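(* Let $R$ be a viable valuation $A$-ring with fraction field $K$, let $K^{\mathrm{a}}$ be an algebraically closed valued field extension of $K$ whose valuation ring $R^{\mathrm{a}}$ is equipped with an $A$-analytic structure making it an $A$-ring extending $R$, and let $Y=(Y_1,\dots,Y_n)$. Then $K\langle Y\rangle$ is noetherian, and for every proper ideal $I$ of $K\langle Y\rangle$: (ii) there is an injective $K$-algebra morphism $K\langle Y_1,\dots,Y_m\rangle\to K\langle Y\rangle/I$ for some $m\le n$, making $K\langle Y\rangle/I$ a finitely generated $K\langle Y_1,\dots,Y_m\rangle$-module; (iii) there is $y\in(R^{\mathrm{a}})^n$ with $f(y)=0$ for all $f\in I$.
   Context: All rings are commutative with $1$. $A$ is a noetherian ring with an ideal $\mathfrak{o}(A)\neq A$ such that $\bigcap_e\mathfrak{o}(A)^e=\{0\}$ and $A$ is $\mathfrak{o}(A)$-adically complete. $A\langle Y_1,\dots,Y_n\rangle$: power series $\sum a_\nu Y^\nu$ over $A$ with $a_\nu\to0$ $\mathfrak{o}(A)$-adically. An $A$-ring is a ring $R$ with ring morphisms $\iota_n:A\langle Y_1,\dots,Y_n\rangle\to\{\text{functions }R^n\to R\}$ ($f(y)=\iota_n(f)(y)$) such that (A1) $Y_k(y)=y_k$; (A2) adding a dummy last variable does not change values; (A3) for $n\ge1$ and $g=f(Y_{n+1},\dots,Y_{2n})$, $\iota_n(f)(y_{n+1},\dots,y_{2n})=\iota_{2n}(g)(y_1,\dots,y_{2n})$. An $A$-ring $R^*$ extends $R$ if $R\subseteq R^*$ is a subring and the operations restrict.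 A valuation $A$-ring is an $A$-ring that is a valuation ring; viable means its maximal ideal equals the ideal generated by $\iota_0(\mathfrak{o}(A))$ and is nonzero. For $h(X,Y)=\sum_\nu h_\nu(X)Y^\nu\in A\langle X,Y\rangle$ and $x\in R^m$ put $h(x,Y)=\sum_\nu h_\nu(x)Y^\nu\in R[[Y]]$; $R\langle Y\rangle\subseteq R[[Y]]$ is the ring of all such $h(x,Y)$, and $K\langle Y\rangle=\{c^{-1}g: c\in R\setminus\{0\},\ g\in R\langle Y\rangle\}\subseteq K[[Y]]$. For $f=c^{-1}h(x,Y)\in K\langle Y\rangle$ and $y\in(R^{\mathrm{a}})^n$, $f(y):=c^{-1}h(x,y)$, computed in the $A$-ring $R^{\mathrm{a}}$ (this is well defined). *)

(* Defs.v *)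
From HB Require Import structures.
From mathcomp Require Import all_boot all_order all_algebra.
From mathcomp Require Import boolp classical_sets functions.
From mathcomp Require Import mpoly ring.

Set Implicit Arguments.
Unset Strict Implicit.
Unset Printing Implicit Defensive.

Import GRing.Theory.

Local Open Scope classical_set_scope.
Local Open Scope ring_scope.


Section Ideals.
Variable R : comNzRingType.
Implicit Types (I S : set R) (e : nat).

Definition is_ideal I : Prop :=
  [/\ I 0, forall a b, I a -> I b -> I (a + b) & forall a b, I b -> I (a * b)].

Definition ideal_gen S : set R :=
  [set a | exists (k : nat) (c s : 'I_k -> R),
             (forall i, S (s i)) /\ a = \sum_(i < k) c i * s i].

Definition ideal_pow I e : set R :=
  ideal_gen [set a | exists b : 'I_e -> R,
                       (forall j, I (b j)) /\ a = \prod_(j < e) b j].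

Definition noetherian : Prop :=
  forall I, is_ideal I -> exists s : seq R, I = ideal_gen [set` s].

Definition maximal_ideal I : Prop :=
  [/\ is_ideal I, ~ I 1
    & forall J, is_ideal J -> ~ J 1 -> I `<=` J -> J = I].

Definition adic_separated I : Prop :=
  \bigcap_(e in [set: nat]) ideal_pow I e = [set 0].

Definition adic_complete I : Prop :=
  forall u : nat -> R,
    (forall e, exists N, forall i j,
       (N <= i)%N -> (N <= j)%N -> ideal_pow I e (u i - u j)) ->
  exists l, forall e, exists N, forall i,
    (N <= i)%N -> ideal_pow I e (u i - l).

Lemma ideal_gen_ideal S : is_ideal (ideal_gen S).
Proof.
split.
- by exists 0%N, (fun=> 0), (fun=> 0); split; [case | rewrite big_ord0].
- move=> a b [k [c [s [sS ->]]]] [l [d [t [tS ->]]]].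
  exists (k + l)%N,
    (fun i : 'I_(k + l) => match fintype.split i with inl x => c x | inr y => d y end),
    (fun i : 'I_(k + l) => match fintype.split i with inl x => s x | inr y => t y end); split.
    by move=> i; case: fintype.split.
  rewrite big_split_ord /=; congr (_ + _); apply: eq_bigr => i _.
    by rewrite (unsplitK (inl i)).
  by rewrite (unsplitK (inr i)).
- move=> a b [k [c [s [sS ->]]]]; exists k, (fun i => a * c i), s; split=> //.
  by rewrite mulr_sumr; apply: eq_bigr => i _; rewrite mulrA.
Qed.

Lemma is_ideal_sum I (J : Type) (r : seq J) (P : pred J) (F : J -> R) :
  is_ideal I -> (forall j, P j -> I (F j)) -> I (\sum_(j <- r | P j) F j).
Proof. by case=> I0 ID _ IF; apply: (big_ind I). Qed.

End Ideals.


Section MnmCat.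
Variables m n : nat.

Definition mnmcat (mu : 'X_{1..m}) (nu : 'X_{1..n}) : 'X_{1..m + n} :=
  [multinom match fintype.split i with inl a => mu a | inr b => nu b end | i < m + n].
Definition mnml (k : 'X_{1..m + n}) : 'X_{1..m} :=
  [multinom k (lshift n i) | i < m].
Definition mnmr (k : 'X_{1..m + n}) : 'X_{1..n} :=
  [multinom k (rshift m i) | i < n].

Lemma mnmcatl mu nu : mnml (mnmcat mu nu) = mu.
Proof. by apply/mnmP => i; rewrite !mnmE (unsplitK (inl i)). Qed.

Lemma mnmcatr mu nu : mnmr (mnmcat mu nu) = nu.
Proof. by apply/mnmP => i; rewrite !mnmE (unsplitK (inr i)). Qed.

Lemma mnmcatK k : mnmcat (mnml k) (mnmr k) = k.
Proof.
apply/mnmP => i; rewrite -[i]splitK mnmE unsplitK.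
by case: (fintype.split i) => j; rewrite mnmE.
Qed.

Lemma mdeg_cat mu nu : mdeg (mnmcat mu nu) = (mdeg mu + mdeg nu)%N.
Proof.
rewrite !mdegE big_split_ord /=; congr addn; apply: eq_bigr => i _.
  by rewrite mnmE (unsplitK (inl i)).
by rewrite mnmE (unsplitK (inr i)).
Qed.

Lemma mdeg_lr k : mdeg k = (mdeg (mnml k) + mdeg (mnmr k))%N.
Proof. by rewrite -{1}[k]mnmcatK mdeg_cat. Qed.

Lemma mnmcat_le mu nu k :
  (k <= mnmcat mu nu)%MM = ((mnml k <= mu)%MM && (mnmr k <= nu)%MM).
Proof.
apply/mnm_lepP/andP => [le_k|[/mnm_lepP lel /mnm_lepP ler] i].
  split; apply/mnm_lepP => i; rewrite mnmE; apply: (leq_trans (le_k _));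
  by rewrite mnmE ?(unsplitK (inl i)) ?(unsplitK (inr i)).
rewrite -[i]splitK mnmE unsplitK; case: (fintype.split i) => j /=.
  by have := lel j; rewrite mnmE.
by have := ler j; rewrite mnmE.
Qed.

Lemma mnmcatB mu nu mu' nu' :
  (mnmcat mu nu - mnmcat mu' nu')%MM = mnmcat (mu - mu')%MM (nu - nu')%MM.
Proof. by apply/mnmP => i; rewrite !mnmE; case: fintype.split => j; rewrite !mnmE. Qed.

Lemma mnmcat0 : mnmcat 0%MM 0%MM = 0%MM.
Proof. by apply/mnmP => i; rewrite !mnmE; case: fintype.split => j; rewrite !mnmE. Qed.

Lemma mnmcat_inj2 mu nu mu' nu' :
  (mnmcat mu nu == mnmcat mu' nu') = (mu == mu') && (nu == nu').
Proof.
apply/eqP/andP => [E|[/eqP-> /eqP->//]].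
have := congr1 mnml E; rewrite !mnmcatl => ->.
by have := congr1 mnmr E; rewrite !mnmcatr => ->.
Qed.

Lemma mnmcat_U (i : 'I_m) : mnmcat U_(i)%MM 0%MM = U_(lshift n i)%MM.
Proof.
apply/mnmP => j; rewrite -[j]splitK mnmE unsplitK mnm1E.
by case: (fintype.split j) => k /=; rewrite ?mnm1E ?mnm0E ?eq_lshift ?eq_lrshift.
Qed.

End MnmCat.


Record mps (n : nat) (R : Type) := MPS { mcoefs :> 'X_{1..n} -> R }.

Section MPSTheory.
Variables (n : nat).

Lemma mpsP (R : Type) (f g : mps n R) : f =1 g <-> f = g.
Proof. by case: f g => f [g]; split=> [/funext /= ->|->]. Qed.

HB.instance Definition _ (R : Type) := gen_eqMixin (mps n R).
HB.instance Definition _ (R : Type) := gen_choiceMixin (mps n R).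

Section Zmod.
Variable R : zmodType.
Implicit Types f g h : mps n R.

Definition mps_zero : mps n R := MPS (fun=> 0).
Definition mps_opp f : mps n R := MPS (fun m => - f m).
Definition mps_add f g : mps n R := MPS (fun m => f m + g m).

Fact mps_addA : associative mps_add.
Proof. by move=> f g h; apply/mpsP => m /=; rewrite addrA. Qed.
Fact mps_addC : commutative mps_add.
Proof. by move=> f g; apply/mpsP => m /=; rewrite addrC. Qed.
Fact mps_add0 : left_id mps_zero mps_add.
Proof. by move=> f; apply/mpsP => m /=; rewrite add0r. Qed.
Fact mps_addN : left_inverse mps_zero mps_opp mps_add.
Proof. by move=> f; apply/mpsP => m /=; rewrite addNr. Qed.

HB.instance Definition _ :=
  GRing.isZmodule.Build (mps n R) mps_addA mps_addC mps_add0 mps_addN.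

Lemma mps0E m : (0 : mps n R) m = 0. Proof. by []. Qed.
Lemma mpsDE f g m : (f + g) m = f m + g m. Proof. by []. Qed.
Lemma mpsNE f m : (- f) m = - f m. Proof. by []. Qed.
Lemma mpsBE f g m : (f - g) m = f m - g m. Proof. by []. Qed.

Lemma mps_sumE (I : Type) (r : seq I) (P : pred I) (F : I -> mps n R) m :
  (\sum_(i <- r | P i) F i) m = \sum_(i <- r | P i) F i m.
Proof. by elim/big_rec2: _ => // i x y _ <-. Qed.

End Zmod.

Section Ring.
Variable R : comNzRingType.
Implicit Types f g h : mps n R.

Definition mpsC (c : R) : mps n R :=
  MPS (fun m => if m == 0%MM then c else 0).
Definition mpsX (i : 'I_n) : mps n R := MPS (fun m => (m == U_(i)%MM)%:R).
Definition mps_mul f g : mps n R :=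
  MPS (fun m => \sum_(k : 'X_{1..n < (mdeg m).+1} | (k <= m)%MM)
                  f k * g (m - k)%MM).

Let trunc d f : {mpoly R[n]} := \sum_(k : 'X_{1..n < d}) f k *: 'X_[k].

Let truncE d f m : (mdeg m < d)%N -> (trunc d f)@_m = f m.
Proof. exact: mcoeff_mpoly. Qed.

Let mulE d f g m : (mdeg m < d)%N -> mps_mul f g m = (trunc d f * trunc d g)@_m.
Proof.
move=> lt_md; rewrite [RHS](mcoeff_poly_mul_lin _ _ (ltnSn (mdeg m))).
apply: eq_bigr => k _; rewrite !truncE //.
  by apply: leq_ltn_trans lt_md; apply: mdegB.
by apply: leq_ltn_trans lt_md; rewrite -ltnS bmdeg.
Qed.

Let eq_mcoeffM d (p p' q q' : {mpoly R[n]}) m : (mdeg m < d)%N ->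
  (forall k, (mdeg k < d)%N -> p@_k = p'@_k) ->
  (forall k, (mdeg k < d)%N -> q@_k = q'@_k) ->
  (p * q)@_m = (p' * q')@_m.
Proof.
move=> lt_md Ep Eq; rewrite !mcoeffM; apply: eq_bigr => k _.
by rewrite Ep ?Eq //; apply: leq_trans (bmdeg _) lt_md.
Qed.

Fact mps_mulA : associative mps_mul.
Proof.
move=> f g h; apply/mpsP => m; pose d := (mdeg m).+1.
have ltd : (mdeg m < d)%N by [].
rewrite !(mulE _ _ ltd).
transitivity (trunc d f * (trunc d g * trunc d h))@_m.
  by apply: (eq_mcoeffM ltd) => // k ltk; rewrite truncE // (mulE _ _ ltk).
rewrite mulrA.
by apply: (eq_mcoeffM ltd) => // k ltk; rewrite truncE // (mulE _ _ ltk).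
Qed.

Fact mps_mulC : commutative mps_mul.
Proof.
by move=> f g; apply/mpsP => m; rewrite !(mulE _ _ (ltnSn _)) mulrC.
Qed.

Fact mps_mul1 : left_id (mpsC 1) mps_mul.
Proof.
move=> f; apply/mpsP => m; rewrite (mulE _ _ (ltnSn _)).
rewrite -[RHS](truncE f (ltnSn (mdeg m))) -[trunc _ f in RHS]mul1r.
apply: (eq_mcoeffM (ltnSn _)) => // k ltk.
by rewrite truncE // mcoeff1 /=; case: eqP.
Qed.

Fact mps_mulD : left_distributive mps_mul +%R.
Proof.
move=> f g h; apply/mpsP => m /=; rewrite -big_split /=.
by apply: eq_bigr => k _; rewrite -mulrDl.
Qed.

Fact mps_1neq0 : mpsC 1 != 0.
Proof.
by apply/eqP => /mpsP/(_ 0%MM)/eqP; rewrite /= eqxx oner_eq0.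
Qed.

HB.instance Definition _ :=
  GRing.Zmodule_isComNzRing.Build (mps n R)
    mps_mulA mps_mulC mps_mul1 mps_mulD mps_1neq0.

Definition mps_scale (c : R) f : mps n R := MPS (fun m => c * f m).

Fact mps_scaleA c d f : mps_scale c (mps_scale d f) = mps_scale (c * d) f.
Proof. by apply/mpsP => m /=; rewrite mulrA. Qed.
Fact mps_scale1 : left_id 1 mps_scale.
Proof. by move=> f; apply/mpsP => m /=; rewrite mul1r. Qed.
Fact mps_scaleDr : right_distributive mps_scale +%R.
Proof. by move=> c f g; apply/mpsP => m /=; rewrite mulrDr. Qed.
Fact mps_scaleDl f : {morph mps_scale^~ f : c d / c + d}.
Proof. by move=> c d; apply/mpsP => m /=; rewrite mulrDl. Qed.

HB.instance Definition _ :=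
  GRing.Zmodule_isLmodule.Build R (mps n R)
    mps_scaleA mps_scale1 mps_scaleDr mps_scaleDl.

Fact mps_scaleAl (c : R) f g : c *: (f * g) = c *: f * g.
Proof.
apply/mpsP => m /=; rewrite mulr_sumr.
by apply: eq_bigr => k _; rewrite mulrA.
Qed.

HB.instance Definition _ :=
  GRing.Lmodule_isLalgebra.Build R (mps n R) mps_scaleAl.
HB.instance Definition _ :=
  GRing.Lalgebra_isComAlgebra.Build R (mps n R).

Lemma mps1E m : (1 : mps n R) m = (m == 0%MM)%:R.
Proof. by rewrite /= /GRing.one /=; case: eqP. Qed.
Lemma mpsZE (c : R) f m : (c *: f) m = c * f m. Proof. by []. Qed.
Lemma mpsME f g m :
  (f * g) m = \sum_(k : 'X_{1..n < (mdeg m).+1} | (k <= m)%MM)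
                f k * g (m - k)%MM.
Proof. by []. Qed.

Definition dvms m : seq 'X_{1..n} :=
  [seq val k | k : 'X_{1..n < (mdeg m).+1} in [pred k | (val k <= m)%MM]].

Lemma dvms_uniq m : uniq (dvms m).
Proof. by rewrite map_inj_uniq ?enum_uniq //; apply: val_inj. Qed.

Lemma mem_dvms m k : (k \in dvms m) = (k <= m)%MM.
Proof.
apply/mapP/idP => [[k' + ->]|le_km]; first by rewrite mem_enum.
have lt_k : (mdeg k < (mdeg m).+1)%N.
  by rewrite ltnS -(submK le_km) mdegD leq_addl.
by exists (BMultinom lt_k); rewrite ?mem_enum.
Qed.

Lemma mpsM_seq f g m (s : seq 'X_{1..n}) :
  uniq s -> (forall k, (k \in s) = (k <= m)%MM) ->
  (f * g) m = \sum_(k <- s) f k * g (m - k)%MM.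
Proof.
move=> us Es; rewrite mpsME [RHS](perm_big (dvms m)) /=.
  by rewrite big_map big_enum.
by apply: uniq_perm => [||k] //; rewrite ?dvms_uniq // Es mem_dvms.
Qed.

End Ring.

Definition mps_map (R S : Type) (u : R -> S) (f : mps n R) : mps n S :=
  MPS (fun m => u (f m)).

End MPSTheory.



Section Tate.
Variables (A : comNzRingType) (oA : idealr A).

Local Notation opow := (ideal_pow [set` oA]).

Lemma opow_ideal e : is_ideal (opow e).
Proof. exact: ideal_gen_ideal. Qed.

(* [a_nu -> 0]: there are finitely many multi-indices of each degree, so
   it suffices to bound the degree of the exceptional ones. *)
Definition restricted n : {pred mps n A} :=
  [pred f : mps n A | `[< forall e, exists d, forall m,
                            (d <= mdeg m)%N -> opow e (f m) >]].

Lemma restrictedP n (f : mps n A) :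
  reflect (forall e, exists d, forall m, (d <= mdeg m)%N -> opow e (f m))
          (f \in @restricted n).
Proof. exact: asboolP. Qed.

Lemma restricted_finsupp n (f : mps n A) d :
  (forall m, (d <= mdeg m)%N -> f m = 0) -> f \in @restricted n.
Proof.
move=> f0; apply/restrictedP => e; exists d => m /f0 ->.
by case: (opow_ideal e).
Qed.

Fact restricted_subring n : subring_closed (@restricted n).
Proof.
split=> [|f g /restrictedP rf /restrictedP rg|f g /restrictedP rf /restrictedP rg].
- apply: (@restricted_finsupp _ _ 1) => m; rewrite mps1E.
  by case: eqP => // ->; rewrite mdeg0.
- apply/restrictedP => e; have [d1 f1] := rf e; have [d2 g2] := rg e.
  exists (maxn d1 d2) => m; rewrite geq_max => /andP[le1 le2].
  have [_ oD oM] := opow_ideal e; rewrite mpsBE.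
  by apply: oD; [exact: f1 | rewrite -mulN1r; apply/oM/g2].
- apply/restrictedP => e; have [d1 f1] := rf e; have [d2 g2] := rg e.
  have [_ _ oM] := opow_ideal e.
  exists (d1 + d2)%N => m le_m; rewrite mpsME.
  apply: is_ideal_sum (opow_ideal e) _ => k le_km.
  have [le_k|lt_k] := leqP d1 (mdeg k); first by rewrite mulrC; apply/oM/f1.
  apply/oM/g2; rewrite -(leq_add2l (mdeg k)) -mdegD addmC submK //.
  by apply: leq_trans le_m; rewrite leq_add2r ltnW.
Qed.

HB.instance Definition _ n :=
  GRing.isSubringClosed.Build (mps n A) (@restricted n) (@restricted_subring n).

(* [A<Y_1..Y_n>] *)
Record tate n := Tate { tate_val :> mps n A; _ : tate_val \in @restricted n }.

HB.instance Definition _ n := [isSub for @tate_val n].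
HB.instance Definition _ n := [Choice of tate n by <:].
HB.instance Definition _ n := [SubChoice_isSubComNzRing of tate n by <:].

Lemma tateP n (f g : tate n) : (forall m, f m = g m) <-> f = g.
Proof. by split=> [fg|-> //]; apply/val_inj/mpsP. Qed.

Lemma tate_valP n (f : tate n) : tate_val f \in @restricted n.
Proof. by case: f. Qed.

Fact tateC_subproof n (a : A) : mpsC n a \in @restricted n.
Proof.
apply: (@restricted_finsupp _ _ 1) => m /=.
by case: eqP => // ->; rewrite mdeg0.
Qed.

Definition tateC n (a : A) : tate n := Tate (tateC_subproof n a).

Fact tateX_subproof n (i : 'I_n) : mpsX A i \in @restricted n.
Proof.
apply: (@restricted_finsupp _ _ 2) => m /=.
by case: eqP => // ->; rewrite mdeg1.
Qed.

Definition tateX n (i : 'I_n) : tate n := Tate (tateX_subproof i).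

(* [tate_lift p f] is [f(Y_1..Y_n)], and [tate_shift p f] is
   [f(Y_(p+1)..Y_(p+n))]. *)
Fact tate_lift_subproof n p (f : tate n) :
  MPS (fun k : 'X_{1..n + p} => if mnmr k == 0%MM then f (mnml k) else 0)
    \in @restricted (n + p).
Proof.
apply/restrictedP => e; have /restrictedP/(_ e)[d fd] := tate_valP f.
exists d => k le_k /=; case: eqP => [k0|_]; last by case: (opow_ideal e).
by apply: fd; rewrite mdeg_lr k0 mdeg0 addn0 in le_k.
Qed.

Definition tate_lift n p (f : tate n) : tate (n + p) :=
  Tate (tate_lift_subproof p f).

Fact tate_shift_subproof n p (f : tate n) :
  MPS (fun k : 'X_{1..p + n} => if mnml k == 0%MM then f (mnmr k) else 0)
    \in @restricted (p + n).
Proof.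
apply/restrictedP => e; have /restrictedP/(_ e)[d fd] := tate_valP f.
exists d => k le_k /=; case: eqP => [k0|_]; last by case: (opow_ideal e).
by apply: fd; rewrite mdeg_lr k0 mdeg0 add0n in le_k.
Qed.

Definition tate_shift n p (f : tate n) : tate (p + n) :=
  Tate (tate_shift_subproof p f).

(* [tate_coef h nu] is [h_nu(X)], where [h(X, Y) = \sum_nu h_nu(X) Y^nu]. *)
Fact tate_coef_subproof m n (h : tate (m + n)) (nu : 'X_{1..n}) :
  MPS (fun mu => h (mnmcat mu nu)) \in @restricted m.
Proof.
apply/restrictedP => e; have /restrictedP/(_ e)[d hd] := tate_valP h.
exists d => k le_k /=; apply: hd; rewrite mdeg_cat.
exact: leq_trans le_k (leq_addr _ _).
Qed.

Definition tate_coef m n (h : tate (m + n)) (nu : 'X_{1..n}) : tate m :=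
  Tate (tate_coef_subproof h nu).

Lemma tate_val_sum n (I : Type) (r : seq I) (P : pred I) (F : I -> tate n) m :
  (\sum_(i <- r | P i) F i) m = \sum_(i <- r | P i) F i m.
Proof. by elim/big_rec2: _ => // i x y _ <-. Qed.

Lemma tate_coefB m n (h h' : tate (m + n)) nu :
  tate_coef (h - h') nu = tate_coef h nu - tate_coef h' nu.
Proof. by apply/tateP. Qed.

Lemma tate_coefD m n (h h' : tate (m + n)) nu :
  tate_coef (h + h') nu = tate_coef h nu + tate_coef h' nu.
Proof. by apply/tateP. Qed.

Lemma tate_coefM m n (h h' : tate (m + n)) nu :
  tate_coef (h * h') nu =
  \sum_(k <- dvms nu) tate_coef h k * tate_coef h' (nu - k)%MM.
Proof.
apply/tateP => mu; rewrite tate_val_sum.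
pose s := [seq mnmcat l k | k <- dvms nu, l <- dvms mu].
have -> : tate_coef (h * h') nu mu = (tate_val h * tate_val h') (mnmcat mu nu) by [].
rewrite (mpsM_seq _ _ (s := s)).
- rewrite big_allpairs_dep; apply: eq_bigr => k _ /=.
  transitivity
    ((tate_val (tate_coef h k) * tate_val (tate_coef h' (nu - k)%MM)) mu); last by [].
  rewrite (mpsM_seq _ _ (dvms_uniq mu) (mem_dvms mu)).
  by apply: eq_bigr => l _; rewrite mnmcatB.
- apply: allpairs_uniq; rewrite ?dvms_uniq //.
  move=> [k l] [k' l'] _ _ /= /eqP.
  by rewrite mnmcat_inj2 => /andP[/eqP-> /eqP->].
- move=> k; apply/allpairsP/idP => [[[a b] /= [+ + ->]]|le_k].
    by rewrite !mem_dvms mnmcat_le mnmcatl mnmcatr => -> ->.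
  exists (mnmr k, mnml k) => /=; rewrite !mem_dvms mnmcatK.
  by move: le_k; rewrite mnmcat_le => /andP[].
Qed.

End Tate.

Arguments tateC {A oA} n a.
Arguments tateX {A oA n} i.
Arguments tate_lift {A oA n} p f.
Arguments tate_shift {A oA n} p f.


Record Aring_structure (A : comNzRingType) (oA : idealr A) (R : comNzRingType) :=
  AringStructure {
    iota_ : forall n, {rmorphism tate oA n -> ('rV[R]_n -> R)};
    iota_var : forall n (k : 'I_n) (y : 'rV[R]_n), iota_ n (tateX k) y = y 0 k;
    iota_dummy : forall n (f : tate oA n) (y : 'rV[R]_(n + 1)),
      iota_ (n + 1)%N (tate_lift 1 f) y = iota_ n f (lsubmx y);
    iota_shift : forall n (f : tate oA n) (y : 'rV[R]_(n + n)), (0 < n)%N ->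
      iota_ n f (rsubmx y) = iota_ (n + n)%N (tate_shift n f) y
  }.

Section Specialization.
Variables (A : comNzRingType) (oA : idealr A) (R : comNzRingType).
Variables (iR : Aring_structure oA R) (n : nat).

(* [spec h x] is [h(x, Y)]. *)
Definition spec m (h : tate oA (m + n)) (x : 'rV[R]_m) : mps n R :=
  MPS (fun nu => iota_ iR m (tate_coef h nu) x).

(* [R<Y_1..Y_n>] *)
Definition Rtate : {pred mps n R} :=
  [pred g : mps n R | `[< exists m (h : tate oA (m + n)) (x : 'rV[R]_m),
                            g = spec h x >]].

Lemma RtateP g :
  reflect (exists m (h : tate oA (m + n)) (x : 'rV[R]_m), g = spec h x)
          (g \in Rtate).
Proof. exact: asboolP. Qed.

Let iotaD m (f g : tate oA m) y :
  iota_ iR m (f + g) y = iota_ iR m f y + iota_ iR m g y.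
Proof. by rewrite rmorphD. Qed.

Let iotaB m (f g : tate oA m) y :
  iota_ iR m (f - g) y = iota_ iR m f y - iota_ iR m g y.
Proof. by rewrite rmorphB. Qed.

Let iotaM m (f g : tate oA m) y :
  iota_ iR m (f * g) y = iota_ iR m f y * iota_ iR m g y.
Proof. by rewrite rmorphM. Qed.

Let iota0 m y : iota_ iR m 0 y = 0.
Proof. by rewrite rmorph0. Qed.

Let iota1 m y : iota_ iR m 1 y = 1.
Proof. by rewrite rmorph1. Qed.

Let iota_sum m (I : Type) (r : seq I) (F : I -> tate oA m) y :
  iota_ iR m (\sum_(i <- r) F i) y = \sum_(i <- r) iota_ iR m (F i) y.
Proof.
elim: r => [|i r IH]; first by rewrite !big_nil iota0.
by rewrite !big_cons iotaD IH.
Qed.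

Lemma specB m (h h' : tate oA (m + n)) x :
  spec (h - h') x = spec h x - spec h' x.
Proof. by apply/mpsP => nu /=; rewrite tate_coefB iotaB. Qed.

Lemma specD m (h h' : tate oA (m + n)) x :
  spec (h + h') x = spec h x + spec h' x.
Proof. by apply/mpsP => nu /=; rewrite tate_coefD iotaD. Qed.

Lemma specM m (h h' : tate oA (m + n)) x :
  spec (h * h') x = spec h x * spec h' x.
Proof.
apply/mpsP => nu; rewrite (mpsM_seq _ _ (dvms_uniq nu) (mem_dvms nu)) /=.
by rewrite tate_coefM iota_sum; apply: eq_bigr => k _; rewrite iotaM.
Qed.

Lemma spec1 m (x : 'rV[R]_m) : spec 1 x = 1.
Proof.
apply/mpsP => nu; rewrite mps1E /=.
have -> : tate_coef 1 nu = (nu == 0%MM)%:R :> tate oA m.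
  apply/tateP => mu.
  have -> : tate_coef 1 nu mu = (1 : mps (m + n) A) (mnmcat mu nu) by [].
  rewrite mps1E -(mnmcat0 m n) mnmcat_inj2.
  case: (nu == 0%MM); rewrite ?andbF // andbT.
  by have -> : (1 : tate oA m) mu = (1 : mps m A) mu by []; rewrite mps1E.
by case: eqP => _; rewrite ?iota0 ?iota1.
Qed.

Lemma spec_cst m (x : 'rV[R]_m) (i : 'I_m) :
  spec (tateX (lshift n i)) x = mpsC n (x 0 i).
Proof.
apply/mpsP => nu /=.
case: eqP => [->|nu0].
  rewrite -(iota_var iR); congr (iota_ iR m _ x); apply/tateP => mu /=.
  by rewrite -mnmcat_U mnmcat_inj2 eqxx andbT.
rewrite -[RHS](iota0 x); congr (iota_ iR m _ x); apply/tateP => mu /=.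
by rewrite -mnmcat_U mnmcat_inj2 (introF eqP nu0) andbF.
Qed.

Fact liftX_subproof m p (h : tate oA (m + n)) :
  MPS (fun k : 'X_{1..(m + p) + n} =>
         if mnmr (mnml k) == 0%MM then h (mnmcat (mnml (mnml k)) (mnmr k))
         else 0)
    \in @restricted A oA (m + p + n)%N.
Proof.
apply/restrictedP => e; have /restrictedP/(_ e)[d hd] := tate_valP h.
exists d => k le_k /=; case: eqP => [k0|_]; last by case: (opow_ideal oA e).
by apply: hd; rewrite mdeg_lr [mdeg (mnml k)]mdeg_lr k0 mdeg0 addn0 -mdeg_cat in le_k.
Qed.

Let liftX m p (h : tate oA (m + n)) : tate oA (m + p + n) :=
  Tate (liftX_subproof p h).

Fact shiftX_subproof m p (h : tate oA (m + n)) :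
  MPS (fun k : 'X_{1..(p + m) + n} =>
         if mnml (mnml k) == 0%MM then h (mnmcat (mnmr (mnml k)) (mnmr k))
         else 0)
    \in @restricted A oA (p + m + n)%N.
Proof.
apply/restrictedP => e; have /restrictedP/(_ e)[d hd] := tate_valP h.
exists d => k le_k /=; case: eqP => [k0|_]; last by case: (opow_ideal oA e).
by apply: hd; rewrite mdeg_lr [mdeg (mnml k)]mdeg_lr k0 mdeg0 add0n -mdeg_cat in le_k.
Qed.

Let shiftX m p (h : tate oA (m + n)) : tate oA (p + m + n) :=
  Tate (shiftX_subproof p h).

Let spec_lift m (h : tate oA (m + n)) (y : 'rV[R]_(m + 1)) :
  spec (liftX 1 h) y = spec h (lsubmx y).
Proof.
apply/mpsP => nu /=; rewrite -iota_dummy; congr (iota_ iR _ _ y).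
by apply/tateP => mu /=; rewrite mnmcatl mnmcatr.
Qed.

Let spec_shift m (h : tate oA (m + n)) (y : 'rV[R]_(m + m)) : (0 < m)%N ->
  spec (shiftX m h) y = spec h (rsubmx y).
Proof.
move=> m_gt0; apply/mpsP => nu /=; rewrite iota_shift //.
congr (iota_ iR _ _ y).
by apply/tateP => mu /=; rewrite mnmcatl mnmcatr.
Qed.

Let rep N (y : nat -> R) g :=
  exists h : tate oA (N + n), g = spec h (\row_(i < N) y i).

Let rep_le M N y g : (M <= N)%N -> rep M y g -> rep N y g.
Proof.
move=> /subnK <-; elim: (N - M)%N => // k IH /IH [h ->].
suff : rep (k + M + 1) y (spec h (\row_(i < k + M) y i)) by rewrite addn1.
exists (liftX 1 h); rewrite spec_lift; congr (spec h _).
by apply/rowP => i; rewrite !mxE.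
Qed.

Let rep_shift N y y' g : (0 < N)%N -> (forall i, (i < N)%N -> y (N + i)%N = y' i) ->
  rep N y' g -> rep (N + N) y g.
Proof.
move=> N_gt0 Ey [h ->]; exists (shiftX N h); rewrite spec_shift //.
by congr (spec h _); apply/rowP => i; rewrite !mxE /= Ey.
Qed.

Let rep_eq N y y' g : (forall i, (i < N)%N -> y i = y' i) ->
  rep N y g -> rep N y' g.
Proof.
by move=> Ey [h ->]; exists h; congr (spec h _); apply/rowP => i; rewrite !mxE Ey.
Qed.

Let repP g : g \in Rtate -> exists N y, rep N y g.
Proof.
case/RtateP => m [h [x ->]].
exists m, (fun i => if insub i is Some j then x 0 j else 0), h.
by congr (spec h _); apply/rowP => i; rewrite mxE valK.
Qed.

Lemma Rtate_pair g g' : g \in Rtate -> g' \in Rtate ->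
  exists m (h h' : tate oA (m + n)) (x : 'rV[R]_m),
    g = spec h x /\ g' = spec h' x.
Proof.
move=> /repP[m [y gP]] /repP[m' [y' g'P]].
pose N := (maxn m m').+1.
have gN : rep N y g by apply: rep_le gP; rewrite ltnW // ltnS leq_maxl.
have g'N : rep N y' g' by apply: rep_le g'P; rewrite ltnW // ltnS leq_maxr.
pose z i := if (i < N)%N then y i else y' (i - N)%N.
have [h ->] : rep (N + N) z g.
  apply: (rep_le (leq_addr N N)); apply: rep_eq gN => i lt_iN.
  by rewrite /z lt_iN.
have [h' ->] : rep (N + N) z g'.
  apply: rep_shift g'N => // i lt_iN.
  by rewrite /z ltnNge leq_addr /= addKn.
by exists (N + N)%N, h, h', (\row_(i < N + N) z i).
Qed.

Fact Rtate_subring : subring_closed Rtate.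
Proof.
split=> [|g g' gR g'R|g g' gR g'R].
- by apply/RtateP; exists 0%N, 1, 0; rewrite spec1.
- have [m [h [h' [x [-> ->]]]]] := Rtate_pair gR g'R.
  by apply/RtateP; exists m, (h - h'), x; rewrite specB.
- have [m [h [h' [x [-> ->]]]]] := Rtate_pair gR g'R.
  by apply/RtateP; exists m, (h * h'), x; rewrite specM.
Qed.

HB.instance Definition _ :=
  GRing.isSubringClosed.Build (mps n R) Rtate Rtate_subring.

Lemma RtateC c : mpsC n c \in Rtate.
Proof.
apply/RtateP; exists 1%N, (tateX (lshift n 0)), (const_mx c).
by rewrite spec_cst mxE.
Qed.

Lemma mpsCM (c : R) (g : mps n R) : mpsC n c * g = c *: g.
Proof.
rewrite -[g in RHS]mul1r scalerAl; congr (_ * _).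
by apply/mpsP => nu; rewrite mpsZE mps1E /=; case: eqP => _; rewrite ?mulr1 ?mulr0.
Qed.

Lemma RtateZ c g : g \in Rtate -> c *: g \in Rtate.
Proof. by move=> gR; rewrite -mpsCM rpredM // RtateC. Qed.

End Specialization.

(* ['rV[R]_0] has a single point, so [iota_0] is a map [A -> R] on constants. *)
Definition viable (A : comNzRingType) (oA : idealr A) (R : comNzRingType)
    (iR : Aring_structure oA R) : Prop :=
  let oR := ideal_gen [set iota_ iR 0 (tateC 0 a) 0 | a in [set` oA]] in
  maximal_ideal oR /\ oR <> [set 0].

(* [Rs] extends [R] along the inclusion [e : R -> Rs]. *)
Definition extends (A : comNzRingType) (oA : idealr A) (R Rs : comNzRingType)
    (iR : Aring_structure oA R) (iRs : Aring_structure oA Rs)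
    (e : {rmorphism R -> Rs}) : Prop :=
  injective e /\
  forall n (f : tate oA n) (y : 'rV[R]_n),
    e (iota_ iR n f y) = iota_ iRs n f (map_mx e y).


(* By [vringP], [K] is the fraction field of the subring. *)
Record valuation_subring (K : fieldType) := ValuationSubring {
  vset : {pred K};
  vring :> subIdomainType vset;
  vringP : forall z : K, z != 0 -> z \in vset \/ z^-1 \in vset
}.

Arguments Rtate {A oA R} iR n.

Section KTate.
Variables (A : comNzRingType) (oA : idealr A) (K : fieldType).
Variables (R : valuation_subring K) (iR : Aring_structure oA R) (n : nat).

Definition Ktate_pred : {pred mps n K} :=
  [pred f : mps n K | `[< exists (c : R) (g : mps n R),
      [/\ c != 0, g \in Rtate iR n & f = (val c)^-1 *: mps_map val g] >]].

Lemma Ktate_predP f :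
  reflect (exists (c : R) (g : mps n R),
             [/\ c != 0, g \in Rtate iR n & f = (val c)^-1 *: mps_map val g])
          (f \in Ktate_pred).
Proof. exact: asboolP. Qed.

Let frac (z : K) : exists a b : R, b != 0 /\ z = val a / val b.
Proof.
have [->|z0] := eqVneq z 0.
  by exists 0, 1; rewrite oner_neq0 rmorph0 mul0r.
case: (vringP R z0) => [zV|zV].
  by exists (Sub z zV : R), 1; rewrite oner_neq0 SubK rmorph1 divr1.
exists 1, (Sub z^-1 zV : R); rewrite rmorph1 SubK invrK mul1r; split=> //.
apply: contra_neq z0 => /(congr1 val); rewrite SubK rmorph0 => /eqP.
by rewrite invr_eq0 => /eqP.
Qed.

Let mapD (f g : mps n R) :
  mps_map val (f + g) = mps_map val f + mps_map val g :> mps n K.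
Proof. by apply/mpsP => m /=; rewrite rmorphD. Qed.

Let mapZ c (f : mps n R) :
  mps_map val (c *: f) = val c *: mps_map val f :> mps n K.
Proof. by apply/mpsP => m /=; rewrite rmorphM. Qed.

Let mapM (f g : mps n R) :
  mps_map val (f * g) = mps_map val f * mps_map val g :> mps n K.
Proof.
apply/mpsP => m /=; rewrite rmorph_sum; apply: eq_bigr => k _.
by rewrite rmorphM.
Qed.

Let map1 : mps_map val (1 : mps n R) = 1 :> mps n K.
Proof.
apply/mpsP => m; rewrite mps1E [LHS]/=.
by case: eqP => _; rewrite ?rmorph1 ?rmorph0.
Qed.

Let val_neq0 (c : R) : c != 0 -> val c != 0.
Proof. by apply: contra_neq => c0; apply: val_inj; rewrite c0 rmorph0. Qed.

Fact Ktate_subalg : subalg_closed Ktate_pred.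
Proof.
split=> [|z _ _ /Ktate_predP[c [g [c0 gR ->]]] /Ktate_predP[d [h [d0 hR ->]]]
        |_ _ /Ktate_predP[c [g [c0 gR ->]]] /Ktate_predP[d [h [d0 hR ->]]]].
- apply/Ktate_predP; exists 1, 1.
  by rewrite oner_neq0 rpred1 map1 rmorph1 invr1 scale1r.
- have [a [b [b0 ->]]] := frac z; apply/Ktate_predP.
  exists (b * c * d), ((a * d) *: g + (b * c) *: h).
  split; [by rewrite !mulf_neq0 | by rewrite rpredD ?RtateZ |].
  rewrite mapD !mapZ scalerDr !scalerA !rmorphM /=.
  by congr (_ *: _ + _ *: _); field; rewrite !val_neq0.
- apply/Ktate_predP; exists (c * d), (g * h).
  split; [by rewrite mulf_neq0 | by rewrite rpredM |].
  by rewrite mapM rmorphM invfM -scalerAl -scalerAr scalerA.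
Qed.

HB.instance Definition _ :=
  GRing.isSubalgClosed.Build K (mps n K) Ktate_pred
    (GRing.subalg_closed_semi Ktate_subalg).

(* [K<Y_1..Y_n>] *)
Record Ktate := KTate { ktval :> mps n K; _ : ktval \in Ktate_pred }.

HB.instance Definition _ := [isSub for ktval].
HB.instance Definition _ := [Choice of Ktate by <:].
HB.instance Definition _ := [SubChoice_isSubComNzRing of Ktate by <:].
HB.instance Definition _ := [SubZmodule_isSubLmodule of Ktate by <:].
HB.instance Definition _ := [SubNzRing_SubLmodule_isSubLalgebra of Ktate by <:].
End KTate.

Arguments Ktate {A oA K R} iR n.

(* [f(y) = v], where [f = c^-1 h(x, Y)] and [f(y) = c^-1 h(x, y)] is computed
   in the extension [Rs].  A relation rather than a function, since the
   independence of [f(y)] from the choice of [c], [h] and [x] is a theorem. *)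
Definition Ktate_eval (A : comNzRingType) (oA : idealr A) (K Ks : fieldType)
    (R : valuation_subring K) (Rs : valuation_subring Ks)
    (iR : Aring_structure oA R) (iRs : Aring_structure oA Rs)
    (e : {rmorphism R -> Rs}) (n : nat)
    (f : Ktate iR n) (y : 'rV[Rs]_n) (v : Ks) : Prop :=
  exists (c : R) (m : nat) (h : tate oA (m + n)) (x : 'rV[R]_m),
    [/\ c != 0,
        ktval f = (val c)^-1 *: mps_map val (spec iR h x)
      & v = (val (e c))^-1 * val (iota_ iRs (m + n)%N h (row_mx (map_mx e x) y))].

Lemma Ktate_eval_ex (A : comNzRingType) (oA : idealr A) (K Ks : fieldType)
    (R : valuation_subring K) (Rs : valuation_subring Ks)
    (iR : Aring_structure oA R) (iRs : Aring_structure oA Rs)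
    (e : {rmorphism R -> Rs}) (n : nat) (f : Ktate iR n) (y : 'rV[Rs]_n) :
  exists v, Ktate_eval iRs e f y v.
Proof.
case: f => f fP; have /Ktate_predP[c [g [c0 /RtateP[m [h [x Eg]]] Ef]]] := fP.
eexists; exists c, m, h, x; split=> //=; first by rewrite Ef Eg.
Qed.

(* Main.v *)
From HB Require Import structures.
From mathcomp Require Import all_boot all_order all_algebra.
From mathcomp Require Import boolp classical_sets functions.
From mathcomp Require Import mpoly ring.
Require Import Defs.

Set Implicit Arguments.
Unset Strict Implicit.
Unset Printing Implicit Defensive.
Import GRing.Theory.
Local Open Scope classical_set_scope.
Local Open Scope ring_scope.
Local Open Scope quotient_scope.

(* Every ideal b of the complete ring A<X> is closed: by Hilbert's basis theorem the
   leading forms of b are generated by finitely many of them, and successive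
   approximation lifts this to the closure of b.  Hence the kernel of every evaluation
   A<X> -> R is closed, so evaluations commute with substitution, and every h(X, Y) is a
   finite combination of its coefficients h_nu(X).  In a valuation ring one of these
   finitely many values h_nu(x) divides the others, so a nonzero f in K<Y> is a scalar
   times a series in R<Y> with a coefficient 1 and finitely many coefficients outside the
   maximal ideal.  As the latter is generated by the image of some a in o(A), f lifts to
   an F in A<X, Y> which modulo o(A) is monic in Y_0 over the series in X and the
   Y_j - Y_0^(M^j); Weierstrass division by F in the complete ring A<X, Y> then
   specializes to K<Y>.
   So K<Y>/(f) is finite over a copy of K<Y'> with one variable less, and noetherianity
   and Noether normalization follow by induction on n.  For a morphism pi : K<Y> -> Q
   killing f, a zero y' of the kernel of pi on K<Y'> lifts: if P is the monic relation
   for Y_0 and no root of P over y' were a zero of all polynomials killed by pi, one of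
   these, p, would have no common root with P over y', and the resultant of P and p would
   be killed by pi without vanishing at y'. *)

(** * Noetherian rings *)

(** The axioms of an [A]-ring mention neither continuity nor composition, and [R] has no usable
    topology: its rank may exceed one, and it may be neither complete nor separated for the powers
    of its maximal ideal. Limits are therefore taken only in the rings [A<X, Y>], and what is built
    there is carried over by plain ring morphisms, with closed kernels in place of continuity.
    Elements of [R] enter as values of the variables [X] at a parameter point [x]; finitely many
    data can always be moved to one common point. The exponents [M^j] come from digits: [M] exceeds
    every exponent of a monomial whose coefficient lies outside the maximal ideal, so these
    monomials acquire distinct degrees in [Y_0] and a single one dominates. Normalization and the
    zeros are proved for a morphism [pi] to a nonzero ring rather than for a proper ideal, because
    [pi \o psi] is then the next instance of the induction. The resultant argument works over such
    an arbitrary [Q], without choosing a maximal ideal or embedding a residue field into [Ka]. *)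

Section IdealGenerators.
Variable R : comNzRingType.
Implicit Types (I J S : set R) (s : seq R).

Lemma is_idealB I a b : is_ideal I -> I a -> I b -> I (a - b).
Proof. by case=> I0 ID IM Ia Ib; rewrite -mulN1r; apply/ID/IM. Qed.

Lemma sub_ideal_gen S : S `<=` ideal_gen S.
Proof.
move=> x Sx; exists 1%N, (fun=> 1), (fun=> x); split=> //.
by rewrite big_ord1 mul1r.
Qed.

Lemma ideal_gen_min S I : is_ideal I -> S `<=` I -> ideal_gen S `<=` I.
Proof.
move=> idI sSI _ [k [c [x [Sx ->]]]]; apply: is_ideal_sum (idI) _ => i _.
by case: idI => _ _; apply; apply/sSI/Sx.
Qed.

Lemma ideal_gen_mono S S' : S `<=` S' -> ideal_gen S `<=` ideal_gen S'.
Proof.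
move=> sS; apply: ideal_gen_min (ideal_gen_ideal _) _ => x /sS.
exact: sub_ideal_gen.
Qed.

Lemma ideal_gen_seqP s a : ideal_gen [set` s] a ->
  exists c : 'I_(size s) -> R, a = \sum_(i < size s) c i * s`_i.
Proof.
pose I : set R := [set a | exists c : 'I_(size s) -> R,
                             a = \sum_(i < size s) c i * s`_i].
apply: (@ideal_gen_min _ I).
  split=> [|_ _ [c ->] [d ->]|x _ [c ->]].
  - by exists (fun=> 0); rewrite big1 // => i _; rewrite mul0r.
  - exists (fun i => c i + d i); rewrite -big_split /=.
    by apply: eq_bigr => i _; rewrite mulrDl.
  - exists (fun i => x * c i); rewrite mulr_sumr.
    by apply: eq_bigr => i _; rewrite mulrA.
move=> x /= xs; have lt_x : (index x s < size s)%N by rewrite index_mem.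
exists (fun i => (i == Ordinal lt_x)%:R).
rewrite (bigD1 (Ordinal lt_x)) //= eqxx mul1r nth_index // big1 ?addr0 //.
by move=> i /negPf ->; rewrite mul0r.
Qed.

(** Each of finitely many generators involves only finitely many elements of [S]. Having generators
    inside [S] matters because membership in [S] will carry a witness: a polynomial or series with
    the given leading term. *)
Lemma noetherian_gen S : noetherian R ->
  exists s, [set` s] `<=` S /\ ideal_gen S `<=` ideal_gen [set` s].
Proof.
move=> /(_ _ (ideal_gen_ideal S))[t tE].
suff : forall u : seq R, [set` u] `<=` ideal_gen S ->
    exists s, [set` s] `<=` S /\ [set` u] `<=` ideal_gen [set` s].
  case/(_ t) => [|s [sS ts]]; first by rewrite tE; exact: sub_ideal_gen.
  exists s; split=> //; rewrite tE; apply: ideal_gen_min => //.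
  exact: ideal_gen_ideal.
elim=> [|x u IH] uS; first by exists [::]; split.
have [y yu|s [sS us]] := IH; first by apply: uS; rewrite /= inE; apply/orP; right.
have /uS [k [c [v [vS xE]]]] : [set` x :: u] x by rewrite /= mem_head.
exists (codom v ++ s); split.
  by move=> y; rewrite /= mem_cat => /orP[/codomP[i ->]|/sS].
move=> y; rewrite /= inE => /orP[/eqP->|/us]; last first.
  by apply: ideal_gen_mono => z; rewrite /= mem_cat orbC => ->.
rewrite xE; apply: is_ideal_sum; first exact: ideal_gen_ideal.
move=> i _; have [_ _ gM] := ideal_gen_ideal [set` codom v ++ s].
by apply/gM/sub_ideal_gen; rewrite /= mem_cat codom_f.
Qed.

End IdealGenerators.

Section NoetherianTransfer.
Variables (R S : comNzRingType) (psi : {rmorphism R -> S}).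

Let submodule (M : set S) : Prop :=
  [/\ M 0, forall a b, M a -> M b -> M (a + b)
    & forall r a, M a -> M (psi r * a)].

(** Induction on [d]: the coefficients that occur at the last [b d] form an ideal [L] of [R], and
    lifts of generators of [L] reduce [N] to the span of the earlier [b i]. Finite generation is
    phrased as minimality among submodules containing [s]. *)
Lemma noetherian_submodule (b : nat -> S) d (N : set S) :
  noetherian R -> submodule N ->
  (forall x, N x -> exists r : 'I_d -> R, x = \sum_(i < d) psi (r i) * b i) ->
  exists s : seq S, [set` s] `<=` N /\
    forall M, submodule M -> [set` s] `<=` M -> N `<=` M.
Proof.
move=> nR; elim: d N => [|d IH] N [N0 ND NM] Nb.
  exists [::]; split=> // M [M0 _ _] _ x /Nb[r ->].
  by rewrite big_ord0.
pose L : set R := [set a | exists2 x, N x & exists r : 'I_d -> R,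
                     x = \sum_(i < d) psi (r i) * b i + psi a * b d].
have idL : is_ideal L.
  split.
  - exists 0 => //; exists (fun=> 0).
    by rewrite big1 => [|i _]; rewrite rmorph0 mul0r ?addr0.
  - move=> a a' [x Nx [r xE]] [x' Nx' [r' x'E]]; exists (x + x'); first exact: ND.
    exists (fun i => r i + r' i); rewrite xE x'E addrACA rmorphD mulrDl.
    congr (_ + _); rewrite -big_split /=.
    by apply: eq_bigr => i _; rewrite rmorphD mulrDl.
  - move=> c a [x Nx [r xE]]; exists (psi c * x); first exact: NM.
    exists (fun i => c * r i); rewrite xE mulrDr mulr_sumr rmorphM mulrA.
    by congr (_ + _); apply: eq_bigr => i _; rewrite rmorphM mulrA.
have [t tE] := nR L idL.
have /choice[h hP] : forall a, exists x, a \in t -> N x /\ exists r : 'I_d -> R,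
                     x = \sum_(i < d) psi (r i) * b i + psi a * b d.
  move=> a; have [at_|] := boolP (a \in t); last by exists 0.
  have : L a by rewrite tE; apply: sub_ideal_gen.
  by case=> x Nx rP; exists x.
pose N' : set S := N `&` [set x | exists r : 'I_d -> R,
                                     x = \sum_(i < d) psi (r i) * b i].
have [s' [s'N s'P]] : exists s : seq S, [set` s] `<=` N' /\
    forall M, submodule M -> [set` s] `<=` M -> N' `<=` M.
  apply: IH => [|x []//]; split.
  - split=> //; exists (fun=> 0).
    by rewrite big1 // => i _; rewrite rmorph0 mul0r.
  - move=> x x' [Nx [r xE]] [Nx' [r' x'E]]; split; first exact: ND.
    exists (fun i => r i + r' i); rewrite xE x'E -big_split /=.
    by apply: eq_bigr => i _; rewrite rmorphD mulrDl.
  - move=> c x [Nx [r xE]]; split; first exact: NM.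
    exists (fun i => c * r i); rewrite xE mulr_sumr.
    by apply: eq_bigr => i _; rewrite rmorphM mulrA.
exists (map h t ++ s'); split.
  move=> x; rewrite /= mem_cat => /orP[/mapP[a at_ ->]|/s'N[]//].
  by have [] := hP a at_.
move=> M [M0 MD MM] sM x Nx.
have [r xE] := Nb x Nx; rewrite big_ord_recr /= in xE.
have : L (r ord_max) by exists x => //; eexists; exact: xE.
rewrite tE => /ideal_gen_seqP[c cE].
(* [y] has the same coefficient at [b d] as [x], so [x - y] falls into [N']. *)
pose y := \sum_(i < size t) psi (c i) * h t`_i.
have hin (i : 'I_(size t)) : t`_i \in t by rewrite mem_nth.
have Ny : N y by apply: (big_ind N) => // i _; apply: NM; have [] := hP _ (hin i).
have My : M y.
  apply: (big_ind M) => // i _; apply/(MM)/sM.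
  by rewrite /= mem_cat map_f // hin.
rewrite -(subrK y x); apply: (MD) => //.
apply: (s'P M); first by split.
  by move=> z /= zs; apply: sM; rewrite /= mem_cat zs orbT.
split.
  by apply: ND => //; rewrite -mulN1r -(rmorph1 psi) -rmorphN; apply: NM.
have /choice[r' r'E] : forall i : 'I_(size t), exists r : 'I_d -> R,
    h t`_i = \sum_(j < d) psi (r j) * b j + psi t`_i * b d.
  by move=> i; have [_ []] := hP _ (hin i) => q qE; exists q.
exists (fun j => r (widen_ord (leqnSn d) j) - \sum_(i < size t) c i * r' i j).
have -> : y = \sum_(j < d) psi (\sum_(i < size t) c i * r' i j) * b j
                + psi (r ord_max) * b d.
  rewrite cE !rmorph_sum mulr_suml /y.
  transitivity (\sum_(i < size t) (\sum_(j < d) psi (c i * r' i j) * b j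
                  + psi (c i * t`_i) * b d)).
    apply: eq_bigr => i _; rewrite r'E mulrDr mulr_sumr !rmorphM mulrA.
    by congr (_ + _); apply: eq_bigr => j _; rewrite rmorphM mulrA.
  rewrite big_split /= exchange_big /=; congr (_ + _).
  by apply: eq_bigr => j _; rewrite rmorph_sum mulr_suml.
rewrite xE opprD addrACA subrr addr0 -sumrB.
by apply: eq_bigr => j _; rewrite -mulrBl -rmorphB.
Qed.

(* The common core of Hilbert's basis theorem and of the noetherianity of
   rings with Weierstrass division. *)
Lemma noetherian_reduce (I : set S) (s : seq S) d (b : nat -> S) :
  noetherian R -> is_ideal I -> [set` s] `<=` I ->
  (forall x, I x -> exists2 h, ideal_gen [set` s] h &
     exists r : 'I_d -> R, x = h + \sum_(i < d) psi (r i) * b i) ->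
  exists t : seq S, I = ideal_gen [set` t].
Proof.
move=> nR idI sI red; have [I0 ID IM] := idI.
pose N : set S := I `&` [set x | exists r : 'I_d -> R,
                                   x = \sum_(i < d) psi (r i) * b i].
have [|x []//|t [tN tP]] := @noetherian_submodule b d N nR.
  split.
  - split=> //; exists (fun=> 0).
    by rewrite big1 // => i _; rewrite rmorph0 mul0r.
  - move=> x x' [Nx [r xE]] [Nx' [r' x'E]]; split; first exact: ID.
    exists (fun i => r i + r' i); rewrite xE x'E -big_split /=.
    by apply: eq_bigr => i _; rewrite rmorphD mulrDl.
  - move=> c x [Nx [r xE]]; split; first exact: IM.
    exists (fun i => c * r i); rewrite xE mulr_sumr.
    by apply: eq_bigr => i _; rewrite rmorphM mulrA.
exists (s ++ t); apply/seteqP; split; last first.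
  apply: ideal_gen_min => // x; rewrite /= mem_cat => /orP[/sI//|/tN[]//].
have [g0 gD gM] := ideal_gen_ideal [set` s ++ t].
move=> x Ix; have [h hs [r xE]] := red x Ix.
have hst : ideal_gen [set` s ++ t] h.
  by apply: ideal_gen_mono hs => y; rewrite /= mem_cat => ->.
rewrite xE; apply: (gD) => //.
apply: (tP (ideal_gen [set` s ++ t])); first by split=> // r' a; exact: gM.
  by move=> y /= yt; apply: sub_ideal_gen; rewrite /= mem_cat yt orbT.
split; last by exists r.
rewrite -[\sum_(i < d) _](addKr h) -xE addrC; apply: is_idealB => //.
exact: ideal_gen_min idI sI _ hs.
Qed.

Lemma noetherian_surj : noetherian R -> (forall y, exists x, psi x = y) ->
  noetherian S.
Proof.
move=> nR surj I idI; apply: (@noetherian_reduce I [::] 1 (fun=> 1)) => //.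
move=> x _; exists 0; first by have [] := ideal_gen_ideal [set` [::] : seq S].
by have [r rx] := surj x; exists (fun=> r); rewrite big_ord1 mulr1 add0r.
Qed.

End NoetherianTransfer.

Lemma noetherian_poly (R : comNzRingType) : noetherian R -> noetherian {poly R}.
Proof.
move=> nR I idI; have [I0 ID IM] := idI.
pose S : set R := [set a | exists (p : {poly R}) n,
                             [/\ I p, (size p <= n.+1)%N & p`_n = a]].
have [t [tS St]] := noetherian_gen S nR.
have /choice[f fP] : forall a, exists p : {poly R}, a \in t -> I p /\
    exists n, (size p <= n.+1)%N /\ p`_n = a.
  move=> a; have [/tS[p [n [Ip sp pn]]]|] := boolP (a \in t); last by exists 0.
  by exists p => _; split=> //; exists n.
(* From degree [d] on, every leading coefficient of [I] can be cancelled by shifted [f t_i]; what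
   remains lies in the module spanned by the ['X^i] with [i < d]. *)
pose d := (\max_(i < size t) size (f (t`_i)%R))%N.
have tin (i : 'I_(size t)) : t`_i \in t by rewrite mem_nth.
apply: (@noetherian_reduce _ _ polyC I (map f t) d (fun i => 'X^i)) => //.
  by move=> _ /mapP[a at_ ->]; have [] := fP a at_.
suff red n p : I p -> (size p <= n)%N -> exists2 h, ideal_gen [set` map f t] h &
     exists r : 'I_d -> R, p = h + \sum_(i < d) (r i)%:P * 'X^i.
  by move=> p Ip; apply: (red (size p)).
elim: n p => [|n IH] p Ip sp.
  have -> : p = 0 by apply/eqP; rewrite -size_poly_eq0 -leqn0.
  exists 0; first by have [] := ideal_gen_ideal [set` map f t].
  by exists (fun=> 0); rewrite big1 ?addr0 // => i _; rewrite mul0r.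
have [le_d|lt_d] := leqP n.+1 d.
  exists 0; first by have [] := ideal_gen_ideal [set` map f t].
  exists (fun i => p`_i); rewrite add0r.
  rewrite [p in LHS](_ : p = \poly_(i < d) p`_i).
    by rewrite poly_def; apply: eq_bigr => i _; rewrite mul_polyC.
  apply/polyP => i; rewrite coef_poly; case: ltnP => // le_i.
  by rewrite nth_default // (leq_trans sp) // (leq_trans le_d).
have /ideal_gen_seqP[c cE] : ideal_gen [set` t] p`_n.
  by apply/St/sub_ideal_gen; exists p, n.
(* The recorded [n] is only a formal degree and may exceed the current one. In that case [t_i] is
   zero, and so is the coefficient at the current [n], because the size is at most [d <= n]. *)
have /choice[e eP] : forall i : 'I_(size t), exists e,
    (e <= n)%N /\ (size (f (t`_i)%R) <= e.+1)%N /\ (f t`_i)`_e = t`_i.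
  move=> i; have [_ [e [se fe]]] := fP _ (tin i).
  have le_fd : (size (f (t`_i)%R) <= d)%N.
    exact: (@leq_bigmax _ (fun i : 'I_(size t) => size (f (t`_i)%R)) i).
  have [le_en|lt_ne] := leqP e n; first by exists e.
  have le_fn : (size (f (t`_i)%R) <= n)%N by apply: leq_trans le_fd _.
  exists n; split=> //; split; first exact: leqW.
  rewrite -[RHS]fe (nth_default _ le_fn) nth_default //.
  exact: leq_trans le_fn (ltnW lt_ne).
pose g := \sum_(i < size t) (c i *: 'X^(n - e i)) * f t`_i.
have gs : ideal_gen [set` map f t] g.
  apply: is_ideal_sum (ideal_gen_ideal _) _ => i _.
  have [_ _ gM] := ideal_gen_ideal [set` map f t].
  by apply/gM/sub_ideal_gen; rewrite /= map_f // tin.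
have Ig : I g.
  apply: ideal_gen_min gs => // _ /mapP[a at_ ->].
  by have [] := fP a at_.
have [||h hs [r pE]] := IH (p - g); first exact: is_idealB.
  apply/leq_sizeP => j; rewrite leq_eqVlt coefB /g coef_sum => /orP[/eqP<-|lt_nj].
    rewrite cE; apply/eqP; rewrite subr_eq0; apply/eqP/eq_bigr => i _.
    have [le_en [_ fe]] := eP i.
    by rewrite -scalerAl coefZ coefXnM ltnNge leq_subr /= subKn // fe.
  rewrite nth_default ?(leq_trans sp) // big1 ?subr0 // => i _.
  have [le_en [se _]] := eP i.
  rewrite -scalerAl coefZ coefXnM; case: ltnP => _; rewrite ?mulr0 //.
  rewrite nth_default ?mulr0 //; apply: leq_trans se _.
  by rewrite ltn_subRL addnC subnKC.
exists (h + g); last by exists r; rewrite addrAC -pE subrK.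
by have [_ gD _] := ideal_gen_ideal [set` map f t]; apply: gD.
Qed.

Lemma noetherian_mpoly (R : comNzRingType) n :
  noetherian R -> noetherian {mpoly R[n]}.
Proof.
move=> nR; elim: n => [|n IH].
  refine (noetherian_surj (psi := @mpolyC 0 R) nR _) => p.
  by exists (p@_0%MM); rewrite [RHS]nvar0_mpolyC.
pose phi : {rmorphism {poly {mpoly R[n]}} -> {mpoly R[n.+1]}} :=
  horner_eval 'X_ord_max \o map_poly (@mwiden n R).
refine (noetherian_surj (psi := phi) (noetherian_poly IH) _).
suff sX (m : 'X_{1..n.+1}) : exists x, phi x = 'X_[m].
  elim/mpolyind => [|c m p _ _ [x <-]]; first by exists 0; rewrite rmorph0.
  have [y yE] := sX m; exists ((c%:MP)%:P * y + x).
  rewrite rmorphD rmorphM yE /= /horner_eval map_polyC hornerC /=.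
  by rewrite mwidenC mul_mpolyC.
have sU (i : 'I_n.+1) : exists x, phi x = 'X_i.
  case: (unliftP ord_max i) => [j ->|->].
    exists ('X_j)%:P; rewrite /= /horner_eval map_polyC hornerC /= mwidenX.
    rewrite mnmwiden1; congr 'X_[U_(_)]; apply: val_inj => /=.
    by rewrite /bump leqNgt ltn_ord.
  by exists 'X; rewrite /= /horner_eval map_polyX hornerX.
have [f fE] := choice sU.
exists (\prod_i f i ^+ m i).
by rewrite rmorph_prod mpolyXE_id; apply: eq_bigr => i _; rewrite rmorphXn fE.
Qed.

(** * The adic topology of A<Y> *)

Section IdealPowers.
Variables (R : comNzRingType) (I : set R).
Implicit Types (e : nat) (a b : R).

Lemma ideal_pow0 a : ideal_pow I 0 a.
Proof.
have [_ _ gM] := ideal_gen_ideal [set a | exists b : 'I_0 -> R,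
                       (forall j, I (b j)) /\ a = \prod_(j < 0) b j].
rewrite -[a]mulr1; apply/gM/sub_ideal_gen; exists (fun=> 0).
by rewrite big_ord0; split=> // -[].
Qed.

Lemma ideal_pow1 a : I a -> ideal_pow I 1 a.
Proof.
by move=> Ia; apply: sub_ideal_gen; exists (fun=> a); rewrite big_ord1.
Qed.

Lemma ideal_powM e e' a b : ideal_pow I e a -> ideal_pow I e' b ->
  ideal_pow I (e + e') (a * b).
Proof.
have [g0 gD gM] := ideal_gen_ideal [set a | exists b : 'I_(e + e') -> R,
                       (forall j, I (b j)) /\ a = \prod_(j < e + e') b j].
move=> aI bI; move: a aI.
apply: (@ideal_gen_min _ _ [set a | ideal_pow I (e + e') (a * b)]).
  split=> [|x y|x y] /=; first by rewrite mul0r; exact: g0.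
    by rewrite mulrDl; apply: gD.
  by rewrite -mulrA; apply: gM.
move=> _ [c [cI ->]] /=; move: b bI.
apply: (@ideal_gen_min _ _
  [set b | ideal_pow I (e + e') (\prod_(j < e) c j * b)]).
  split=> [|x y|x y] /=; first by rewrite mulr0; exact: g0.
    by rewrite mulrDr; apply: gD.
  by rewrite mulrCA; apply: gM.
move=> _ [d [dI ->]] /=; apply: sub_ideal_gen.
exists (fun j => match fintype.split j with inl k => c k | inr k => d k end).
split; first by move=> j; case: fintype.split.
rewrite big_split_ord /=; congr (_ * _); apply: eq_bigr => i _.
  by rewrite (unsplitK (inl i)).
by rewrite (unsplitK (inr i)).
Qed.

Lemma ideal_pow_le e e' a : (e <= e')%N -> ideal_pow I e' a -> ideal_pow I e a.
Proof.
move=> /subnK <-; elim: (e' - e)%N a => // k IH a; rewrite addSn => aI.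
apply: IH; move: a aI; apply: ideal_gen_min; first exact: ideal_gen_ideal.
move=> _ [b [bI ->]]; rewrite big_ord_recl.
have [_ _ gM] := ideal_gen_ideal [set a | exists b : 'I_(k + e) -> R,
                       (forall j, I (b j)) /\ a = \prod_(j < k + e) b j].
by apply/gM/sub_ideal_gen; exists (fun j => b (lift ord0 j)).
Qed.

End IdealPowers.

(** The corrections chosen at each step sum to [x] by completeness of [M], and separatedness of [N]
    identifies [Phi x] with [y]. The invariant [C] is passed from one error term to the next: it is
    the closure of an ideal in one use and everything in the other. *)
Lemma successive_approximation (M N : zmodType) (FM : nat -> set M)
    (FN : nat -> set N) (Phi : M -> N) (C : set N) (y : N) :
  (forall v, (forall i, FM i (v i)) ->
     exists x, forall k, FM k (x - \sum_(i < k) v i)) ->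
  (forall k a b, FN k a -> FN k b -> FN k (a - b)) ->
  (forall a, (forall k, FN k a) -> a = 0) ->
  {morph Phi : a b / a - b} -> (forall k x, FM k x -> FN k (Phi x)) ->
  (forall e z, C z -> FN e z ->
     exists x, [/\ FM e x, C (z - Phi x) & FN e.+1 (z - Phi x)]) ->
  C y -> FN 0%N y -> exists x, y = Phi x.
Proof.
move=> cplt FNB sep PhiB cont step Cy Fy.
have /choice[g gP] : forall ez : nat * N, exists x, C ez.2 -> FN ez.1 ez.2 ->
    [/\ FM ez.1 x, C (ez.2 - Phi x) & FN ez.1.+1 (ez.2 - Phi x)].
  move=> [e z]; have [[Cz Fz]|nz] := pselect (C z /\ FN e z).
    by have [x xP] := step e z Cz Fz; exists x.
  by exists 0 => Cz Fz; case: nz.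
pose fix z k := if k is i.+1 then z i - Phi (g (i, z i)) else y.
have zP k : C (z k) /\ FN k (z k).
  by elim: k => // k [Cz Fz]; have [] := gP (k, z k) Cz Fz.
have [|x xP] := cplt (fun i => g (i, z i)).
  by move=> i; have [Cz Fz] := zP i; have [] := gP (i, z i) Cz Fz.
have Phi0 : Phi 0 = 0 by rewrite -(subrr 0) PhiB subrr.
have PhiN b : Phi (- b) = - Phi b by rewrite -sub0r PhiB Phi0 sub0r.
have PhiD a b : Phi (a + b) = Phi a + Phi b.
  by rewrite -[in LHS](opprK b) PhiB PhiN opprK.
pose v i := g (i, z i).
have zE k : z k = y - Phi (\sum_(i < k) v i).
  elim: k => [|k IH]; first by rewrite big_ord0 Phi0 subr0.
  by rewrite big_ord_recr PhiD opprD addrA -IH.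
exists x; apply/eqP; rewrite -subr_eq0; apply/eqP/sep => k.
have -> : y - Phi x = z k - Phi (x - \sum_(i < k) v i).
  by rewrite zE PhiB opprB addrA subrK.
by apply: FNB; [have [] := zP k | apply/cont/xP].
Qed.

Lemma mpoly_hom_eq (R S : comNzRingType) n
    (phi psi : {rmorphism {mpoly R[n]} -> S}) :
  (forall c, phi c%:MP = psi c%:MP) -> (forall i, phi 'X_i = psi 'X_i) ->
  phi =1 psi.
Proof.
move=> eqC eqX p; elim/mpolyind: p => [|c m p _ _ IH]; first by rewrite !rmorph0.
rewrite -mul_mpolyC !rmorphD !rmorphM IH eqC; congr (_ * _ + _).
by rewrite mpolyXE_id !rmorph_prod; apply: eq_bigr => i _; rewrite !rmorphXn eqX.
Qed.

Section TateTopology.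
Variables (A : comNzRingType) (oA : idealr A).

Local Notation opow := (ideal_pow [set` oA]).
Local Notation tate := (tate oA).

(** Defined on coefficients rather than as a power of an ideal of [tate n], so that separation and
    completeness come directly from those of [A]. *)
Definition tfilt n e : set (tate n) := [set f | forall m, opow e (f m)].

Lemma tfilt_ideal n e : is_ideal (@tfilt n e).
Proof.
have idO := opow_ideal oA e; have [O0 OD OM] := idO.
split=> [m|f g fF gF m|f g gF m]; first exact: O0.
  by apply: OD; [exact: fF | exact: gF].
apply: is_ideal_sum (idO) _ => k _; apply/OM/gF.
Qed.

Lemma tfilt_le n e e' (f : tate n) : (e <= e')%N -> tfilt e' f -> tfilt e f.
Proof. by move=> le_e fF m; apply: ideal_pow_le le_e (fF m). Qed.

Lemma tfilt0 n (f : tate n) : tfilt 0 f.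
Proof. by move=> m; apply: ideal_pow0. Qed.

Lemma tfiltM n e e' (f g : tate n) :
  tfilt e f -> tfilt e' g -> tfilt (e + e') (f * g).
Proof.
move=> fF gF m; apply: is_ideal_sum (opow_ideal oA (e + e')) _ => k _.
exact: ideal_powM.
Qed.

Fact tateC_is_additive n : additive (@tateC A oA n).
Proof.
move=> a b; apply/tateP => m; change (mpsC n (a - b) m = mpsC n a m - mpsC n b m).
by rewrite /=; case: eqP => // _; rewrite subrr.
Qed.

Lemma tateCM n (a : A) (f : tate n) m : (tateC n a * f) m = a * f m.
Proof.
change ((mpsC n a * tate_val f) m = a * f m).
by rewrite mpsCM.
Qed.

Fact tateC_is_multiplicative n : multiplicative (@tateC A oA n).
Proof.
split=> [a b|]; last first.
  by apply/tateP => m; change (mpsC n 1 m = (1 : mps n A) m).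
apply/tateP => m; rewrite tateCM.
change (mpsC n (a * b) m = a * mpsC n b m).
by rewrite /=; case: eqP => // _; rewrite mulr0.
Qed.

HB.instance Definition _ n :=
  GRing.isAdditive.Build A (tate n) (@tateC A oA n) (@tateC_is_additive n).
HB.instance Definition _ n :=
  GRing.isMultiplicative.Build A (tate n) (@tateC A oA n)
    (@tateC_is_multiplicative n).

Lemma tfiltC n e a : opow e a -> tfilt e (tateC n a : tate n).
Proof.
by move=> aO m /=; case: eqP => // _; have [] := opow_ideal oA e.
Qed.

Fact tate_poly_subproof n (p : {mpoly A[n]}) :
  MPS (fun m => p@_m) \in @restricted A oA n.
Proof.
apply: (@restricted_finsupp _ _ _ _ (msize p)) => m le_m /=.
by apply: memN_msupp_eq0; apply: msize_mdeg_ge.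
Qed.

Definition tate_poly n (p : {mpoly A[n]}) : tate n := Tate (tate_poly_subproof p).

Fact tate_poly_is_additive n : additive (@tate_poly n).
Proof. by move=> p q; apply/tateP => m /=; rewrite mcoeffB. Qed.

Fact tate_poly_is_multiplicative n : multiplicative (@tate_poly n).
Proof.
split=> [p q|]; apply/tateP => m.
  by rewrite /= (mcoeff_poly_mul_lin _ _ (ltnSn (mdeg m))).
change (1@_m = (1 : mps n A) m); rewrite mps1E mcoeff1; by case: eqP.
Qed.

HB.instance Definition _ n :=
  GRing.isAdditive.Build {mpoly A[n]} (tate n) (@tate_poly n)
    (@tate_poly_is_additive n).
HB.instance Definition _ n :=
  GRing.isMultiplicative.Build {mpoly A[n]} (tate n) (@tate_poly n)
    (@tate_poly_is_multiplicative n).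

Lemma tate_polyC n c : tate_poly (c%:MP) = tateC n c.
Proof. by apply/tateP => m /=; rewrite mcoeffC; case: eqP; rewrite ?mulr1 ?mulr0. Qed.

Lemma tate_polyX n (i : 'I_n) : tate_poly 'X_i = tateX i.
Proof. by apply/tateP => m /=; rewrite mcoeffX eq_sym. Qed.

(** The polynomial is a truncation of [f], so it keeps every bound on the coefficients of [f]; the
    second clause lets an approximation start at the order of [f]. *)
Lemma tate_dense n e (f : tate n) :
  exists p : {mpoly A[n]}, tfilt e (f - tate_poly p) /\
    forall e', tfilt e' f -> forall m, opow e' (p@_m).
Proof.
have /restrictedP/(_ e)[d fd] := tate_valP f.
exists (\sum_(k : 'X_{1..n < d}) f k *: 'X_[k]); split=> [m|e' fF m].
  change (opow e (f m - (\sum_(k : 'X_{1..n < d}) f k *: 'X_[k])@_m)).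
  have [lt_d|le_d] := ltnP (mdeg m) d.
    by rewrite mcoeff_mpoly // subrr; have [] := opow_ideal oA e.
  rewrite raddf_sum big1 ?subr0 /=; first exact: fd.
  move=> k _; rewrite mcoeffZ mcoeffX; case: eqP => [E|_]; last by rewrite mulr0.
  by have := bmdeg k; rewrite E ltnNge le_d.
rewrite raddf_sum; apply: is_ideal_sum (opow_ideal oA e') _ => k _ /=.
by rewrite mcoeffZ mulrC; have [_ _ OM] := opow_ideal oA e'; apply: OM.
Qed.

Hypothesis A_sep : adic_separated [set` oA].
Hypothesis A_complete : adic_complete [set` oA].

Lemma tfilt_sep n (f : tate n) : (forall e, tfilt e f) -> f = 0.
Proof.
move=> fF; apply/tateP => m.
suff : [set 0] (f m) by [].
by rewrite -A_sep => e _; apply: fF.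
Qed.

(** The limit is taken coefficient by coefficient. Since the Cauchy bound is uniform in the
    multi-index, the limit is uniformly close to some [u N], which makes it restricted. *)
Lemma tate_limit n (u : nat -> tate n) :
  (forall e, exists N, forall i j, (N <= i)%N -> (N <= j)%N ->
     tfilt e (u i - u j)) ->
  exists l, forall e, exists N, forall i, (N <= i)%N -> tfilt e (u i - l).
Proof.
move=> uC.
have /choice[l lP] : forall m, exists a, forall e, exists N, forall i,
    (N <= i)%N -> opow e (u i m - a).
  move=> m; apply: A_complete => e; have [N NP] := uC e.
  by exists N => i j le_i le_j; apply: (NP i j).
have lim e N : (forall i j, (N <= i)%N -> (N <= j)%N -> tfilt e (u i - u j)) ->
    forall i m, (N <= i)%N -> opow e (u i m - l m).
  move=> NP i m le_i; have [N' N'P] := lP m e.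
  have [_ OD _] := opow_ideal oA e.
  rewrite -(subrK (u (maxn N N') m) (u i m)) -addrA; apply: OD.
    by apply: (NP i (maxn N N')) => //; apply: leq_maxl.
  exact/N'P/leq_maxr.
have lr : MPS l \in @restricted A oA n.
  apply/restrictedP => e; have [N NP] := uC e.
  have /restrictedP/(_ e)[d fd] := tate_valP (u N).
  exists d => m le_m /=; rewrite -[l m](subKr (u N m)).
  by apply: is_idealB => //; [exact: opow_ideal | exact: fd | exact: lim NP _ _ _].
exists (Tate lr) => e; have [N NP] := uC e.
by exists N => i le_i m; apply: (lim e N).
Qed.

(** The shift [E] allows for a later multiplication by a generator of order [E]; subtraction is
    truncated, so the first terms are unconstrained. *)
Lemma tate_series n E (v : nat -> tate n) : (forall i, tfilt (i - E) (v i)) ->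
  exists x, forall k, tfilt (k - E) (x - \sum_(i < k) v i).
Proof.
move=> vF.
have uF k i : (k <= i)%N ->
    tfilt (k - E) (\sum_(j < i) v j - \sum_(j < k) v j).
  move=> le_ki; rewrite -!(big_mkord xpredT) (big_cat_nat (leq0n k) le_ki) //=.
  rewrite addrAC subrr add0r big_nat_cond; apply: is_ideal_sum (tfilt_ideal n _) _ => j.
  by rewrite andbT => /andP[le_kj _]; apply: tfilt_le (vF j); apply: leq_sub2r.
have [|x xP] := @tate_limit n (fun k => \sum_(j < k) v j).
  move=> e; exists (e + E)%N => i j le_i le_j.
  rewrite -(subrKA (\sum_(j < e + E) v j)) -[in X in tfilt X _](addnK E e).
  have [_ FD _] := tfilt_ideal n (e + E - E); apply: FD; first exact: uF.
  rewrite -opprB -mulN1r; have [_ _ FM] := tfilt_ideal n (e + E - E).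
  exact/FM/uF.
exists x => k; have [N NP] := xP (k - E)%N.
pose i := maxn N k.
have -> : x - \sum_(i < k) v i =
    (\sum_(j < i) v j - \sum_(j < k) v j) - (\sum_(j < i) v j - x).
  by rewrite opprB [RHS]addrC subrKA.
apply: is_idealB (tfilt_ideal n _) _ _; first by apply: uF; apply: leq_maxr.
by apply: NP; apply: leq_maxl.
Qed.

End TateTopology.

(** * Ideals of A<Y> are closed *)

(** Serves to make the coefficients homogeneous when a form is written as a combination of forms. *)
Lemma pihomog_mulr (R : comNzRingType) n d e (p q : {mpoly R[n]}) :
  p \is d.-homog ->
  pihomog mdeg e (q * p) = if (d <= e)%N then pihomog mdeg (e - d) q * p else 0.
Proof.
move=> hp; elim/mpolyind: q => [|c m q _ _ IH].
  by rewrite mul0r !pihomog0 mul0r; case: ifP.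
rewrite mulrDl !pihomogD IH !linearZ /= pihomogX.
have -> : pihomog mdeg e (c *: 'X_[m] * p) =
    if (d <= e)%N then (if mdeg m == (e - d)%N then c *: 'X_[m] else 0) * p else 0.
  have hmp : c *: 'X_[m] * p \is (mdeg m + d).-homog.
    by apply: dhomogM => //; apply: dhomogZ; rewrite dhomogX.
  have [E|ne] := eqVneq e (mdeg m + d)%N.
    by rewrite E leq_addl addnK eqxx pihomog_dE.
  rewrite (pihomog_ne0 (d := (mdeg m + d)%N)) //; last by rewrite eq_sym.
  case: leqP => // le_de; case: eqP => [E|_]; last by rewrite mul0r.
  by rewrite E subnK // eqxx in ne.
case: ifP => _; last by rewrite addr0.
by rewrite mulrDl; case: eqP; rewrite ?scaler0.
Qed.

Section ClosedIdeals.
Variables (A : comNzRingType) (oA : idealr A).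
Hypothesis A_noeth : noetherian A.
Hypothesis A_sep : adic_separated [set` oA].
Hypothesis A_complete : adic_complete [set` oA].

Local Notation opow := (ideal_pow [set` oA]).
Local Notation tate := (tate oA).

Lemma idealr_is_ideal (R : comNzRingType) (I : idealr R) : is_ideal [set` I].
Proof.
by split=> [|a b|a b] /=; [exact: rpred0 | exact: rpredD | exact: idealMr].
Qed.

Let gens : exists a : seq A, [set` oA] = ideal_gen [set` a].
Proof. exact/A_noeth/idealr_is_ideal. Qed.

Section Leading.
Variables (n : nat) (a : seq A).
Hypothesis aE : [set` oA] = ideal_gen [set` a].

Let T := {mpoly {mpoly A[n]}[size a]}.

(* [T] surjects degreewise onto the associated graded ring of [tate n]. *)
Let phi : {rmorphism T -> tate n} :=
  mmap (@tate_poly A oA n) (fun i : 'I_(size a) => tateC n a`_i).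

Let ev (P : T) : tate n := phi P.

Let evD P Q : ev (P + Q) = ev P + ev Q. Proof. exact: (rmorphD phi). Qed.
Let evM P Q : ev (P * Q) = ev P * ev Q. Proof. exact: (rmorphM phi). Qed.
Let ev0 : ev 0 = 0. Proof. exact: (rmorph0 phi). Qed.
Let ev_sum (J : Type) (r : seq J) (F : J -> T) :
  ev (\sum_(i <- r) F i) = \sum_(i <- r) ev (F i).
Proof. exact: (rmorph_sum phi). Qed.
Let evP (p : {mpoly A[n]}) : ev p%:MP = tate_poly oA p.
Proof. by rewrite /ev /= mmapC. Qed.
Let evX i : ev 'X_i = tateC n a`_i.
Proof. by rewrite /ev /= mmapX mmap1U. Qed.

Let evF e (P : T) : P \is e.-homog -> tfilt e (ev P).
Proof.
move=> hP; rewrite /ev /= /mmap big_seq.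
apply: is_ideal_sum (tfilt_ideal _ _ _) _ => m mP; have [_ _ FM] := tfilt_ideal oA n e.
have me : mdeg m = e := dhomog_mf hP mP.
apply: FM; rewrite -me mdegE /mmap1.
elim/big_rec2: _ => [|i k f _ fF]; first exact: tfilt0.
rewrite addnC [X in tfilt X]addnC; apply: tfiltM fF.
elim: (m i) => [|j IH]; first exact: tfilt0.
rewrite exprS -add1n; apply: tfiltM IH; apply/tfiltC/ideal_pow1.
by rewrite aE; apply: sub_ideal_gen; rewrite /= mem_nth.
Qed.

Let evC e c : opow e c -> exists2 P : T, P \is e.-homog & ev P = tateC n c.
Proof.
have hC (b : A) d (P : T) : P \is d.-homog -> (b%:MP)%:MP * P \is d.-homog.
  by move=> hP; rewrite mul_mpolyC dhomogZ.
have evCC (b : A) : ev (b%:MP)%:MP = tateC n b by rewrite evP tate_polyC.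
move: c; apply: (@ideal_gen_min _ _
  [set c | exists2 P : T, P \is e.-homog & ev P = tateC n c]).
  split=> [|c d [P hP EP] [Q hQ EQ]|c d [P hP EP]] /=.
  - by exists 0; [exact: dhomog0 | rewrite ev0 rmorph0].
  - by exists (P + Q); [exact: dhomogD | rewrite evD rmorphD EP EQ].
  - by exists ((c%:MP)%:MP * P); [exact: hC | rewrite evM rmorphM evCC EP].
move=> _ [b [bI ->]] /=; elim: e b bI => [|e IH] b bI.
  by exists 1; [exact: dhomog1 | rewrite big_ord0 rmorph1; exact: (rmorph1 phi)].
have [|P hP EP] := IH (fun j => b (lift ord0 j)); first by move=> j; apply: bI.
have : ideal_gen [set` a] (b ord0) by rewrite -aE; apply: bI.
case/ideal_gen_seqP => c cE; exists ((\sum_i (c i)%:MP%:MP * 'X_i) * P).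
  rewrite -add1n; apply: dhomogM => //; apply: rpred_sum => i _.
  by apply: hC; rewrite dhomogX /= mdeg1.
rewrite evM big_ord_recl rmorphM EP ev_sum cE rmorph_sum; congr (_ * _).
by apply: eq_bigr => i _; rewrite evM evCC evX rmorphM.
Qed.

(** Leading forms exist because [f] agrees to order [e.+1] with a polynomial whose coefficients lie
    in the [e]-th power of [oA], and [evC] lifts each of these to a form of degree [e]. *)
Let evlead e (f : tate n) : tfilt e f ->
  exists2 P : T, P \is e.-homog & tfilt e.+1 (f - ev P).
Proof.
move=> fF; have [p [fp /(_ e fF) pO]] := tate_dense e.+1 f.
have /choice[H HP] : forall m, exists P : T, P \is e.-homog /\ ev P = tateC n p@_m.
  by move=> m; have [P hP EP] := evC (pO m); exists P.
exists (\sum_(m <- msupp p) ('X_[m])%:MP * H m).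
  apply: rpred_sum => m _; rewrite mul_mpolyC dhomogZ //.
  by have [] := HP m.
suff -> : ev (\sum_(m <- msupp p) ('X_[m])%:MP * H m) = tate_poly oA p by [].
rewrite [p in RHS]mpolyE ev_sum rmorph_sum; apply: eq_bigr => m _.
have [_ EH] := HP m.
by rewrite evM EH evP -mul_mpolyC rmorphM /= tate_polyC mulrC.
Qed.

Variable b : set (tate n).
Hypothesis idb : is_ideal b.

Let cl : set (tate n) := [set x | forall e, exists2 y, b y & tfilt e (x - y)].

Let clB x y : cl x -> cl y -> cl (x - y).
Proof.
move=> clx cly e; have [x' bx' Fx'] := clx e; have [y' by' Fy'] := cly e.
exists (x' - y'); first exact: is_idealB.
rewrite (_ : x - y - _ = (x - x') - (y - y')); last by ring.
exact: is_idealB (tfilt_ideal _ _ _) Fx' Fy'.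
Qed.

Let bcl : b `<=` cl.
Proof.
by move=> x bx e; exists x => //; rewrite subrr; have [] := tfilt_ideal oA n e.
Qed.

(* The ideal of leading forms of [b] is generated by finitely many leading forms of
   elements [g_j] of [b]; successive approximation then writes every element of the
   closure of [b] as a combination of the [g_j]. *)
Lemma closed_ideal_gens : cl `<=` b.
Proof.
pose S : set T := [set P | exists e, P \is e.-homog /\
                      exists2 y, b y & tfilt e.+1 (y - ev P)].
have [s [sS Ss]] := noetherian_gen S (noetherian_mpoly (noetherian_mpoly A_noeth)).
have /choice[dy dyP] : forall P : T, exists dy : nat * tate n, P \in s ->
    [/\ P \is dy.1.-homog, b dy.2 & tfilt dy.1.+1 (dy.2 - ev P)].
  move=> P; have [Ps|] := boolP (P \in s); last by exists (0%N, 0).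
  by have [e [hP [y yb yP]]] := sS P Ps; exists (e, y).
pose d (j : 'I_(size s)) := (dy s`_j).1; pose g (j : 'I_(size s)) := (dy s`_j).2.
have dgP (j : 'I_(size s)) :
    [/\ s`_j \is (d j).-homog, b (g j) & tfilt (d j).+1 (g j - ev s`_j)].
  exact/dyP/mem_nth.
have gF j : tfilt (d j) (g j).
  have [hP _ gP] := dgP j; rewrite -(subrK (ev s`_j) (g j)).
  have [_ FD _] := tfilt_ideal oA n (d j); apply: FD; last exact: evF.
  exact: tfilt_le (leqnSn _) gP.
pose Phi (c : {ffun 'I_(size s) -> tate n}) := \sum_j c j * g j.
have Phib c : b (Phi c).
  apply: is_ideal_sum (idb) _ => j _; have [_ _ bM] := idb; apply: bM.
  by have [] := dgP j.
(* [g j] already has order [d j], so order [k - d j] for [c j] suffices to give [c j * g j] order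
   [k]. *)
pose FM k := [set c : {ffun 'I_(size s) -> tate n} |
                forall j, tfilt (k - d j) (c j)].
move=> x clx.
suff [c ->] : exists c, x = Phi c by apply: Phib.
apply: (successive_approximation (FM := FM) (FN := @tfilt A oA n) (C := cl)) => //.
- move=> v vF; have /choice[c cP] : forall j, exists x, forall k,
      tfilt (k - d j) (x - \sum_(i < k) v i j).
    move=> j.
    exact: (@tate_series A oA A_complete n (d j) (fun i => v i j) (fun i => vF i j)).
  exists [ffun j => c j] => k j; rewrite !ffunE sum_ffunE.
  exact: cP.
- by move=> k y z; apply: is_idealB; exact: tfilt_ideal.
- by move=> y; apply: (tfilt_sep A_sep).
- move=> y z; rewrite /Phi -sumrB; apply: eq_bigr => j _.
  by rewrite !ffunE mulrBl.
- move=> k c cF; apply: is_ideal_sum (tfilt_ideal _ _ _) _ => j _.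
  apply: (@tfilt_le _ _ _ _ (k - d j + d j)); last exact: tfiltM.
  by rewrite addnC -leq_subLR.
- move=> e z clz Fz; have [P hP FP] := evlead Fz.
  (* An element of [b] that agrees with [z] to order [e.+1] has the same leading form [P], so
     closure elements bring in no new leading forms. *)
  have [y by_ Fy] := clz e.+1.
  have : ideal_gen S P.
    apply: sub_ideal_gen; exists e; split=> //; exists y => //.
    rewrite (_ : y - _ = (z - ev P) - (z - y)); last by ring.
    exact: is_idealB (tfilt_ideal _ _ _) FP Fy.
  move=> /Ss/ideal_gen_seqP[Q PE].
  pose Q' j := if (d j <= e)%N then pihomog mdeg (e - d j) (Q j) else 0.
  have {}PE : P = \sum_(j < size s) Q' j * s`_j.
    rewrite -(pihomog_dE hP) {1}PE raddf_sum; apply: eq_bigr => j _ /=.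
    have [hj _ _] := dgP j; rewrite (pihomog_mulr _ _ hj) /Q'.
    by case: ifP => _ //; rewrite mul0r.
  have Q'F j : tfilt (e - d j) (ev (Q' j)).
    rewrite /Q'; case: ifP => _; first exact/evF/pihomogP.
    by rewrite ev0; have [] := tfilt_ideal oA n (e - d j).
  exists [ffun j => ev (Q' j)]; split.
  + by move=> j; rewrite ffunE.
  + exact/clB/bcl/Phib.
  + have -> : z - Phi [ffun j => ev (Q' j)] = (z - ev P) -
        \sum_j ev (Q' j) * (g j - ev s`_j).
      rewrite {1}PE ev_sum -addrA -opprD -big_split /=; congr (_ - _).
      by apply: eq_bigr => j _; rewrite ffunE evM -mulrDr addrC subrK.
    apply: is_idealB (tfilt_ideal _ _ _) FP _.
    apply: is_ideal_sum (tfilt_ideal _ _ _) _ => j _.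
    have [_ _ gj] := dgP j; have := Q'F j; rewrite /Q'.
    case: ifP => [le_d|_] FQ; last first.
      by rewrite ev0 mul0r; have [] := tfilt_ideal oA n e.+1.
    by rewrite -[e in tfilt e.+1](subnK le_d) -addnS; apply: tfiltM.
- exact: tfilt0.
Qed.

End Leading.

Lemma tate_ideal_closed n (b : set (tate n)) x : is_ideal b ->
  (forall e, exists2 y, b y & tfilt e (x - y)) -> b x.
Proof.
by move=> idb clx; have [a aE] := gens; exact: (closed_ideal_gens aE idb).
Qed.

Lemma tate_rmorph_closed n (S : comNzRingType) (phi : {rmorphism tate n -> S}) x :
  (forall e, exists2 y, phi y = 0 & tfilt e (x - y)) -> phi x = 0.
Proof.
apply: (@tate_ideal_closed n [set y | phi y = 0]).
split=> [|a b /= a0 b0|a b /= b0]; first exact: rmorph0.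
  by rewrite rmorphD a0 b0 addr0.
by rewrite rmorphM b0 mulr0.
Qed.

End ClosedIdeals.

(** * Substitution in A<Y> *)

Section Monomials.
Variables (A : comNzRingType) (oA : idealr A).
Local Notation tate := (tate oA).
Local Notation opow := (ideal_pow [set` oA]).

Lemma tate_mulX n (f : tate n) k m :
  (f * tate_poly oA 'X_[k]) m = if (k <= m)%MM then f (m - k)%MM else 0.
Proof.
rewrite mulrC; change ((tate_val (tate_poly oA 'X_[k]) * tate_val f) m =
  if (k <= m)%MM then f (m - k)%MM else 0).
rewrite (mpsM_seq _ _ (dvms_uniq m) (mem_dvms m)) /=.
have E k' : 'X_[k]@_k' * f (m - k')%MM = if k' == k then f (m - k)%MM else 0.
  by rewrite mcoeffX eq_sym; case: eqP => [->|_]; rewrite ?mul1r ?mul0r.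
rewrite (eq_bigr _ (fun k' _ => E k')) -big_mkcond /=.
case: ifP => [le_km|/negbT nle_km].
  rewrite -big_filter (_ : [seq i <- _ | _] = [:: k]) ?big_seq1 //.
  by apply: filter_pred1_uniq; rewrite ?dvms_uniq ?mem_dvms.
rewrite big_seq_cond big_pred0 // => i; rewrite mem_dvms.
by case: (i =P k) => [->|_]; rewrite ?andbF // (negPf nle_km).
Qed.

Lemma mpolyX_mnmcat (R : comNzRingType) m n (a : 'X_{1..m}) (b : 'X_{1..n}) :
  'X_[mnmcat a b] =
  (\prod_i 'X_(lshift n i) ^+ a i) * (\prod_i 'X_(rshift m i) ^+ b i)
    :> {mpoly R[m + n]}.
Proof.
rewrite mpolyXE_id big_split_ord; congr (_ * _); apply: eq_bigr => i _.
  by rewrite mnmE (unsplitK (inl i)).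
by rewrite mnmE (unsplitK (inr i)).
Qed.

(* The monomial [Y^k] in [A<X, Y>]. *)
Definition monY m n (k : 'X_{1..n}) : tate (m + n) :=
  tate_poly oA 'X_[mnmcat 0%MM k].

Fact tate_lift_is_additive n p : additive (@tate_lift A oA n p).
Proof.
by move=> f g; apply/tateP => m /=; case: eqP => // _; rewrite subrr.
Qed.
HB.instance Definition _ n p :=
  GRing.isAdditive.Build (tate n) (tate (n + p)) (@tate_lift A oA n p)
    (@tate_lift_is_additive n p).

Fact tate_shift_is_additive n p : additive (@tate_shift A oA n p).
Proof.
by move=> f g; apply/tateP => m /=; case: eqP => // _; rewrite subrr.
Qed.
HB.instance Definition _ n p :=
  GRing.isAdditive.Build (tate n) (tate (p + n)) (@tate_shift A oA n p)
    (@tate_shift_is_additive n p).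

Definition coefY m n (nu : 'X_{1..n}) (h : tate (m + n)) : tate m := tate_coef h nu.

Fact coefY_is_additive m n nu : additive (@coefY m n nu).
Proof. by move=> f g; rewrite /coefY tate_coefB. Qed.
HB.instance Definition _ m n nu :=
  GRing.isAdditive.Build (tate (m + n)) (tate m) (@coefY m n nu)
    (@coefY_is_additive m n nu).

Lemma tfilt_lift n p e (f : tate n) : tfilt e f -> tfilt e (tate_lift p f).
Proof.
by move=> fF m /=; case: ifP => _; [apply: fF | have [] := opow_ideal oA e].
Qed.

Lemma tfilt_shift n p e (f : tate n) : tfilt e f -> tfilt e (tate_shift p f).
Proof.
by move=> fF m /=; case: ifP => _; [apply: fF | have [] := opow_ideal oA e].
Qed.

Lemma tfilt_coef m n e (f : tate (m + n)) nu : tfilt e f -> tfilt e (tate_coef f nu).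
Proof. by move=> fF k; apply: fF. Qed.

Lemma lift_monY_E m n (c : tate m) (k : 'X_{1..n}) l :
  (tate_lift n c * monY m k) l = if mnmr l == k then c (mnml l) else 0.
Proof.
rewrite /monY tate_mulX -[l]mnmcatK mnmcat_le !mnmcatl !mnmcatr mnmcatB subm0.
have -> : (0 <= mnml l)%MM by apply/mnm_lepP => i; rewrite mnm0E.
have [->|ne] := eqVneq (mnmr l) k.
  rewrite lepm_refl /= mnmcatl mnmcatr ifT //.
  by apply/eqP/mnmP => i; rewrite mnmBE mnm0E subnn.
case: ifP => //= le_k; rewrite mnmcatr ifF //; apply: contraNF ne => /eqP E.
by rewrite -(submK le_k) E add0m.
Qed.

Lemma tate_coef_lift_monY m n (c : tate m) (k nu : 'X_{1..n}) :
  tate_coef (tate_lift n c * monY m k) nu = if nu == k then c else 0.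
Proof.
apply/tateP => l.
change ((tate_lift n c * monY m k) (mnmcat l nu) = (if nu == k then c else 0) l).
by rewrite lift_monY_E mnmcatl mnmcatr; case: eqP.
Qed.

Lemma tate_coef_approx m n e (h : tate (m + n)) : exists d,
  tfilt e (h - \sum_(k : 'X_{1..n < d}) tate_lift n (tate_coef h k) * monY m k).
Proof.
have /restrictedP/(_ e)[d hd] := tate_valP h.
exists d => l.
change (opow e (h l - (\sum_(k : 'X_{1..n < d})
  tate_lift n (tate_coef h k) * monY m k) l)).
rewrite tate_val_sum.
have E (k : 'X_{1..n < d}) : true ->
    (tate_lift n (tate_coef h k) * monY m k) l = if mnmr l == k then h l else 0.
  by move=> _; rewrite lift_monY_E /=; case: eqP => // <-; rewrite mnmcatK.
rewrite (eq_bigr _ E) -big_mkcond /=.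
have [lt_d|le_d] := ltnP (mdeg (mnmr l)) d.
  rewrite (big_pred1 (BMultinom lt_d)) => [|k]; last by rewrite eq_sym.
  by rewrite subrr; have [] := opow_ideal oA e.
rewrite big_pred0 => [|k]; last first.
  by apply: contraTF le_d => /eqP ->; rewrite -ltnNge bmdeg.
by rewrite subr0; apply: hd; rewrite mdeg_lr (leq_trans le_d) // leq_addl.
Qed.

End Monomials.

Section Composition.
Variables (A : comNzRingType) (oA : idealr A).
Hypothesis A_sep : adic_separated [set` oA].
Hypothesis A_complete : adic_complete [set` oA].

Local Notation opow := (ideal_pow [set` oA]).
Local Notation tate := (tate oA).

Lemma tate_poly_mmap n : @tate_poly A oA n =1 mmap (@tateC A oA n) (@tateX A oA n).
Proof.
apply: mpoly_hom_eq => [c|i]; first by rewrite /= tate_polyC mmapC.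
by rewrite /= tate_polyX mmapX mmap1U.
Qed.

Lemma tfilt_mmap n m (g : 'I_n -> tate m) e (p : {mpoly A[n]}) :
  (forall k, opow e p@_k) -> tfilt e (mmap (@tateC A oA m) g p).
Proof.
move=> pO; apply: is_ideal_sum (tfilt_ideal _ _ _) _ => k _.
by rewrite mulrC; have [_ _ FM] := tfilt_ideal oA m e; apply/FM/tfiltC.
Qed.

(** Substituting [g] into polynomials preserves [tfilt], so it extends by density. Quantifying over
    all approximations [p] pins the limit down independently of any chosen sequence. *)
Lemma tate_comp_ex n m (g : 'I_n -> tate m) (f : tate n) :
  exists! l, forall e p, tfilt e (f - tate_poly oA p) ->
    tfilt e (l - mmap (@tateC A oA m) g p).
Proof.
have close e p q : tfilt e (f - tate_poly oA p) -> tfilt e (f - tate_poly oA q) ->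
    tfilt e (mmap (@tateC A oA m) g p - mmap (@tateC A oA m) g q).
  move=> Fp Fq; rewrite -mmapB; apply: tfilt_mmap => k.
  have /(_ k) : tfilt e ((f - tate_poly oA q) - (f - tate_poly oA p)).
    exact: is_idealB (tfilt_ideal _ _ _) Fq Fp.
  rewrite opprB addrC subrKA -raddfB; exact.
have /choice[p pP] : forall e, exists p, tfilt e (f - tate_poly oA p).
  by move=> e; have [p [pF _]] := tate_dense e f; exists p.
have [|l lP] := tate_limit A_complete (u := fun e => mmap (@tateC A oA m) g (p e)).
  move=> e; exists e => i j le_i le_j.
  by apply: close; [apply: tfilt_le (pP i) | apply: tfilt_le (pP j)].
suff lim e q : tfilt e (f - tate_poly oA q) ->
    tfilt e (l - mmap (@tateC A oA m) g q).
  exists l; split=> // l' l'P; apply/eqP; rewrite -subr_eq0.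
  apply/eqP/(tfilt_sep A_sep) => e.
  rewrite -(addrKA (- mmap (@tateC A oA m) g (p e))).
  apply: is_idealB (tfilt_ideal _ _ _) _ _; first exact/lim/pP.
  by rewrite addrC; apply: l'P.
move=> qF; have [N NP] := lP e; pose i := maxn N e.
rewrite (_ : l - _ = (mmap (@tateC A oA m) g (p i) - mmap (@tateC A oA m) g q)
   - (mmap (@tateC A oA m) g (p i) - l)); last by ring.
apply: is_idealB (tfilt_ideal _ _ _) _ _; last exact/NP/leq_maxl.
by apply: close qF; apply: tfilt_le (pP i); apply: leq_maxr.
Qed.

(* [tate_comp g f] is [f(g_1, .., g_n)]. *)
Definition tate_comp n m (g : 'I_n -> tate m) (f : tate n) : tate m :=
  projT1 (cid (tate_comp_ex g f)).

Lemma tate_compP n m (g : 'I_n -> tate m) f e p : tfilt e (f - tate_poly oA p) ->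
  tfilt e (tate_comp g f - mmap (@tateC A oA m) g p).
Proof. by have [lP _] := projT2 (cid (tate_comp_ex g f)); apply: lP. Qed.

Lemma tate_comp_poly n m (g : 'I_n -> tate m) p :
  tate_comp g (tate_poly oA p) = mmap (@tateC A oA m) g p.
Proof.
apply/eqP; rewrite -subr_eq0; apply/eqP/(tfilt_sep A_sep) => e.
by apply: tate_compP; rewrite subrr; have [] := tfilt_ideal oA n e.
Qed.

Lemma tfilt_comp n m (g : 'I_n -> tate m) e f :
  tfilt e f -> tfilt e (tate_comp g f).
Proof.
move=> fF; have [p [Fp /(_ e fF) pO]] := tate_dense e f.
rewrite -(subrK (mmap (@tateC A oA m) g p) (tate_comp g f)).
have [_ FD _] := tfilt_ideal oA m e.
by apply: FD; [exact: tate_compP | exact: tfilt_mmap].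
Qed.

Section Morphism.
Variables (n m : nat) (g : 'I_n -> tate m).
Local Notation ev := (mmap (@tateC A oA m) g).

Fact tate_comp_is_additive : additive (tate_comp g).
Proof.
move=> f f'; apply/eqP; rewrite -subr_eq0; apply/eqP/(tfilt_sep A_sep) => e.
have [p [Fp _]] := tate_dense e f; have [p' [Fp' _]] := tate_dense e f'.
rewrite (_ : _ - _ = (tate_comp g (f - f') - (ev p - ev p'))
  - ((tate_comp g f - ev p) - (tate_comp g f' - ev p'))); last by ring.
apply: is_idealB (tfilt_ideal _ _ _) _ _.
  rewrite -mmapB; apply: tate_compP; rewrite rmorphB.
  rewrite (_ : _ - _ = (f - tate_poly oA p) - (f' - tate_poly oA p')); last by ring.
  exact: is_idealB (tfilt_ideal _ _ _) Fp Fp'.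
by apply: is_idealB (tfilt_ideal _ _ _) _ _; apply: tate_compP.
Qed.

Fact tate_comp_is_multiplicative : multiplicative (tate_comp g).
Proof.
split=> [f f'|]; last by rewrite -(rmorph1 (@tate_poly A oA n)) tate_comp_poly rmorph1.
apply/eqP; rewrite -subr_eq0; apply/eqP/(tfilt_sep A_sep) => e.
have [p [Fp _]] := tate_dense e f; have [p' [Fp' _]] := tate_dense e f'.
have FM k : forall a b : tate k, tfilt e b -> tfilt e (a * b).
  by have [_ _] := tfilt_ideal oA k e.
have FD k : forall a b : tate k, tfilt e a -> tfilt e b -> tfilt e (a + b).
  by have [_ FD _] := tfilt_ideal oA k e.
rewrite (_ : _ - _ = (tate_comp g (f * f') - ev (p * p'))
  - (tate_comp g f' * (tate_comp g f - ev p)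
     + ev p * (tate_comp g f' - ev p'))); last by rewrite rmorphM /=; ring.
apply: is_idealB (tfilt_ideal _ _ _) _ _.
  apply: tate_compP; rewrite rmorphM.
  rewrite (_ : _ - _ = f' * (f - tate_poly oA p)
    + tate_poly oA p * (f' - tate_poly oA p')); last by rewrite /=; ring.
  by apply: FD; apply: FM.
by apply: FD; apply: FM; apply: tate_compP.
Qed.

HB.instance Definition _ :=
  GRing.isAdditive.Build (tate n) (tate m) (tate_comp g) tate_comp_is_additive.
HB.instance Definition _ :=
  GRing.isMultiplicative.Build (tate n) (tate m) (tate_comp g)
    tate_comp_is_multiplicative.
End Morphism.

Lemma tate_compC n m (g : 'I_n -> tate m) c : tate_comp g (tateC n c) = tateC m c.
Proof. by rewrite -tate_polyC tate_comp_poly mmapC. Qed.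

Lemma tate_compX n m (g : 'I_n -> tate m) i : tate_comp g (tateX i) = g i.
Proof. by rewrite -tate_polyX tate_comp_poly mmapX mmap1U. Qed.

Lemma tate_comp_mon n m (g : 'I_n -> tate m) k :
  tate_comp g (tate_poly oA 'X_[k]) = \prod_i g i ^+ k i.
Proof. by rewrite tate_comp_poly mmapX. Qed.

Lemma eq_tate_comp n m (g g' : 'I_n -> tate m) :
  g =1 g' -> tate_comp g = tate_comp g'.
Proof. by move=> /funext ->. Qed.

Lemma tate_cont_eq n m (phi psi : {additive tate n -> tate m}) :
  (forall e f, tfilt e f -> tfilt e (phi f)) ->
  (forall e f, tfilt e f -> tfilt e (psi f)) ->
  (forall p, phi (tate_poly oA p) = psi (tate_poly oA p)) -> phi =1 psi.
Proof.
move=> cphi cpsi E f; apply/eqP; rewrite -subr_eq0; apply/eqP/(tfilt_sep A_sep) => e.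
have [p [Fp _]] := tate_dense e f.
have -> : phi f - psi f = phi (f - tate_poly oA p) - psi (f - tate_poly oA p).
  by rewrite (raddfB phi) (raddfB psi) E; ring.
by apply: is_idealB (tfilt_ideal _ _ _) _ _; [apply: cphi | apply: cpsi].
Qed.

Lemma tate_comp_comp n m k (g : 'I_m -> tate k) (h : 'I_n -> tate m) f :
  tate_comp g (tate_comp h f) = tate_comp (fun i => tate_comp g (h i)) f.
Proof.
apply: (@tate_cont_eq n k (tate_comp g \o tate_comp h)) => [e x|e x|p] /=.
- by move=> xF; do 2!apply: tfilt_comp.
- exact: tfilt_comp.
rewrite !tate_comp_poly.
apply: (@mpoly_hom_eq _ _ _ (tate_comp g \o mmap (@tateC A oA m) h)
  (mmap (@tateC A oA k) (fun i => tate_comp g (h i)))) => [c|i] /=.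
  by rewrite !mmapC /= tate_compC.
by rewrite !mmapX !mmap1U.
Qed.

Lemma tate_comp_id n f : tate_comp (@tateX A oA n) f = f.
Proof.
apply: (@tate_cont_eq n n (tate_comp (@tateX A oA n)) idfun) => // [e x|p].
  exact: tfilt_comp.
by rewrite /= tate_comp_poly -tate_poly_mmap.
Qed.

(** Together with [tate_shiftE] this turns the axioms [iota_dummy] and [iota_shift] into statements
    about substitutions of variables. *)
Lemma tate_liftE n p (f : tate n) :
  tate_lift p f = tate_comp (fun i => tateX (lshift p i)) f.
Proof.
apply: tate_cont_eq => [e x|e x|q]; [exact: tfilt_lift | exact: tfilt_comp |].
elim/mpolyind: q => [|c m q _ _ IH]; first by rewrite !raddf0.
rewrite !raddfD /= IH -mul_mpolyC; congr (_ + _).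
rewrite !rmorphM /= !tate_polyC tate_compC tate_comp_mon.
have -> : \prod_i tateX (lshift p i) ^+ m i = tate_poly oA 'X_[mnmcat m 0%MM].
  rewrite mpolyX_mnmcat [X in _ * X]big1 ?mulr1 => [|i _]; last by rewrite mnm0E.
  by rewrite rmorph_prod; apply: eq_bigr => i _; rewrite rmorphXn /= tate_polyX.
apply/tateP => l; rewrite [RHS]tateCM.
change ((if mnmr l == 0%MM then (tateC n c * tate_poly oA 'X_[m]) (mnml l) else 0)
  = c * 'X_[mnmcat m 0%MM]@_l).
rewrite tateCM /= !mcoeffX.
rewrite -[l in RHS]mnmcatK mnmcat_inj2 [0%MM == _]eq_sym.
by case: eqP => _; rewrite ?andbT ?andbF // mulr0.
Qed.

Lemma tate_shiftE n p (f : tate n) :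
  tate_shift p f = tate_comp (fun i => tateX (rshift p i)) f.
Proof.
apply: tate_cont_eq => [e x|e x|q]; [exact: tfilt_shift | exact: tfilt_comp |].
elim/mpolyind: q => [|c m q _ _ IH]; first by rewrite !raddf0.
rewrite !raddfD /= IH -mul_mpolyC; congr (_ + _).
rewrite !rmorphM /= !tate_polyC tate_compC tate_comp_mon.
have -> : \prod_i tateX (rshift p i) ^+ m i = tate_poly oA 'X_[mnmcat 0%MM m].
  rewrite mpolyX_mnmcat [X in X * _]big1 ?mul1r => [|i _]; last by rewrite mnm0E.
  by rewrite rmorph_prod; apply: eq_bigr => i _; rewrite rmorphXn /= tate_polyX.
apply/tateP => l; rewrite [RHS]tateCM.
change ((if mnml l == 0%MM then (tateC n c * tate_poly oA 'X_[m]) (mnmr l) else 0)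
  = c * 'X_[mnmcat 0%MM m]@_l).
rewrite tateCM /= !mcoeffX.
rewrite -[l in RHS]mnmcatK mnmcat_inj2 [0%MM == _]eq_sym.
by case: eqP => _; rewrite ?mulr0.
Qed.

End Composition.

Section CompositionInArings.
Variables (A : comNzRingType) (oA : idealr A).
Hypothesis A_noeth : noetherian A.
Hypothesis A_sep : adic_separated [set` oA].
Hypothesis A_complete : adic_complete [set` oA].

Local Notation tate := (tate oA).
Local Notation comp := (tate_comp A_sep A_complete).

(* The kernel of [phi] is closed, so it suffices to treat polynomials [f]. *)
Lemma tate_comp_congr n m (S : comNzRingType) (phi : {rmorphism tate m -> S})
    (u v : 'I_n -> tate m) f :
  (forall i, phi (u i) = phi (v i)) -> phi (comp u f) = phi (comp v f).
Proof.
move=> E; apply/eqP; rewrite -subr_eq0 -rmorphB; apply/eqP.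
apply: (tate_rmorph_closed A_noeth A_sep A_complete) => e.
have [p [Fp _]] := tate_dense e f.
exists (mmap (@tateC A oA m) u p - mmap (@tateC A oA m) v p).
  apply/eqP; rewrite rmorphB subr_eq0; apply/eqP.
  apply: (@mpoly_hom_eq _ _ _ (phi \o mmap (@tateC A oA m) u)
    (phi \o mmap (@tateC A oA m) v)) => [c|i] /=; first by rewrite !mmapC.
  by rewrite !mmapX !mmap1U.
rewrite opprD addrACA -opprD.
by apply: is_idealB (tfilt_ideal _ _ _) _ _; apply: tate_compP.
Qed.

Variables (R : comNzRingType) (iR : Aring_structure oA R).

(** With the point fixed, [iota_] is a ring morphism to [R], to which closedness of kernels
    applies. *)
Definition iota_at n (y : 'rV[R]_n) (f : tate n) : R := iota_ iR n f y.

Fact iota_at_is_additive n (y : 'rV[R]_n) : additive (iota_at y).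
Proof. by move=> f g; rewrite /iota_at rmorphB. Qed.

Fact iota_at_is_multiplicative n (y : 'rV[R]_n) : multiplicative (iota_at y).
Proof. by split=> [f g|]; rewrite /iota_at ?rmorphM ?rmorph1. Qed.

HB.instance Definition _ n (y : 'rV[R]_n) :=
  GRing.isAdditive.Build (tate n) R (iota_at y) (iota_at_is_additive y).
HB.instance Definition _ n (y : 'rV[R]_n) :=
  GRing.isMultiplicative.Build (tate n) R (iota_at y)
    (iota_at_is_multiplicative y).

Lemma iota_atX n (y : 'rV[R]_n) k : iota_at y (tateX k) = y 0 k.
Proof. exact: iota_var. Qed.

Lemma iota_at_widen n N (le_nN : (n <= N)%N) (f : tate n) (y : 'rV[R]_N) :
  iota_at y (comp (fun i => tateX (widen_ord le_nN i)) f)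
    = iota_at (\row_i y 0 (widen_ord le_nN i)) f.
Proof.
(* [M'] comes with an equation because [iota_dummy] speaks of [n + 1] and the induction of
   [N.+1]. *)
have step M M' (g : tate M) (le_M : (M <= M')%N) (z : 'rV[R]_M') : M' = (M + 1)%N ->
    iota_at z (comp (fun i => tateX (widen_ord le_M i)) g)
      = iota_at (\row_i z 0 (widen_ord le_M i)) g.
  move=> E; subst M'; rewrite (@eq_tate_comp _ _ _ _ _ _ _ (fun i => tateX (lshift 1 i))).
    rewrite -(tate_liftE A_sep) /iota_at iota_dummy; congr (iota_ iR _ _ _).
    by apply/rowP => i; rewrite !mxE; congr (z 0 _); apply: val_inj.
  by move=> i; congr tateX; apply: val_inj.
elim: N le_nN y => [|N IH] le_nN y.
  have E : n = 0%N by apply/eqP; rewrite -leqn0.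
  subst n; rewrite (@eq_tate_comp _ _ _ _ _ _ _ (@tateX A oA 0)) => [|[]//].
  rewrite (tate_comp_id A_sep); congr (iota_at _ _).
  by apply/rowP => -[].
have : (n == N.+1) || (n < N.+1)%N by rewrite -leq_eqVlt.
case/orP => [/eqP E|lt_nN].
  subst n; rewrite (@eq_tate_comp _ _ _ _ _ _ _ (@tateX A oA N.+1)).
    rewrite (tate_comp_id A_sep); congr (iota_at _ _); apply/rowP => i.
    by rewrite mxE; congr (y 0 _); apply: val_inj.
  by move=> i; congr tateX; apply: val_inj.
rewrite -(@eq_tate_comp _ _ _ _ _ _
    (fun i => comp (fun i => tateX (widen_ord (leqnSn N) i))
                   (tateX (widen_ord (lt_nN : (n <= N)%N) i)))); last first.
  by move=> i; rewrite (tate_compX A_sep); congr tateX; apply: val_inj.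
rewrite -(tate_comp_comp A_sep) step ?addn1 // IH; congr (iota_at _ _).
by apply/rowP => i; rewrite !mxE; congr (y 0 _); apply: val_inj.
Qed.

(** New variables are adjoined that take the values [z i] of [g i]. At the joint point [w] the
    series [g i] and the [i]-th new variable have the same value, so [tate_comp_congr] lets one
    replace the other inside [f]. *)
Theorem iota_at_comp n m (g : 'I_n -> tate m) (f : tate n) (y : 'rV[R]_m) :
  iota_at y (comp g f) = iota_at (\row_i iota_at y (g i)) f.
Proof.
pose z : 'rV[R]_n := \row_i iota_at y (g i); rewrite -/z.
(* [iota_shift] requires two blocks of the same positive length, so both points are padded by zeros
   to length [N]. *)
pose N := (n + m).+1.
have le_n : (n <= N)%N by rewrite leqW ?leq_addr.
have le_m : (m <= N)%N by rewrite leqW ?leq_addl.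
have le_nN : (n <= N + N)%N by rewrite (leq_trans le_n) ?leq_addr.
pose ext k (x : 'rV[R]_k) : 'rV[R]_N :=
  \row_i (if insub (val i) is Some j then x 0 j else 0).
pose w := row_mx (ext n z) (ext m y).
pose sh (h : tate m) :=
  comp (fun i => tateX (rshift N i)) (comp (fun i => tateX (widen_ord le_m i)) h).
have shE h : iota_at w (sh h) = iota_at y h.
  rewrite /sh -(tate_shiftE A_sep) /iota_at -iota_shift // row_mxKr.
  rewrite [LHS]iota_at_widen /iota_at; congr (iota_ iR _ _ _).
  by apply/rowP => i; rewrite !mxE /= valK.
transitivity (iota_at w (comp (fun i => tateX (widen_ord le_nN i)) f)).
  rewrite -shE /sh !(tate_comp_comp A_sep).
  apply: tate_comp_congr => i /=; rewrite iota_atX -(tate_comp_comp A_sep).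
  rewrite [LHS]shE -[widen_ord _ i](_ : lshift N (widen_ord le_n i) = _).
    by rewrite row_mxEl !mxE /= valK mxE.
  exact: val_inj.
rewrite iota_at_widen; congr (iota_at _ _); apply/rowP => i.
rewrite mxE -[widen_ord _ i](_ : lshift N (widen_ord le_n i) = _).
  by rewrite row_mxEl !mxE /= valK mxE.
exact: val_inj.
Qed.

End CompositionInArings.

(** * Weierstrass preparation over A *)

Section ExtendedEvaluation.
Variables (R S : comNzRingType) (psi : {rmorphism R -> S}) (eta : S).

Definition ext_eval (p : {poly R}) : S := (map_poly psi p).[eta].

Fact ext_eval_is_additive : additive ext_eval.
Proof. by move=> p q; rewrite /ext_eval rmorphB hornerD hornerN. Qed.

Fact ext_eval_is_multiplicative : multiplicative ext_eval.
Proof.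
by split=> [p q|]; rewrite /ext_eval ?rmorphM ?hornerM // rmorph1 hornerC.
Qed.

HB.instance Definition _ :=
  GRing.isAdditive.Build {poly R} S ext_eval ext_eval_is_additive.
HB.instance Definition _ :=
  GRing.isMultiplicative.Build {poly R} S ext_eval ext_eval_is_multiplicative.

Lemma ext_evalC c : ext_eval c%:P = psi c.
Proof. by rewrite /ext_eval map_polyC hornerC. Qed.

Lemma ext_evalX : ext_eval 'X = eta.
Proof. by rewrite /ext_eval map_polyX hornerX. Qed.

Lemma ext_eval_wide d (p : {poly R}) : (size p <= d)%N ->
  ext_eval p = \sum_(i < d) psi p`_i * eta ^+ i.
Proof.
move=> le_pd; rewrite /ext_eval (@horner_coef_wide _ d).
  by apply: eq_bigr => i _; rewrite coef_map.
by rewrite (leq_trans _ le_pd) // size_poly.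
Qed.

End ExtendedEvaluation.

Section Weierstrass.
Variables (A : comNzRingType) (oA : idealr A).
Hypothesis A_noeth : noetherian A.
Hypothesis A_sep : adic_separated [set` oA].
Hypothesis A_complete : adic_complete [set` oA].

Local Notation tate := (tate oA).
Local Notation comp := (tate_comp A_sep A_complete).
Local Notation opow := (ideal_pow [set` oA]).

Section Division.
Variables (n m : nat) (g : 'I_n -> tate m) (eta : tate m).

Let psi : {rmorphism tate n -> tate m} := tate_comp A_sep A_complete g.

Local Notation eval := (ext_eval psi eta).

Hypothesis generated : forall i, exists p, tateX i = eval p.

Let dense (f : tate m) : exists p, tfilt 1 (f - eval p).
Proof.
have [p [Fp _]] := tate_dense 1 f.
suff [q qE] : exists q, eval q = tate_poly oA p by exists q; rewrite qE.
elim/mpolyind: p {Fp} => [|c k p _ _ [q IH]]; first by exists 0; rewrite !rmorph0.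
have [x xE] := choice generated.
exists ((tateC n c)%:P * (\prod_i x i ^+ k i) + q).
rewrite rmorphD rmorphM /= IH ext_evalC /= rmorphD -mul_mpolyC rmorphM /=.
rewrite tate_polyC (tate_compC A_sep); congr (_ * _ + _).
rewrite mpolyXE_id !rmorph_prod; apply: eq_bigr => i _.
by rewrite !rmorphXn /= -xE tate_polyX.
Qed.

(** Modulo [oA] every series is a value of a polynomial in [eta] and [F] is the value of the monic
    [Q]; ordinary division by [Q] is thus correct to first order, and the errors are divided
    again. *)
Lemma tate_division (Q : {poly tate n}) (F : tate m) : Q \is monic ->
  tfilt 1 (F - eval Q) ->
  forall f, exists q (r : {poly tate n}), (size r < size Q)%N /\ f = q * F + eval r.
Proof.
move=> Qm FQ f; pose d := (size Q).-1.
have sQ : size Q = d.+1 by rewrite /d prednK // size_poly_gt0 monic_neq0.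
pose V := (tate m * {ffun 'I_d -> tate n})%type.
pose Phi (x : V) := x.1 * F + \sum_(i < d) psi (x.2 i) * eta ^+ i.
suff [[q r] ->] : exists x, f = Phi x.
  exists q, (\poly_(i < d) (if insub i is Some j then r j else 0)); split.
    by rewrite sQ ltnS size_poly.
  congr (_ + _); rewrite (ext_eval_wide _ _ (size_poly _ _)).
  by apply: eq_bigr => i _; rewrite coef_poly ltn_ord valK.
pose FM k := [set x : V | tfilt k x.1 /\ forall i, tfilt k (x.2 i)].
have step0 (h : tate m) : exists x, tfilt 1 (h - Phi x).
  have [p Fp] := dense h.
  pose q := Pdiv.CommonRing.rdivp p Q; pose r := Pdiv.CommonRing.rmodp p Q.
  have pE : p = q * Q + r by apply: Pdiv.RingMonic.rdivp_eq.
  have sr : (size r <= d)%N.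
    by rewrite -ltnS -sQ Pdiv.CommonRing.ltn_rmodp monic_neq0.
  exists (eval q, [ffun i => r`_(val i)]).
  have -> : h - Phi (eval q, [ffun i => r`_(val i)]) =
      (h - eval p) - eval q * (F - eval Q).
    rewrite /Phi /= pE rmorphD rmorphM /= (ext_eval_wide _ _ sr).
    rewrite (eq_bigr (fun i : 'I_d => psi r`_i * eta ^+ i)); last first.
      by move=> i _; rewrite ffunE.
    by ring.
  apply: is_idealB (tfilt_ideal _ _ _) Fp _.
  by have [_ _ FD] := tfilt_ideal oA m 1; apply: FD.
apply: (successive_approximation (FM := FM) (FN := @tfilt A oA m) (C := setT)) => //.
- move=> v vF.
  have vF1 i : tfilt (i - 0) (v i).1 by rewrite subn0; have [] := vF i.
  have vF2 j i : tfilt (i - 0) ((v i).2 j) by rewrite subn0; have [] := vF i.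
  have [q qP] := @tate_series A oA A_complete m 0 (fun i => (v i).1) vF1.
  have /choice[r rP] j := @tate_series A oA A_complete n 0 (fun i => (v i).2 j) (vF2 j).
  exists (q, [ffun j => r j]) => k; split=> [|j] /=.
    rewrite (_ : (\sum_(i < k) v i).1 = \sum_(i < k) (v i).1).
      by have := qP k; rewrite subn0.
    by elim/big_rec2: _ => // i x y _ <-.
  rewrite !ffunE (_ : (\sum_(i < k) v i).2 j = \sum_(i < k) (v i).2 j).
    by have := rP j k; rewrite subn0.
  by elim/big_rec2: _ => [|i x y _ <-] /=; rewrite ffunE.
- by move=> k a b; apply: is_idealB; exact: tfilt_ideal.
- by move=> a; apply: (tfilt_sep A_sep).
- move=> a b; rewrite /Phi mulrBl opprD addrACA -sumrB; congr (_ + _).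
  by apply: eq_bigr => i _; rewrite !ffunE -mulrBl rmorphB.
- move=> k x [Fq Fr]; have [_ FD FMul] := tfilt_ideal oA m k.
  apply: FD; first by rewrite mulrC; apply: FMul.
  apply: is_ideal_sum (tfilt_ideal _ _ _) _ => i _.
  by rewrite mulrC; apply/FMul/(tfilt_comp A_sep)/Fr.
(* The first-order division [step0] is applied to each monomial of [p]; the coefficients of [p] have
   order [e], so the total error has order [e.+1]. *)
- move=> e z _ Fz; have [p [Fp /(_ e Fz) pO]] := tate_dense e.+1 z.
  have /choice[x xP] := fun k : 'X_{1..m} => step0 (tate_poly oA 'X_[k]).
  pose c (k : 'X_{1..m}) l := tateC l p@_k : tate l.
  have cF k l : tfilt e (c k l) by apply/tfiltC/pO.
  exists (\sum_(k <- msupp p) c k m * (x k).1,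
    [ffun i => \sum_(k <- msupp p) c k n * (x k).2 i]); split=> //.
    have FMul l (a b : tate l) : tfilt e a -> tfilt e (a * b).
      by rewrite mulrC; have [_ _] := tfilt_ideal oA l e; apply.
    split=> [|i] /=; rewrite ?ffunE;
    by apply: is_ideal_sum (tfilt_ideal _ _ _) _ => k _; apply: FMul.
  have -> : Phi (\sum_(k <- msupp p) c k m * (x k).1,
      [ffun i => \sum_(k <- msupp p) c k n * (x k).2 i])
      = \sum_(k <- msupp p) c k m * Phi (x k).
    rewrite /Phi /= mulr_suml.
    under [in RHS]eq_bigr do rewrite mulrDr mulrA mulr_sumr.
    rewrite big_split /= exchange_big /=; congr (_ + _).
    apply: eq_bigr => i _; rewrite ffunE (rmorph_sum psi) mulr_suml.
    apply: eq_bigr => k _; rewrite (rmorphM psi) mulrA.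
    by rewrite [psi (c k n)](tate_compC A_sep).
  have pE : tate_poly oA p = \sum_(k <- msupp p) c k m * tate_poly oA 'X_[k].
    rewrite {1}[p]mpolyE rmorph_sum; apply: eq_bigr => k _.
    by rewrite -mul_mpolyC rmorphM /= tate_polyC.
  rewrite -(subrK (tate_poly oA p) z) -addrA {2}pE -sumrB.
  have [_ FD _] := tfilt_ideal oA m e.+1; apply: FD => //.
  apply: is_ideal_sum (tfilt_ideal _ _ _) _ => k _.
  by rewrite -mulrBr -addn1; apply: tfiltM.
- exact: tfilt0.
Qed.

(** Dividing [eta ^+ d] by [F] and moving the remainder to the left gives the monic relation.
    Divisibility by [F] is all that is recorded, since [F] will enter through ideals that contain
    its value. *)
Lemma tate_preparation (Q : {poly tate n}) (F : tate m) : Q \is monic ->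
  tfilt 1 (F - eval Q) ->
  exists2 P : {poly tate n}, P \is monic & exists q, eval P = q * F.
Proof.
move=> Qm FQ; pose d := (size Q).-1.
have sQ : size Q = d.+1 by rewrite /d prednK // size_poly_gt0 monic_neq0.
have [q [r [sr etaE]]] := tate_division Qm FQ (eta ^+ d).
exists ('X^d - r).
  apply/monicP; rewrite lead_coefDl ?lead_coefXn //.
  by rewrite size_polyN size_polyXn -sQ.
by exists q; rewrite rmorphB rmorphXn /= ext_evalX etaE addrK.
Qed.

End Division.

(** The number with base-[M] digits [nu i]; it determines [nu] as long as all entries are below
    [M]. *)
Definition mnm_weight M n (nu : 'X_{1..n}) : nat := (\sum_i nu i * M ^ i)%N.

(* [X |-> X], [Y_j |-> Y_(j+1) - Y_0^(M^(j+1))]; with [Y_0] adjoined to its image,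
   the monomial [Y^nu] becomes monic in [Y_0] of degree [mnm_weight M nu]. *)
Definition twist m n M (i : 'I_(m + n)) : tate (m + n.+1) :=
  match fintype.split i with
  | inl a => tateX (lshift n.+1 a)
  | inr b => tateX (rshift m (lift ord0 b)) - tateX (rshift m ord0) ^+ (M ^ b.+1)
  end.

Lemma twist_lift m n M (c : tate m) :
  comp (twist (m := m) (n := n) M) (tate_lift n c) = tate_lift n.+1 c.
Proof.
rewrite !(tate_liftE A_sep A_complete) (tate_comp_comp A_sep A_complete).
apply: (congr1 (fun g => comp g c)); apply: funext => i.
by rewrite (tate_compX A_sep A_complete) /twist (unsplitK (inl i)).
Qed.

Section TwistedPreparation.
Variables (m n M : nat).
Hypothesis M_gt0 : (0 < M)%N.

Let psi : {rmorphism tate (m + n) -> tate (m + n.+1)} :=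
  comp (twist (m := m) (n := n) M).
Local Notation eval := (ext_eval psi (tateX (rshift m ord0))).

(** Inverts the twist: [Y_(j+1)] is [Y_0^(M^(j+1))] plus the image of [Y_j], hence monic of degree
    [M^(j+1)] in [Y_0]. *)
Let varP (b : 'I_n.+1) : {poly tate (m + n)} :=
  if unlift ord0 b is Some j then 'X^(M ^ j.+1) + (tateX (rshift m j))%:P else 'X.

Let varP_spec b : [/\ varP b \is monic, size (varP b) = (M ^ b).+1
  & eval (varP b) = tateX (rshift m b)].
Proof.
rewrite /varP; case: (unliftP ord0 b) => [j|] ->.
  have pos : (0 < M ^ j.+1)%N by rewrite expn_gt0 M_gt0.
  split; [exact: monicXnaddC | exact: size_XnaddC |].
  rewrite rmorphD rmorphXn /= ext_evalX ext_evalC /=.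
  by rewrite (tate_compX A_sep A_complete) /twist (unsplitK (inr j)) addrC subrK.
by split; rewrite ?monicX ?size_polyX ?ext_evalX.
Qed.

Let monP (nu : 'X_{1..n.+1}) : {poly tate (m + n)} := \prod_b varP b ^+ nu b.

Let monP_spec nu : [/\ monP nu \is monic, size (monP nu) = (mnm_weight M nu).+1
  & eval (monP nu) = monY oA m nu].
Proof.
have sizeM (p q : {poly tate (m + n)}) k l : p \is monic -> q \is monic ->
    size p = k.+1 -> size q = l.+1 -> size (p * q) = (k + l).+1.
  move=> pm qm pk ql; rewrite size_Mmonic ?monic_neq0 // pk ql.
  by rewrite addSn addnS.
split.
- by apply: rpred_prod => b _; apply: rpredX; have [] := varP_spec b.
- suff [] : monP nu \is monic /\ size (monP nu) = (mnm_weight M nu).+1 by [].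
  rewrite /monP /mnm_weight; elim/big_rec2: _ => [|b k p _ [pm pk]].
    by rewrite monic1 size_poly1.
  have [vm vs _] := varP_spec b.
  have vX j : size (varP b ^+ j) = (j * M ^ b).+1.
    elim: j => [|j IH]; first by rewrite size_poly1.
    by rewrite exprS mulSn; apply: sizeM => //; apply: rpredX.
  by split; [rewrite rpredM ?rpredX | apply: sizeM => //; apply: rpredX].
- rewrite rmorph_prod /monY mpolyX_mnmcat [X in X * _]big1; last first.
    by move=> i _; rewrite mnm0E.
  rewrite mul1r rmorph_prod; apply: eq_bigr => b _.
  by rewrite !rmorphXn /= tate_polyX; have [_ _ ->] := varP_spec b.
Qed.

Let twisted_generated i : exists p, tateX i = eval p.
Proof.
have [] := fintype.splitP i => [a|b] ia.
  exists (tateX (lshift n a))%:P; rewrite ext_evalC /= (tate_compX A_sep A_complete).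
  by rewrite /twist (unsplitK (inl a)); congr tateX; apply: val_inj.
exists (varP b); have [_ _ ->] := varP_spec b.
by congr tateX; apply: val_inj.
Qed.

Lemma tate_twisted_division (P : {poly tate (m + n)}) f : P \is monic ->
  exists q (r : {poly tate (m + n)}),
    (size r < size P)%N /\ f = q * eval P + eval r.
Proof.
move=> Pm; apply: (tate_division twisted_generated Pm).
by rewrite subrr; have [] := tfilt_ideal oA (m + n.+1) 1.
Qed.

(** Rewriting every [Y^nu] as [monP nu] turns [F - E] into a polynomial in [Y_0], monic because
    [nu0] has coefficient 1 and strictly the largest weight. *)
Lemma tate_twisted_preparation (nu0 : 'X_{1..n.+1}) (s : seq 'X_{1..n.+1})
    (C : 'X_{1..n.+1} -> tate m) (E F : tate (m + n.+1)) :
  (forall nu, nu \in s -> (mnm_weight M nu < mnm_weight M nu0)%N) ->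
  tfilt 1 E ->
  F = monY oA m nu0 + \sum_(nu <- s) tate_lift n.+1 (C nu) * monY oA m nu + E ->
  exists2 P : {poly tate (m + n)}, P \is monic & exists q, eval P = q * F.
Proof.
move=> lt_s FE ->.
pose Q := monP nu0 + \sum_(nu <- s) (tate_lift n (C nu))%:P * monP nu.
have [m0 s0 e0] := monP_spec nu0.
apply: (tate_preparation twisted_generated (Q := Q)).
- apply/monicP; rewrite /Q lead_coefDl ?(monicP m0) // s0 ltnS.
  rewrite big_seq; apply: (leq_trans (size_sum _ _ _)); apply/bigmax_leqP_seq.
  move=> nu _ nus; rewrite mul_polyC; apply: leq_trans (size_scale_leq _ _) _.
  by have [_ -> _] := monP_spec nu; apply: lt_s.
- suff <- : eval Q = monY oA m nu0 +
      \sum_(nu <- s) tate_lift n.+1 (C nu) * monY oA m nu by rewrite addrC addKr.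
  have evD p q : eval (p + q) = eval p + eval q := rmorphD (ext_eval psi _) p q.
  have evM p q : eval (p * q) = eval p * eval q := rmorphM (ext_eval psi _) p q.
  have evS f : eval (\sum_(nu <- s) f nu) = \sum_(nu <- s) eval (f nu).
    exact: (rmorph_sum (ext_eval psi _)).
  rewrite /Q evD e0 evS; apply: congr1; apply: eq_bigr => nu _.
  rewrite evM; have [_ _ ->] := monP_spec nu.
  by rewrite ext_evalC /= twist_lift.
Qed.

End TwistedPreparation.
End Weierstrass.

(** * Specialization of parameters *)

Section Specialization.
Variables (A : comNzRingType) (oA : idealr A).
Hypothesis A_noeth : noetherian A.
Hypothesis A_sep : adic_separated [set` oA].
Hypothesis A_complete : adic_complete [set` oA].

Local Notation tate := (tate oA).
Local Notation comp := (tate_comp A_sep A_complete).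

(* [h(X, Y)] lies in the ideal generated by its coefficients [h_nu(X)], because
   this ideal is closed and contains approximations of [h]. *)
Lemma tate_coef_ideal m n (h : tate (m + n)) :
  exists (k : nat) (nu : 'I_k -> 'X_{1..n}) (g : 'I_k -> tate (m + n)),
    h = \sum_(i < k) tate_lift n (tate_coef h (nu i)) * g i.
Proof.
pose S : set (tate (m + n)) := [set f | exists nu, f = tate_lift n (tate_coef h nu)].
have [k [c [s [sS hE]]]] : ideal_gen S h.
  apply: (tate_ideal_closed A_noeth A_sep A_complete (ideal_gen_ideal S)) => e.
  have [d hd] := tate_coef_approx e h; eexists; last exact: hd.
  apply: is_ideal_sum (ideal_gen_ideal S) _ => nu _; rewrite mulrC.
  have [_ _ gM] := ideal_gen_ideal S; apply/gM/sub_ideal_gen.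
  by exists (val nu).
have [nu nuE] := choice sS.
exists k, nu, c; rewrite [LHS]hE; apply: eq_bigr => i _.
by rewrite mulrC {1}nuE.
Qed.

(** The ring [S] has no topology, so vanishing cannot be summed over infinitely many terms; the
    finite combination of coefficients replaces this. It makes [h(x, y)] depend on the series
    [h(x, Y)] only. *)
Lemma tate_coef_vanish m n (S : comNzRingType) (phi : {rmorphism tate (m + n) -> S})
    (h : tate (m + n)) :
  (forall nu, phi (tate_lift n (tate_coef h nu)) = 0) -> phi h = 0.
Proof.
move=> h0; have [k [nu [g ->]]] := tate_coef_ideal h.
by rewrite rmorph_sum big1 // => i _; rewrite rmorphM h0 mul0r.
Qed.

Definition rename_params n m m' (r : 'I_m -> 'I_m') (i : 'I_(m + n)) : tate (m' + n) :=
  match fintype.split i with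
  | inl a => tateX (lshift n (r a))
  | inr b => tateX (rshift m' b)
  end.

Lemma rename_params_lift n m m' (r : 'I_m -> 'I_m') c :
  comp (rename_params (n := n) r) (tate_lift n c)
    = tate_lift n (comp (fun i => tateX (r i)) c).
Proof.
rewrite !(tate_liftE A_sep A_complete) !(tate_comp_comp A_sep A_complete).
apply: (congr1 (fun g => comp g c)); apply: funext => i.
by rewrite !(tate_compX A_sep A_complete) /rename_params (unsplitK (inl i)).
Qed.

Lemma rename_params_monY n m m' (r : 'I_m -> 'I_m') k :
  comp (rename_params (n := n) r) (monY oA m k) = monY oA m' k.
Proof.
rewrite /monY (tate_comp_mon A_sep A_complete) mpolyX_mnmcat.
rewrite rmorphM !rmorph_prod big_split_ord /= [X in X * _ = _]big1; last first.
  by move=> i _; rewrite mnmE (unsplitK (inl i)) mnm0E.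
rewrite [X in _ = X * _]big1; last by move=> i _; rewrite mnm0E rmorph1.
rewrite !mul1r; apply: eq_bigr => i _.
rewrite rmorphXn /= tate_polyX mnmE (unsplitK (inr i)).
by rewrite /rename_params (unsplitK (inr i)).
Qed.

(** Clear for finite sums of monomials in [Y], and both sides preserve [tfilt]. *)
Lemma rename_params_coef n m m' (r : 'I_m -> 'I_m') (h : tate (m + n)) nu :
  tate_coef (comp (rename_params r) h) nu = comp (fun i => tateX (r i)) (tate_coef h nu).
Proof.
apply/eqP; rewrite -subr_eq0; apply/eqP/(tfilt_sep A_sep) => e.
have [d hd] := tate_coef_approx e h.
pose ren : {rmorphism tate (m + n) -> tate (m' + n)} := comp (rename_params r).
pose s : {rmorphism tate m -> tate m'} := comp (fun i => tateX (r i)).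
set p := \sum_(k : 'X_{1..n < d}) _ in hd.
pose cf : {additive tate (m' + n) -> tate m'} := coefY nu.
pose cf' : {additive tate (m + n) -> tate m} := coefY nu.
have pE : cf (ren p) = s (cf' p).
  rewrite /p (rmorph_sum ren) (raddf_sum cf) (raddf_sum cf') (rmorph_sum s).
  apply: eq_bigr => k _; rewrite (rmorphM ren).
  rewrite [ren (tate_lift _ _)]rename_params_lift [ren (monY _ _ _)]rename_params_monY.
  by rewrite /cf /cf' /= /coefY !tate_coef_lift_monY; case: eqP => // _; rewrite rmorph0.
have -> : tate_coef (comp (rename_params r) h) nu
    - comp (fun i => tateX (r i)) (tate_coef h nu) = cf (ren (h - p)) - s (cf' (h - p)).
  rewrite (rmorphB ren) (raddfB cf) (raddfB cf') pE (rmorphB s).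
  by rewrite opprB addrA subrK.
apply: is_idealB (tfilt_ideal _ _ _) _ _.
  by apply: tfilt_coef; apply: tfilt_comp.
by apply: tfilt_comp; apply: tfilt_coef.
Qed.

Variables (R : comNzRingType) (iR : Aring_structure oA R).

Definition reindex_row m m' (r : 'I_m -> 'I_m') (x : 'rV[R]_m') : 'rV[R]_m :=
  \row_i x 0 (r i).

Lemma reindex_row_l m m' (x : 'rV[R]_m) (x' : 'rV[R]_m') :
  reindex_row (@lshift m m') (row_mx x x') = x.
Proof. by apply/rowP => i; rewrite mxE row_mxEl. Qed.

Lemma reindex_row_r m m' (x : 'rV[R]_m) (x' : 'rV[R]_m') :
  reindex_row (@rshift m m') (row_mx x x') = x'.
Proof. by apply/rowP => i; rewrite mxE row_mxEr. Qed.

Lemma iota_at_rename m m' (r : 'I_m -> 'I_m') x c :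
  iota_at iR x (comp (fun i => tateX (r i)) c) = iota_at iR (reindex_row r x) c.
Proof.
rewrite (iota_at_comp A_noeth); congr (iota_at iR _ _).
by apply/rowP => i; rewrite !mxE iota_atX.
Qed.

Lemma spec_rename n m m' (r : 'I_m -> 'I_m') x (h : tate (m + n)) :
  spec iR (comp (rename_params r) h) x = spec iR h (reindex_row r x).
Proof.
apply/mpsP => nu; change (iota_at iR x (tate_coef (comp (rename_params r) h) nu)
  = iota_at iR (reindex_row r x) (tate_coef h nu)).
by rewrite rename_params_coef iota_at_rename.
Qed.

Lemma spec_lift_monY n m (x : 'rV[R]_m) c (k nu : 'X_{1..n}) :
  spec iR (tate_lift n c * monY oA m k) x nu
    = if nu == k then iota_at iR x c else 0.
Proof.
change (iota_at iR x (tate_coef (tate_lift n c * monY oA m k) nu)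
  = if nu == k then iota_at iR x c else 0).
by rewrite tate_coef_lift_monY; case: eqP => // _; rewrite rmorph0.
Qed.

Lemma spec_lift n m (x : 'rV[R]_m) c :
  spec iR (tate_lift n c) x = mpsC n (iota_at iR x c).
Proof.
apply/mpsP => nu; rewrite -[tate_lift n c]mulr1.
rewrite (_ : 1 = monY oA m 0) ?spec_lift_monY //.
by rewrite /monY mnmcat0 mpolyX0 rmorph1.
Qed.

Lemma iota_at_const m (x : 'rV[R]_m) a :
  iota_at iR x (tateC m a) = iota_ iR 0 (tateC 0 a) 0.
Proof.
have g0 : 'I_0 -> tate m by case.
rewrite -(tate_compC A_sep A_complete g0) (iota_at_comp A_noeth) /iota_at.
by congr (iota_ iR 0 _ _); apply/rowP => -[].
Qed.

(* Properties of a parameter point [x] that persist when further parameters are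
   added; finitely many of them, each satisfiable, hold at a common point. *)
Definition stable_under_params (P : forall m, 'rV[R]_m -> Prop) : Prop :=
  forall m m' (r : 'I_m -> 'I_m') x, P m (reindex_row r x) -> P m' x.

Lemma merge_params P Q : stable_under_params P -> stable_under_params Q ->
  (exists m x, P m x) -> (exists m x, Q m x) -> exists m x, P m x /\ Q m x.
Proof.
move=> sP sQ [m [x Px]] [m' [x' Qx']]; exists (m + m')%N, (row_mx x x'); split.
  by apply: (sP _ _ (@lshift m m')); rewrite reindex_row_l.
by apply: (sQ _ _ (@rshift m m')); rewrite reindex_row_r.
Qed.

Lemma merge_params_seq (I : eqType) (s : seq I) (P : I -> forall m, 'rV[R]_m -> Prop) :
  (forall i, stable_under_params (P i)) ->
  (forall i, i \in s -> exists m x, P i m x) ->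
  exists m x, forall i, i \in s -> P i m x.
Proof.
move=> sP; elim: s => [|i s IH] Ps; first by exists 0%N, 0.
have [m [x [Pi Px]]] : exists m x, P i m x /\ forall j, j \in s -> P j m x.
  apply: (@merge_params (P i) (fun m x => forall j, j \in s -> P j m x)) => //.
  - by move=> m m' r x Px j js; apply: sP (Px j js).
  - by apply: Ps; rewrite mem_head.
  - by apply: IH => j js; apply: Ps; rewrite inE js orbT.
by exists m, x => j; rewrite inE => /orP[/eqP ->|/Px].
Qed.

Definition const_over (c : R) m (x : 'rV[R]_m) : Prop :=
  exists C, iota_at iR x C = c.

Lemma const_over_stable c : stable_under_params (const_over c).
Proof.
by move=> m m' r x [C CE]; exists (comp (fun i => tateX (r i)) C); rewrite iota_at_rename.
Qed.

Lemma const_over_ex c : exists m x, const_over c (x : 'rV[R]_m).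
Proof. by exists 1%N, (const_mx c), (tateX 0); rewrite iota_atX mxE. Qed.

Definition series_over n (g : mps n R) m (x : 'rV[R]_m) : Prop :=
  exists h : tate (m + n), spec iR h x = g.

Lemma series_over_stable n (g : mps n R) : stable_under_params (series_over g).
Proof.
by move=> m m' r x [h hE]; exists (comp (rename_params r) h); rewrite spec_rename.
Qed.

Lemma series_over_ex n (g : mps n R) : g \in Rtate iR n ->
  exists m x, series_over g (x : 'rV[R]_m).
Proof. by case/RtateP => m [h [x ->]]; exists m, x, h. Qed.

End Specialization.

(** * Viable valuation rings *)

Section ViableRing.
Variables (A : comNzRingType) (oA : idealr A).
Hypothesis A_noeth : noetherian A.
Hypothesis A_sep : adic_separated [set` oA].
Hypothesis A_complete : adic_complete [set` oA].
Variables (K : fieldType) (R : valuation_subring K) (iR : Aring_structure oA R).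

Local Notation tate := (tate oA).

Lemma val_vring_neq0 (c : R) : c != 0 -> val c != 0.
Proof. by apply: contra_neq => E; apply: val_inj; rewrite E rmorph0. Qed.

Lemma vring_total (a b : R) : (exists c, a = c * b) \/ (exists c, b = c * a).
Proof.
have [->|b0] := eqVneq b 0; first by right; exists 0; rewrite mul0r.
have [->|a0] := eqVneq a 0; first by left; exists 0; rewrite mul0r.
have z0 : val a / val b != 0 by rewrite mulf_neq0 ?invr_eq0 ?val_vring_neq0.
case: (vringP R z0) => zV; [left|right].
  exists (Sub (val a / val b) zV : R); apply: val_inj.
  by rewrite rmorphM /= SubK divfK // val_vring_neq0.
exists (Sub (val a / val b)^-1 zV : R); apply: val_inj; rewrite rmorphM /= SubK.
by rewrite invfM invrK mulrAC mulVf ?val_vring_neq0 // mul1r.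
Qed.

Lemma vring_seq_max (s : seq R) : s != [::] ->
  exists2 x, x \in s & forall y, y \in s -> exists c, y = c * x.
Proof.
elim: s => // a [|b s] IH _.
  exists a; rewrite ?mem_head // => y; rewrite inE => /eqP ->.
  by exists 1; rewrite mul1r.
have [//|x xs xP] := IH.
case: (vring_total a x) => [[c aE]|[c xE]].
  exists x; first by rewrite inE xs orbT.
  by move=> y; rewrite inE => /orP[/eqP ->|/xP//]; exists c.
exists a; first exact: mem_head.
move=> y; rewrite inE => /orP[/eqP ->|/xP[d ->]]; first by exists 1; rewrite mul1r.
by exists (d * c); rewrite xE mulrA.
Qed.

(** If [z^-1] lies in the ring, dividing the monic equation by the next-to-top power of [z]
    expresses [z] as a polynomial in [z^-1] over the ring. *)
Lemma vring_integral (z : K) (p : {poly K}) : p \is monic ->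
  (forall i, p`_i \in vset R) -> root p z -> z \in vset R.
Proof.
move=> pm pV /rootP pz; have [->|z0] := eqVneq z 0.
  by rewrite -(rmorph0 (val : R -> K)); apply: valP.
case: (vringP R z0) => // zV; pose w : R := Sub z^-1 zV.
have wE : val w = z^-1 by rewrite SubK.
pose c i : R := Sub p`_i (pV i).
have cE i : val (c i) = p`_i by rewrite SubK.
have [d sp] : exists d, size p = d.+1.
  by exists (size p).-1; rewrite prednK // size_poly_gt0 monic_neq0.
have lc : p`_d = 1 by have := monicP pm; rewrite /lead_coef sp.
case: d sp lc => [|d] sp lc.
  move: pz; rewrite horner_coef sp big_ord1 lc expr0 mulr1 => /eqP.
  by rewrite oner_eq0.
suff -> : z = val (- \sum_(i < d.+1) c i * w ^+ (d - i)) by apply: valP.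
move: pz; rewrite horner_coef sp big_ord_recr /= lc mul1r => /eqP.
rewrite addr_eq0 => /eqP pz.
rewrite rmorphN rmorph_sum /=.
have zE : z = z ^+ d.+1 * z^-1 ^+ d.
  by rewrite exprS -mulrA -exprMn divff // expr1n mulr1.
rewrite [LHS]zE -[z ^+ d.+1]opprK -pz mulNr mulr_suml; congr (- _).
apply: eq_bigr => i _; rewrite rmorphM rmorphXn /= cE wE -mulrA; congr (_ * _).
have le_id : (i <= d)%N by rewrite -ltnS.
have dE : z^-1 ^+ d = z^-1 ^+ i * z^-1 ^+ (d - i) by rewrite -exprD subnKC.
by rewrite dE mulrA -exprMn divff // expr1n mul1r.
Qed.

Hypothesis R_viable : viable iR.

(* [t] comes from [oA] and generates the maximal ideal; viability provides such a [t]
   because [oA] is finitely generated. *)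
Definition uniformizer (t : R) : Prop :=
  [/\ exists2 a, a \in oA & forall m (x : 'rV[R]_m), iota_at iR x (tateC m a) = t,
      forall a m (x : 'rV[R]_m), a \in oA -> exists c, iota_at iR x (tateC m a) = c * t,
      t != 0, forall c, c * t != 1
    & forall u, (exists v, u * v = 1) \/ (exists c, u = c * t)].

Lemma uniformizer_ex : exists t, uniformizer t.
Proof.
have [[idO O1 Omax] O0] := R_viable; set S := [set _ | _ in _] in idO O1 Omax O0.
pose io a : R := iota_at iR 0 (tateC 0 a).
have ioE a m (x : 'rV[R]_m) : iota_at iR x (tateC m a) = io a.
  by rewrite (iota_at_const A_noeth A_sep A_complete).
have ioD a b : io (a + b) = io a + io b by rewrite /io !rmorphD.
have ioM a b : io (a * b) = io a * io b by rewrite /io !rmorphM.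
have io0 : io 0 = 0 by rewrite /io !rmorph0.
have [s sE] := A_noeth (idealr_is_ideal oA).
(* One image of a generator divides all the others; the extra 0 keeps the list nonempty. *)
have [_ /mapP[a as_ ->] aP] := @vring_seq_max (map io (0 :: s)) isT.
have oAs b : b \in s -> b \in oA.
  move=> bs; change ([set` oA] b); rewrite sE; exact: sub_ideal_gen.
have aA : a \in oA by move: as_; rewrite inE => /orP[/eqP -> | /oAs//]; apply: rpred0.
have div b : b \in oA -> exists c, io b = c * io a.
  move=> bA; have : [set` oA] b by [].
  rewrite sE => /ideal_gen_seqP[c ->].
  have /choice[d dE] : forall i : 'I_(size s), exists d, io s`_i = d * io a.
    by move=> i; apply: aP; rewrite /= inE map_f ?orbT // mem_nth.
  exists (\sum_i io (c i) * d i); rewrite (big_morph io ioD io0) mulr_suml.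
  by apply: eq_bigr => i _; rewrite ioM dE mulrA.
have oRa : ideal_gen S (io a) by apply: sub_ideal_gen; exists a.
have idR : is_ideal (ideal_gen S) := ideal_gen_ideal S.
have oR_sub J : is_ideal J -> J (io a) -> ideal_gen S `<=` J.
  move=> idJ Ja; apply: ideal_gen_min => // _ [b bA <-].
  have [_ _ JM] := idJ; change (J (io b)).
  by have [c ->] := div b bA; apply: JM.
have idM u : is_ideal [set x : R | exists c, x = c * u].
  split=> [|_ _ [c ->] [d ->]|x _ [c ->]]; first by exists 0; rewrite mul0r.
    by exists (c + d); rewrite mulrDl.
  by exists (x * c); rewrite mulrA.
exists (io a); split.
- by exists a => // m x; apply: ioE.
- by move=> b m x bA; rewrite ioE; apply: div.
- apply: contra_notN O0 => /eqP a0; apply/seteqP; split; last first.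
    by move=> _ ->; have [] := idR.
  apply: oR_sub; last exact: a0.
  split=> // [x y -> ->|x y ->]; first by rewrite addr0.
  exact: mulr0.
- move=> c; apply: contra_notN O1 => /eqP <-.
  by have [_ _ gM] := idR; apply: gM.
(* If [u] divides [io a] and is not a unit, the ideal of multiples of [u] is proper and contains the
   maximal one, hence equals it. *)
- move=> u; case: (vring_total u (io a)) => [[c uE]|[c aE]].
    by right; exists c.
  have [[d dE]|n1] := pselect (exists d, 1 = d * u).
    by left; exists d; rewrite mulrC.
  have E : [set x : R | exists c, x = c * u] = ideal_gen S.
    by apply: Omax => //; apply: oR_sub => //; exists c.
  have : ideal_gen S u by rewrite -E; exists 1; rewrite mul1r.
  move=> uS; right; apply: (oR_sub [set x : R | exists c, x = c * io a] _ _ u uS) => //.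
  by exists 1; rewrite mul1r.
Qed.

Variable t : R.
Hypothesis tP : uniformizer t.

(** Provides infinitely many elements of [K], for the generic choice in [avoid]. *)
Lemma uniformizer_expI : injective (fun i => t ^+ i).
Proof.
have [_ _ t0 t1 _] := tP.
suff lt i j : (i < j)%N -> t ^+ i != t ^+ j.
  move=> i j E; case: (ltngtP i j) => // /lt; first by rewrite E eqxx.
  by rewrite -E eqxx.
move=> lt_ij; apply/eqP => E.
have tj : t ^+ j = t ^+ i * (t ^+ (j - i.+1) * t).
  by rewrite -exprSr -exprD -subSn // subSS subnKC // ltnW.
have /eqP : t ^+ i * 1 = t ^+ i * (t ^+ (j - i.+1) * t) by rewrite mulr1 -tj.
by move/eqP/(mulfI (expf_neq0 i t0))/esym/eqP; rewrite (negPf (t1 _)).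
Qed.

(** The series whose value at [x] is a multiple of [t] form an ideal, which is closed, so
    polynomials with coefficients in [oA] decide the matter. *)
Lemma tfilt1_iota m (x : 'rV[R]_m) (f : tate m) :
  tfilt 1 f -> exists c, iota_at iR x f = c * t.
Proof.
have [_ tA _ _ _] := tP.
move=> fF; pose J : set (tate m) := [set f | exists c, iota_at iR x f = c * t].
have idJ : is_ideal J.
  split=> [|f1 f2 [c cE] [d dE]|f1 f2 [c cE]].
  - by exists 0; rewrite rmorph0 mul0r.
  - by exists (c + d); rewrite rmorphD /= cE dE mulrDl.
  - by exists (iota_at iR x f1 * c); rewrite rmorphM /= cE mulrA.
apply: (tate_ideal_closed A_noeth A_sep A_complete idJ) => e.
have [p [Fp /(_ 1%N fF) pO]] := tate_dense e f.
exists (tate_poly oA p) => //; rewrite [p]mpolyE rmorph_sum.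
apply: is_ideal_sum (idJ) _ => k _; rewrite -mul_mpolyC rmorphM mulrC.
have [_ _ JM] := idJ; apply: JM; rewrite /= tate_polyC; apply: tA.
have : ideal_gen [set` oA] p@_k.
  move: (pO k); apply: ideal_gen_min; first exact: ideal_gen_ideal.
  by move=> _ [b [bA ->]]; rewrite big_ord1; apply: sub_ideal_gen.
by apply: (ideal_gen_min (idealr_is_ideal oA)).
Qed.

Variable n : nat.
Implicit Types (g u w : mps n R) (nu : 'X_{1..n}).

Lemma Rtate_small g : g \in Rtate iR n ->
  exists d, forall nu, (d <= mdeg nu)%N -> exists c, g nu = c * t.
Proof.
case/RtateP => m [h [x ->]]; have /restrictedP/(_ 1%N)[d hd] := tate_valP h.
exists d => nu le_d; apply: tfilt1_iota => mu; apply: hd.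
by rewrite mdeg_cat (leq_trans le_d) // leq_addl.
Qed.

(* The Gauss norm is attained: among the finitely many coefficients generating the
   ideal of [tate_coef_ideal], one divides all the others. *)
Lemma Rtate_gauss g : g \in Rtate iR n -> g != 0 ->
  exists nu u, [/\ u \in Rtate iR n, g = g nu *: u & u nu = 1].
Proof.
case/RtateP => m [h [x gE]] g0.
have [k [nu [s hE]]] := tate_coef_ideal A_noeth A_sep A_complete h.
have gsum : g = \sum_(i < k) g (nu i) *: spec iR (s i) x.
  pose sp (f : tate (m + n)) := spec iR f x.
  have sp0 : sp 0 = 0 by rewrite -(subrr 0) /sp specB subrr.
  have spD : {morph sp : f f' / f + f'} by move=> f f'; rewrite /sp specD.
  rewrite [LHS]gE -/(sp h) {1}hE (big_morph sp spD sp0); apply: eq_bigr => i _.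
  by rewrite /sp specM spec_lift mpsCM gE.
have [] := @vring_seq_max (map (fun i => g (nu i)) (enum 'I_k)).
  apply: contra_neq g0 => E; rewrite gsum big1 // => i _.
  by have := mem_enum 'I_k i; case: (enum 'I_k) E.
move=> _ /mapP[i0 _ ->] maxP.
have /choice[c cE] : forall i, exists c, g (nu i) = c * g (nu i0).
  by move=> i; apply: maxP; apply: map_f; rewrite mem_enum.
pose u := \sum_(i < k) c i *: spec iR (s i) x.
have gu : g = g (nu i0) *: u.
  rewrite {1}gsum scaler_sumr; apply: eq_bigr => i _.
  by rewrite cE scalerA mulrC.
exists (nu i0), u; split=> //.
  apply: rpred_sum => i _; apply: RtateZ; apply/RtateP; by exists m, (s i), x.
have gi0 : g (nu i0) != 0 by apply: contra_neq g0 => E; rewrite gu E scale0r.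
by apply: (mulfI gi0); rewrite mulr1 {2}gu mpsZE.
Qed.

(** Coefficientwise division by [t] does not visibly stay in [R<Y>]. Once the dominant coefficient
    is factored out, only this scalar has to be divided. *)
Lemma Rtate_div w : w \in Rtate iR n -> (forall nu, exists c, w nu = c * t) ->
  exists2 w', w' \in Rtate iR n & w = t *: w'.
Proof.
move=> wR wt; have [->|w0] := eqVneq w 0; first by exists 0; rewrite ?rpred0 ?scaler0.
have [nu [u [uR wE _]]] := Rtate_gauss wR w0.
have [c cE] := wt nu; exists (c *: u); first exact: RtateZ.
by rewrite wE cE scalerA mulrC.
Qed.

End ViableRing.

(** * Ring morphisms out of K<Y> *)

Section KtateMorphisms.
Variables (A : comNzRingType) (oA : idealr A).
Hypothesis A_noeth : noetherian A.
Hypothesis A_sep : adic_separated [set` oA].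
Hypothesis A_complete : adic_complete [set` oA].
Variables (K : fieldType) (R : valuation_subring K) (iR : Aring_structure oA R).

Local Notation tate := (tate oA).
Local Notation comp := (tate_comp A_sep A_complete).

Section Inclusion.
Variable n : nat.

Fact kincl_subproof m (h : tate (m + n)) (x : 'rV[R]_m) :
  mps_map val (spec iR h x) \in @Ktate_pred A oA K R iR n.
Proof.
apply/Ktate_predP; exists 1, (spec iR h x); split; rewrite ?oner_neq0 //.
  by apply/RtateP; exists m, h, x.
by rewrite rmorph1 invr1 scale1r.
Qed.

(* [h(x, Y)] as an element of [K<Y>]. *)
Definition kincl m (x : 'rV[R]_m) (h : tate (m + n)) : Ktate iR n :=
  KTate (kincl_subproof h x).

Fact kincl_is_additive m (x : 'rV[R]_m) : additive (kincl x).
Proof.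
move=> h h'; apply/val_inj/mpsP => nu.
change (val (spec iR (h - h') x nu) = val (spec iR h x nu) - val (spec iR h' x nu)).
by rewrite specB mpsBE rmorphB.
Qed.

Fact kincl_is_multiplicative m (x : 'rV[R]_m) : multiplicative (kincl x).
Proof.
split=> [h h'|]; apply/val_inj/mpsP => nu.
  change (val (spec iR (h * h') x nu) =
    (mps_map val (spec iR h x) * mps_map val (spec iR h' x)) nu).
  rewrite specM !mpsME rmorph_sum; apply: eq_bigr => k _.
  by rewrite rmorphM.
change (val (spec iR 1 x nu) = (1 : mps n K) nu).
by rewrite spec1 !mps1E; case: eqP => _; rewrite ?rmorph1 ?rmorph0.
Qed.

HB.instance Definition _ m (x : 'rV[R]_m) :=
  GRing.isAdditive.Build (tate (m + n)) (Ktate iR n) (kincl x) (kincl_is_additive x).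
HB.instance Definition _ m (x : 'rV[R]_m) :=
  GRing.isMultiplicative.Build (tate (m + n)) (Ktate iR n) (kincl x)
    (kincl_is_multiplicative x).

Lemma ktvalZ (k : K) (f : Ktate iR n) : ktval (k%:A * f) = k *: ktval f.
Proof. by rewrite mulr_algl. Qed.

Lemma kincl_rename m m' (r : 'I_m -> 'I_m') (x : 'rV[R]_m') h :
  kincl x (comp (rename_params oA r) h) = kincl (reindex_row r x) h.
Proof. by apply: val_inj; rewrite /= (spec_rename A_noeth). Qed.

Lemma kincl_lift m (x : 'rV[R]_m) c :
  kincl x (tate_lift n c) = (val (iota_at iR x c))%:A.
Proof.
apply: val_inj; change (mps_map val (spec iR (tate_lift n c) x) =
  val (iota_at iR x c) *: (1 : mps n K)).
rewrite spec_lift; apply/mpsP => nu; rewrite mpsZE mps1E /=.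
by case: eqP => _; rewrite ?mulr1 ?mulr0 ?rmorph0.
Qed.

Lemma Ktate_pair (f f' : Ktate iR n) :
  exists (c : R) m (x : 'rV[R]_m) h h', [/\ c != 0,
    f = (val c)^-1%:A * kincl x h & f' = (val c)^-1%:A * kincl x h'].
Proof.
case: f f' => [f fP] [f' f'P].
have /Ktate_predP[c [g [c0 gR fE]]] := fP.
have /Ktate_predP[c' [g' [c'0 g'R f'E]]] := f'P.
have [m [h [h' [x [gE g'E]]]]] := Rtate_pair (RtateZ c' gR) (RtateZ c g'R).
exists (c * c'), m, x, h, h'; split; first by rewrite mulf_neq0.
  apply: val_inj; transitivity ((val (c * c'))^-1 *: mps_map val (spec iR h x)).
    rewrite -gE; change (f = (val (c * c'))^-1 *: mps_map val (c' *: g)).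
    rewrite fE; apply/mpsP => nu; rewrite /= !rmorphM /=.
    by field; rewrite !val_vring_neq0.
  by rewrite mulr_algl.
apply: val_inj; transitivity ((val (c * c'))^-1 *: mps_map val (spec iR h' x)).
  rewrite -g'E; change (f' = (val (c * c'))^-1 *: mps_map val (c *: g')).
  rewrite f'E; apply/mpsP => nu; rewrite /= !rmorphM /=.
  by field; rewrite !val_vring_neq0.
by rewrite mulr_algl.
Qed.

Lemma Ktate_repr (f : Ktate iR n) : exists (c : R) m (x : 'rV[R]_m) h,
  c != 0 /\ f = (val c)^-1%:A * kincl x h.
Proof. by have [c [m [x [h [_ [c0 fE _]]]]]] := Ktate_pair f f; exists c, m, x, h. Qed.

Lemma Ktate_hom_eq (S : comNzRingType) (phi psi : {rmorphism Ktate iR n -> S}) :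
  (forall k : K, phi k%:A = psi k%:A) ->
  (forall m (x : 'rV[R]_m) h, phi (kincl x h) = psi (kincl x h)) -> phi =1 psi.
Proof.
move=> eqA eqR f; have [c [m [x [h [_ ->]]]]] := Ktate_repr f.
by rewrite !rmorphM eqA eqR.
Qed.

End Inclusion.

Section Extension.
Variables (n : nat) (S : comNzRingType) (J : {rmorphism K -> S}).
Variable Theta : forall m, 'rV[R]_m -> {rmorphism tate (m + n) -> S}.
Hypothesis Theta_lift : forall m (x : 'rV[R]_m) c,
  Theta x (tate_lift n c) = J (val (iota_at iR x c)).
Hypothesis Theta_rename : forall m m' (r : 'I_m -> 'I_m') (x : 'rV[R]_m') h,
  Theta x (comp (rename_params oA r) h) = Theta (reindex_row r x) h.

Let represents (f : Ktate iR n) (v : S) : Prop :=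
  exists (c : R) m (x : 'rV[R]_m) h, [/\ c != 0,
    f = (val c)^-1%:A * kincl x h & v = J (val c)^-1 * Theta x h].

Let Theta0 m (x : 'rV[R]_m) h : kincl x h = 0 -> Theta x h = 0.
Proof.
move=> h0; apply: (tate_coef_vanish A_noeth A_sep A_complete) => nu.
have /mpsP/(_ nu) : ktval (kincl x h) = 0 by rewrite h0.
change (val (iota_at iR x (tate_coef h nu)) = 0 ->
  Theta x (tate_lift n (tate_coef h nu)) = 0).
by move=> E; rewrite Theta_lift E rmorph0.
Qed.

(* Both representations live over a common parameter point, at which [c] and [c'] are
   values as well; their difference is then killed by [Theta0]. *)
Let represents_uniq f v v' : represents f v -> represents f v' -> v = v'.
Proof.
move=> [c [m [x [h [c0 -> ->]]]]] [c' [m' [x' [h' [c'0 E ->]]]]].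
pose P M (y : 'rV[R]_M) := exists H H' C C',
  [/\ kincl y H = kincl x h /\ Theta y H = Theta x h,
      kincl y H' = kincl x' h' /\ Theta y H' = Theta x' h',
      iota_at iR y C = c & iota_at iR y C' = c'].
have [M [y [H [H' [C [C' [[kH tH] [kH' tH'] yC yC']]]]]]] : exists M y, P M y.
  pose P1 M (y : 'rV[R]_M) :=
    exists H, kincl y H = kincl x h /\ Theta y H = Theta x h.
  pose P2 M (y : 'rV[R]_M) :=
    exists H, kincl y H = kincl x' h' /\ Theta y H = Theta x' h'.
  have s1 : stable_under_params P1.
    move=> M M' r y [H [kH tH]]; exists (comp (rename_params oA r) H).
    by rewrite kincl_rename Theta_rename.
  have s2 : stable_under_params P2.
    move=> M M' r y [H [kH tH]]; exists (comp (rename_params oA r) H).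
    by rewrite kincl_rename Theta_rename.
  have sC b := const_over_stable A_noeth A_sep A_complete (iR := iR) (c := b).
  have sCC := merge_params (sC c) (sC c') (const_over_ex iR c) (const_over_ex iR c').
  have sPP : exists M y, P1 M y /\ P2 M y.
    by apply: merge_params => //; [exists m, x, h | exists m', x', h'].
  have [||M [y [[[H HP] [H' H'P]] [[C CP] [C' C'P]]]]] := merge_params _ _ sPP sCC.
  - by move=> M M' r y [p1 p2]; split; [apply: s1 p1 | apply: s2 p2].
  - by move=> M M' r y [p1 p2]; split; [apply: sC p1 | apply: sC p2].
  by exists M, y, H, H', C, C'.
(* Denominators are cleared crosswise inside [A<X, Y>], which needs [c] and [c'] as values of [C]
   and [C']. *)
have : Theta y (tate_lift n C' * H - tate_lift n C * H') = 0.
  apply: Theta0; rewrite rmorphB !rmorphM /= !kincl_lift yC yC' kH kH'.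
  have u (b : R) : b != 0 -> (val b)%:A * (val b)^-1%:A = 1 :> Ktate iR n.
    by move=> b0; rewrite mulr_algl scalerA divff ?scale1r // val_vring_neq0.
  have kE : kincl x h = (val c)%:A * ((val c)^-1%:A * kincl x h).
    by rewrite mulrA u // mul1r.
  have kE' : kincl x' h' = (val c')%:A * ((val c')^-1%:A * kincl x' h').
    by rewrite mulrA u // mul1r.
  by set X := _^-1%:A * kincl x' h' in E kE'; rewrite kE E kE' mulrCA subrr.
rewrite rmorphB !rmorphM !Theta_lift yC yC' tH tH' => /eqP; rewrite subr_eq0 => /eqP TE.
have u (b : R) : b != 0 -> J (val b)^-1 * J (val b) = 1.
  by move=> b0; rewrite -rmorphM mulVf ?rmorph1 // val_vring_neq0.
rewrite -[LHS]mul1r -(u c' c'0) -mulrA [J (val c') * _]mulrCA TE.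
by rewrite [J (val c)^-1 * _]mulrA u // mul1r.
Qed.

Let kev_ex f : exists v, represents f v.
Proof.
by have [c [m [x [h [c0 fE]]]]] := Ktate_repr f; eexists; exists c, m, x, h.
Qed.

(* The ring morphism [K<Y> -> S] given by [c^-1 h(x, Y) |-> J(c)^-1 Theta_x(h)]. *)
Theorem Ktate_hom_ex : exists phi : {rmorphism Ktate iR n -> S},
  (forall k : K, phi k%:A = J k) /\
  (forall m (x : 'rV[R]_m) h, phi (kincl x h) = Theta x h).
Proof.
have [f fP] := choice kev_ex.
have fE v a : represents a v -> f a = v by apply: represents_uniq.
have repr1 m (x : 'rV[R]_m) h : represents (kincl x h) (Theta x h).
  exists 1, m, x, h; rewrite oner_neq0 !rmorph1 invr1 scale1r !mul1r.
  by rewrite rmorph1 mul1r.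
have fA : additive f.
  move=> a b; have [c [m [x [h [h' [c0 -> ->]]]]]] := Ktate_pair a b.
  have fr g : f ((val c)^-1%:A * kincl x g) = J (val c)^-1 * Theta x g.
    by apply: fE; exists c, m, x, g.
  by rewrite -mulrBr -rmorphB !fr rmorphB mulrBr.
have fM : multiplicative f.
  split=> [a b|]; last first.
    by rewrite -(rmorph1 (kincl (0 : 'rV[R]_0))) (fE _ _ (repr1 _ _ _)) rmorph1.
  have [c [m [x [h [h' [c0 -> ->]]]]]] := Ktate_pair a b.
  have fr g : f ((val c)^-1%:A * kincl x g) = J (val c)^-1 * Theta x g.
    by apply: fE; exists c, m, x, g.
  rewrite !fr.
  apply: fE; exists (c * c), m, x, (h * h'); split; first by rewrite mulf_neq0.
    rewrite !rmorphM mulrACA invfM; congr (_ * _).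
    by rewrite mulr_algl scalerA.
  by rewrite !rmorphM invfM rmorphM mulrACA.
pose phi0 := GRing.isAdditive.Build _ _ _ fA.
pose phi1 := GRing.isMultiplicative.Build _ _ _ fM.
pose phi : {rmorphism Ktate iR n -> S} := HB.pack f phi0 phi1.
exists phi; split=> [k|m x h]; last exact: fE.
have [c [d [d0 ->]]] : exists c d : R, d != 0 /\ k = (val d)^-1 * val c.
  have [->|k0] := eqVneq k 0; first by exists 0, 1; rewrite oner_neq0 !rmorph0 mulr0.
  case: (vringP R k0) => [kV|kV].
    by exists (Sub k kV : R), 1; rewrite oner_neq0 rmorph1 invr1 mul1r SubK.
  exists 1, (Sub k^-1 kV : R); rewrite SubK invrK rmorph1 mulr1; split=> //.
  apply: contra_neq k0 => /(congr1 val); rewrite SubK rmorph0 => /eqP.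
  by rewrite invr_eq0 => /eqP.
apply: fE; exists d, 1%N, (const_mx c), (tate_lift n (tateX 0)); split=> //.
  by rewrite kincl_lift iota_atX mxE mulr_algl scalerA.
by rewrite Theta_lift iota_atX mxE rmorphM.
Qed.

End Extension.

End KtateMorphisms.

(** * Weierstrass preparation over K *)

Lemma mnm_weight_inj M n (mu nu : 'X_{1..n}) :
  (forall i, (mu i < M)%N) -> (forall i, (nu i < M)%N) ->
  mnm_weight M mu = mnm_weight M nu -> mu = nu.
Proof.
move=> muM nuM E; apply/mnmP.
suff digits k (f g : 'I_k -> nat) : (forall i, (f i < M)%N) ->
    (forall i, (g i < M)%N) ->
    (\sum_i f i * M ^ i = \sum_i g i * M ^ i)%N -> f =1 g by apply: digits.
elim: k f g => [|k IH] f g fM gM; first by move=> _ [].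
rewrite !big_ord_recl !muln1.
have shift (h : 'I_k.+1 -> nat) : (\sum_(i < k) h (lift ord0 i) * M ^ lift ord0 i =
    (\sum_(i < k) h (lift ord0 i) * M ^ i) * M)%N.
  rewrite big_distrl; apply: eq_bigr => i _ /=.
  by rewrite /bump /= add1n expnSr mulnA.
rewrite !shift => E'.
have M_gt0 : (0 < M)%N by apply: leq_ltn_trans (fM ord0).
have E0 : f ord0 = g ord0.
  move/(congr1 (modn^~ M)): E'.
  by rewrite ![(_ + _ * M)%N]addnC !modnMDl !modn_small.
move: E'; rewrite E0 => /addnI/eqP; rewrite eqn_pmul2r // => /eqP E'.
have fg := IH (fun i => f (lift ord0 i)) (fun i => g (lift ord0 i))
  (fun i => fM _) (fun i => gM _) E'.
by move=> i; case: (unliftP ord0 i) => [l|] -> //; apply: fg.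
Qed.

Lemma ext_eval_map (R1 R2 S1 S2 : comNzRingType) (alpha : {rmorphism R1 -> R2})
    (beta : {rmorphism S1 -> S2}) (psi1 : {rmorphism R1 -> S1})
    (psi2 : {rmorphism R2 -> S2}) (eta : S1) p :
  (forall c, beta (psi1 c) = psi2 (alpha c)) ->
  beta (ext_eval psi1 eta p) = ext_eval psi2 (beta eta) (map_poly alpha p).
Proof.
move=> E; rewrite /ext_eval -horner_map -!map_poly_comp /=.
by congr _.[_]; apply: eq_map_poly => c /=; rewrite E.
Qed.

Section Preparation.
Variables (A : comNzRingType) (oA : idealr A).
Hypothesis A_noeth : noetherian A.
Hypothesis A_sep : adic_separated [set` oA].
Hypothesis A_complete : adic_complete [set` oA].
Variables (K : fieldType) (R : valuation_subring K) (iR : Aring_structure oA R).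
Hypothesis R_viable : viable iR.

Local Notation tate := (tate oA).
Local Notation comp := (tate_comp A_sep A_complete).

Definition series_mon n (k : 'X_{1..n}) : mps n R := MPS (fun nu => (nu == k)%:R).

Lemma spec_lift_mon n m (x : 'rV[R]_m) c (k : 'X_{1..n}) :
  spec iR (tate_lift n c * monY oA m k) x = iota_at iR x c *: series_mon k.
Proof.
apply/mpsP => nu; rewrite spec_lift_monY mpsZE /=.
by case: eqP => _; rewrite ?mulr1 ?mulr0.
Qed.

Lemma spec_mon n m (x : 'rV[R]_m) (k : 'X_{1..n}) :
  spec iR (monY oA m k) x = series_mon k.
Proof.
have := spec_lift_mon x 1 k; rewrite rmorph1 scale1r => <-.
congr (spec iR _ x); rewrite (tate_liftE A_sep A_complete) rmorph1.
by rewrite mul1r.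
Qed.

Lemma series_mon_Rtate n (k : 'X_{1..n}) : series_mon k \in Rtate iR n.
Proof. by apply/RtateP; exists 0%N, (monY oA 0 k), 0; rewrite spec_mon. Qed.

(* A series of Gauss norm 1 becomes, up to a unit, the value of some [F] to which
   [tate_twisted_preparation] applies. *)
Lemma Rtate_twist n (u : mps n.+1 R) nu1 : u \in Rtate iR n.+1 -> u nu1 = 1 ->
  exists (M : nat) (c : R) m (x : 'rV[R]_m) (F : tate (m + n.+1))
      (P : {poly tate (m + n)}),
    [/\ (0 < M)%N, c != 0, u = c *: spec iR F x, P \is monic
      & exists q, ext_eval (comp (twist oA M)) (tateX (rshift m ord0)) P = q * F].
Proof.
move=> uR u1; have [t tP] := uniformizer_ex A_noeth A_sep A_complete R_viable.
have [[a aA at_] _ t0 t1 tU] := tP.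
have [d dP] := Rtate_small A_noeth A_sep A_complete tP uR.
pose large nu := `[< ~ exists c, u nu = c * t >].
have small nu : ~~ large nu -> exists c, u nu = c * t.
  by move=> /asboolPn; apply: contra_notP.
have large_d nu : large nu -> (mdeg nu < d)%N.
  by move=> /asboolP nb; rewrite ltnNge; apply/negP => /dP.
have large1 : large nu1.
  by apply/asboolP => -[c cE]; have := t1 c; rewrite -cE u1 eqxx.
(* All multi-indices in [D] have degree below [d], so their entries are digits in base [M] and their
   weights are distinct. *)
pose M := d.+1; pose D := [seq nu <- map val (enum {: 'X_{1..n.+1 < d}}) | large nu].
have memD nu : (nu \in D) = large nu.
  rewrite mem_filter; apply/andb_idr => /large_d lt_d.
  by apply/mapP; exists (BMultinom lt_d); rewrite ?mem_enum.
have uniqD : uniq D by rewrite filter_uniq // map_inj_uniq ?enum_uniq //; apply: val_inj.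
pose wt (k : 'X_{1..n.+1 < d}) := mnm_weight M k.
case: (@arg_maxnP _ (BMultinom (large_d _ large1)) (fun k => large (val k)) wt large1).
move=> k0 large0 max0; pose nu0 : 'X_{1..n.+1} := val k0.
have lt_wt nu : nu \in D -> nu != nu0 -> (mnm_weight M nu < mnm_weight M nu0)%N.
  rewrite memD => bnu ne.
  have le_wt : (mnm_weight M nu <= mnm_weight M nu0)%N.
    exact: (max0 (BMultinom (large_d _ bnu)) bnu).
  rewrite ltn_neqAle le_wt andbT.
  apply: contra_neq ne; apply: mnm_weight_inj => i; rewrite ltnS.
    apply: leq_trans (ltnW (large_d _ bnu)).
    by rewrite mdegE (bigD1 i) //= leq_addr.
  apply: leq_trans (ltnW (large_d _ large0)).
  by rewrite mdegE (bigD1 i) //= leq_addr.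
have [v uv] : exists v, u nu0 * v = 1.
  by case: (tU (u nu0)) => // nu0t; move/asboolP: large0; case.
have c0 : u nu0 != 0 by apply: contra_eq_neq uv => ->; rewrite mul0r eq_sym oner_neq0.
have [u' [u'R u'0 uE u'E]] : exists u', [/\ u' \in Rtate iR n.+1, u' nu0 = 1,
    u = u nu0 *: u' & forall nu, u' nu = v * u nu].
  exists (v *: u); split=> //; first exact: RtateZ.
    by rewrite mpsZE mulrC.
  by rewrite scalerA uv scale1r.
(* What remains has all coefficients in the maximal ideal, so [w] is [t] times a series of [R<Y>];
   as [t] is the value of [a] in [oA], it lifts to a series in [tfilt 1], the term [E] of the
   twisted preparation. *)
pose w := u' - \sum_(nu <- D) u' nu *: series_mon nu.
have wE mu : w mu = if mu \in D then 0 else u' mu.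
  rewrite mpsBE mps_sumE; case: ifP => [muD|/negbT muD].
    rewrite (bigD1_seq mu) //= eqxx mulr1 big1 ?addr0 ?subrr // => nu ne.
    by rewrite eq_sym (negPf ne) mulr0.
  rewrite big_seq big1 ?subr0 // => nu nuD /=; case: eqP => [E|_]; rewrite ?mulr0 //.
  by rewrite E nuD in muD.
have wR : w \in Rtate iR n.+1.
  by apply: rpredB => //; apply: rpred_sum => nu _; apply/RtateZ/series_mon_Rtate.
have [nu|w' w'R w'E] := Rtate_div (t := t) A_noeth A_sep A_complete wR.
  rewrite wE; case: ifPn => [_|]; first by exists 0; rewrite mul0r.
  by rewrite memD => /small[c cE]; exists (v * c); rewrite u'E cE mulrA.
have [m [x [[W WE] CE]]] : exists m x, series_over iR w' x /\
    forall nu, nu \in D -> const_over iR (u' nu) (x : 'rV[R]_m).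
  apply: (@merge_params _ (fun m x => series_over iR w' x)
    (fun m x => forall nu, nu \in D -> const_over iR (u' nu) (x : 'rV[R]_m))).
  - exact: (series_over_stable A_noeth A_sep A_complete).
  - move=> m m' r x H nu nuD.
    exact: (const_over_stable A_noeth A_sep A_complete (H nu nuD)).
  - exact: series_over_ex.
  - apply: merge_params_seq => [nu|nu _]; last exact: const_over_ex.
    exact: (const_over_stable A_noeth A_sep A_complete).
have /choice[C CP] : forall nu, exists c : tate m, nu \in D -> iota_at iR x c = u' nu.
  move=> nu; have [/CE[c cE]|] := boolP (nu \in D); first by exists c.
  by exists 0.
pose s := [seq nu <- D | nu != nu0].
pose F := monY oA m nu0 + \sum_(nu <- s) tate_lift n.+1 (C nu) * monY oA m nu
  + tateC _ a * W.
have specF : spec iR F x = u'.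
  pose sp (f : tate (m + n.+1)) := spec iR f x.
  have sp0 : sp 0 = 0 by rewrite -(subrr 0) /sp specB subrr.
  have spD : {morph sp : f f' / f + f'} by move=> f f'; rewrite /sp specD.
  rewrite -/(sp F) /F !spD (big_morph sp spD sp0) {1}/sp spec_mon.
  have -> : sp (tateC _ a * W) = w.
    rewrite /sp specM WE w'E -(at_ _ x) -mpsCM -spec_lift.
    by rewrite (tate_liftE A_sep A_complete) (tate_compC A_sep A_complete).
  rewrite /w [X in u' - X](bigD1_seq nu0) ?memD //= u'0 scale1r /s big_filter.
  rewrite [X in _ + X + _](_ : _ = \sum_(nu <- D | nu != nu0) u' nu *: series_mon nu).
    by rewrite [LHS]addrC subrK.
  rewrite big_seq_cond [RHS]big_seq_cond; apply: eq_bigr => nu /andP[nuD _].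
  by rewrite /sp spec_lift_mon CP.
have M0 : (0 < M)%N by [].
have [|||P Pm PF] := @tate_twisted_preparation _ _ A_sep A_complete m n M M0
    nu0 s C (tateC _ a * W) F.
- by move=> nu; rewrite mem_filter => /andP[ne nuD]; apply: lt_wt.
- rewrite -[1%N]addn0; apply: tfiltM; last exact: tfilt0.
  exact/tfiltC/ideal_pow1.
- by [].
by exists M, (u nu0), m, x, F, P; rewrite specF.
Qed.

Lemma Ktate_gauss n (f : Ktate iR n) : f != 0 ->
  exists (k : K) (u : mps n R) nu,
    [/\ k != 0, u \in Rtate iR n, u nu = 1 & ktval f = k *: mps_map val u].
Proof.
have [c [m [x [h [c0 ->]]]]] := Ktate_repr f => f0.
have gR : spec iR h x \in Rtate iR n by apply/RtateP; exists m, h, x.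
have g0 : spec iR h x != 0.
  apply: contra_neq f0 => g0; rewrite (_ : kincl iR x h = 0) ?mulr0 //.
  apply: val_inj; change (mps_map val (spec iR h x) = 0 :> mps n K).
  by rewrite g0; apply/mpsP => nu; apply: rmorph0.
have [nu [u [uR gE u1]]] := Rtate_gauss A_noeth A_sep A_complete gR g0.
exists ((val c)^-1 * val (spec iR h x nu)), u, nu; split=> //.
  rewrite mulf_neq0 ?invr_eq0 ?val_vring_neq0 //.
  by apply: contra_neq g0 => E; rewrite gE E scale0r.
rewrite ktvalZ -scalerA; congr (_ *: _); apply/mpsP => mu.
by change (val (spec iR h x mu) = val (spec iR h x nu) * val (u mu));
  rewrite -rmorphM -mpsZE -gE.
Qed.

Lemma Ktate0_unit (f : Ktate iR 0) : f != 0 -> exists2 k : K, k != 0 & f = k%:A.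
Proof.
move=> /Ktate_gauss[k [u [nu [k0 _ u1 fE]]]]; exists k => //; apply: val_inj.
change (ktval f = k *: (1 : mps 0 K)); rewrite fE; congr (_ *: _).
apply/mpsP => mu; rewrite mps1E /= (nvar0_mnmE mu) eqxx -(nvar0_mnmE nu) u1.
exact: rmorph1.
Qed.

Definition kvar n (b : 'I_n) : Ktate iR n := kincl iR (0 : 'rV[R]_0) (tateX (rshift 0 b)).

Lemma kincl_var n m (x : 'rV[R]_m) (b : 'I_n) :
  kincl iR x (tateX (rshift m b)) = kvar b.
Proof.
have r : 'I_0 -> 'I_m by case.
have -> : tateX (rshift m b) = comp (rename_params oA r) (tateX (rshift 0 b)).
  by rewrite (tate_compX A_sep A_complete) /rename_params (unsplitK (inr b)).
rewrite (kincl_rename A_noeth) /kvar; congr (kincl iR _ _).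
by apply/rowP => -[].
Qed.

(** The twist leaves [X] alone, so it commutes with renaming parameters and descends through
    [Ktate_hom_ex]. *)
Lemma Ktwist_ex n M : exists psi : {rmorphism Ktate iR n -> Ktate iR n.+1},
  (forall k : K, psi k%:A = k%:A) /\
  (forall m (x : 'rV[R]_m) h, psi (kincl iR x h) = kincl iR x (comp (twist oA M) h)).
Proof.
apply: (@Ktate_hom_ex _ _ A_noeth A_sep A_complete _ _ iR n (Ktate iR n.+1)
  (in_alg _) (fun m x => kincl iR x \o comp (twist oA M))) => [m x c|m m' r x h] /=.
  by rewrite twist_lift kincl_lift.
rewrite -(kincl_rename A_noeth A_sep A_complete); congr (kincl iR x _).
rewrite !(tate_comp_comp A_sep A_complete).
apply: (congr1 (fun g => comp g h)); apply: funext => i.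
rewrite -[i]splitK; case: (fintype.split i) => b /=.
  rewrite [rename_params _ _ (lshift _ _)]/rename_params (unsplitK (inl b)).
  rewrite [twist _ _ (lshift _ _)]/twist (unsplitK (inl b)).
  rewrite !(tate_compX A_sep A_complete) /rename_params /twist.
  by rewrite (unsplitK (inl (r b))) (unsplitK (inl b)).
rewrite [rename_params _ _ (rshift _ _)]/rename_params (unsplitK (inr b)).
rewrite [twist _ _ (rshift _ _)]/twist (unsplitK (inr b)).
rewrite rmorphB rmorphXn /= !(tate_compX A_sep A_complete) /rename_params /twist.
by rewrite !(unsplitK (inr _)).
Qed.

End Preparation.

(* [map_resultant] is stated for coefficients in a polynomial ring only. *)
Lemma map_resultant_rmorph (aR rR : comNzRingType) (f : {rmorphism aR -> rR}) p q :
    f (lead_coef p) != 0 -> f (lead_coef q) != 0 ->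
  f (resultant p q) = resultant (map_poly f p) (map_poly f q).
Proof.
move=> nz_fp nz_fq; rewrite /resultant /Sylvester_mx !size_map_poly_id0 //.
rewrite -det_map_mx /= map_col_mx; congr (\det (col_mx _ _));
  by apply: map_lin1_mx => v; rewrite map_poly_rV rmorphM /= map_rVpoly.
Qed.

(** * Evaluation at points over [Ra], and its compatibility with preparation *)

Section Points.
Variables (A : comNzRingType) (oA : idealr A).
Hypothesis A_noeth : noetherian A.
Hypothesis A_sep : adic_separated [set` oA].
Hypothesis A_complete : adic_complete [set` oA].
Variables (K : fieldType) (R : valuation_subring K) (iR : Aring_structure oA R).
Hypothesis R_viable : viable iR.
Variables (Ka : closedFieldType) (Ra : valuation_subring Ka).
Variables (iRa : Aring_structure oA Ra) (j : {rmorphism K -> Ka}).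
Variable e : {rmorphism R -> Ra}.
Hypothesis e_incl : forall x : R, val (e x) = j (val x).
Hypothesis Ra_extends : extends iR iRa e.

Local Notation tate := (tate oA).
Local Notation comp := (tate_comp A_sep A_complete).

Lemma Keval_ex n (y : 'rV[Ra]_n) : exists ev : {rmorphism Ktate iR n -> Ka},
  (forall k : K, ev k%:A = j k) /\
  (forall m (x : 'rV[R]_m) h,
     ev (kincl iR x h) = val (iota_at iRa (row_mx (map_mx e x) y) h)).
Proof.
apply: (@Ktate_hom_ex _ _ A_noeth A_sep A_complete _ _ iR n Ka j
  (fun m x => (val : Ra -> Ka) \o iota_at iRa (row_mx (map_mx e x) y)))
  => [m x c|m m' r x h] /=.
  rewrite (tate_liftE A_sep A_complete) (iota_at_comp A_noeth) -e_incl.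
  have [_ ext] := Ra_extends; rewrite [iota_at iR x c]/iota_at ext.
  congr (val (iota_ iRa _ _ _)); apply/rowP => i.
  by rewrite mxE iota_atX row_mxEl.
rewrite (iota_at_comp A_noeth); congr (val (iota_at iRa _ _)).
apply/rowP => i; rewrite mxE -[i]splitK /rename_params unsplitK.
case: (fintype.split i) => b /=; rewrite iota_atX.
  by rewrite !row_mxEl !mxE.
by rewrite !row_mxEr.
Qed.

Definition Keval n (y : 'rV[Ra]_n) : {rmorphism Ktate iR n -> Ka} :=
  projT1 (cid (Keval_ex y)).

Lemma KevalA n (y : 'rV[Ra]_n) (k : K) : Keval y k%:A = j k.
Proof. by have [] := projT2 (cid (Keval_ex y)). Qed.

Lemma Keval_kincl n (y : 'rV[Ra]_n) m (x : 'rV[R]_m) h :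
  Keval y (kincl iR x h) = val (iota_at iRa (row_mx (map_mx e x) y) h).
Proof. by have [_ H] := projT2 (cid (Keval_ex y)); apply: H. Qed.

(** This is the well-definedness of [f(y)]: every value allowed by the relation [Ktate_eval] is that
    of one ring morphism. *)
Lemma Keval_unique n (f : Ktate iR n) (y : 'rV[Ra]_n) v :
  Ktate_eval iRa e f y v -> v = Keval y f.
Proof.
move=> [c [m [h [x [c0 fE ->]]]]].
have -> : f = (val c)^-1%:A * kincl iR x h by apply: val_inj; rewrite mulr_algl.
by rewrite rmorphM KevalA Keval_kincl fmorphV e_incl.
Qed.

(** The interface of all later inductions. Division is by the monic value of [P], a multiple of [f];
    the coefficients of [P] come from series over [A], hence take values in [Ra]. *)
Theorem Ktate_preparation n (f : Ktate iR n.+1) : f != 0 ->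
  exists (psi : {rmorphism Ktate iR n -> Ktate iR n.+1}) (eta : Ktate iR n.+1)
      (P : {poly Ktate iR n}),
    [/\ forall k : K, psi k%:A = k%:A,
        P \is monic,
        exists q, ext_eval psi eta P = q * f,
        forall g, exists q (r : {poly Ktate iR n}), (size r < size P)%N /\
          g = q * ext_eval psi eta P + ext_eval psi eta r
      & forall y : 'rV[Ra]_n, (forall i, Keval y P`_i \in vset Ra) /\
          forall z : Ra, exists y' : 'rV[Ra]_n.+1,
            (forall g, Keval y' (psi g) = Keval y g) /\ Keval y' eta = val z].
Proof.
move=> /(Ktate_gauss A_noeth A_sep A_complete)[k [u [nu [k0 uR u1 fE]]]].
have [M [c [m [x [F [P [M0 c0 uE Pm [q PF]]]]]]]] :=
  Rtate_twist A_noeth A_sep A_complete R_viable uR u1.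
have [psi [psiA psiI]] := Ktwist_ex A_noeth A_sep A_complete iR n M.
pose eta : Ktate iR n.+1 := kvar iR ord0.
have evalI l (w : 'rV[R]_l) (p : {poly tate (l + n)}) :
    kincl iR w (ext_eval (comp (twist oA M)) (tateX (rshift l ord0)) p)
      = ext_eval psi eta (map_poly (kincl iR w) p).
  rewrite /eta -(kincl_var A_noeth A_sep A_complete iR w).
  by apply: (ext_eval_map (alpha := kincl iR w)) => h /=; rewrite psiI.
have fE' : f = (k * val c)%:A * kincl iR x F.
  apply: val_inj; rewrite mulr_algl; 
  change (ktval f = (k * val c) *: mps_map val (spec iR F x)).
  rewrite fE uE -scalerA; congr (_ *: _); apply/mpsP => mu.
  by rewrite /= rmorphM.
have kc0 : k * val c != 0 by rewrite mulf_neq0 ?val_vring_neq0.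
exists psi, eta, (map_poly (kincl iR x) P); split=> //.
- exact: monic_map.
- exists (((k * val c)^-1)%:A * kincl iR x q); rewrite -evalI PF rmorphM fE'.
  by rewrite [RHS]mulrACA [_%:A * _%:A]mulr_algl scalerA mulVf // scale1r mul1r.
- move=> g; have [d [l [w [h [d0 ->]]]]] := Ktate_repr g.
  (* [P] lives over the parameters [x] and [h] over [w]; both are renamed to the joint point before
     dividing in [A<X, Y>]. *)
  pose z := row_mx x w.
  pose Pz := map_poly (comp (rename_params oA (@lshift m l))) P.
  have kP : map_poly (kincl iR z) Pz = map_poly (kincl iR x) P.
    rewrite -map_poly_comp; apply: eq_map_poly => a /=.
    by rewrite (kincl_rename A_noeth) reindex_row_l.
  have Pzm : Pz \is monic by apply: monic_map.
  have [q' [r [sr hE]]] := tate_twisted_division A_sep A_complete M0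
    (comp (rename_params oA (@rshift m l)) h) Pzm.
  exists ((val d)^-1%:A * kincl iR z q'), ((val d)^-1%:A%:P * map_poly (kincl iR z) r).
  split.
    rewrite mul_polyC (leq_ltn_trans (size_scale_leq _ _)) //.
    apply: leq_ltn_trans (size_poly _ _) _; rewrite -kP.
    by rewrite size_map_poly_id0 // (monicP Pzm) rmorph1 oner_neq0.
  have -> : kincl iR w h = kincl iR z (comp (rename_params oA (@rshift m l)) h).
    by rewrite (kincl_rename A_noeth) reindex_row_r.
  rewrite {1}hE rmorphD rmorphM /= !evalI kP mulrDr mulrA; congr (_ + _).
  by rewrite [RHS]rmorphM /= ext_evalC psiA.
- move=> y; split=> [i|z].
    by rewrite coef_map Keval_kincl; apply: valP.
  (* Solves [Y_0 = z] and [Y_(i+1) - Y_0^(M^(i+1)) = y_i], so the twisted coordinates of [y'] are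
     those of [y]. *)
  pose y' : 'rV[Ra]_n.+1 := \row_b
    (if unlift ord0 b is Some i then y 0 i + z ^+ (M ^ i.+1) else z).
  exists y'; split; last first.
    rewrite /eta /kvar Keval_kincl iota_atX row_mxEr mxE unlift_none.
    by [].
  apply: (Ktate_hom_eq (phi := Keval y' \o psi)) => [a|l w h] /=.
    by rewrite psiA !KevalA.
  rewrite psiI !Keval_kincl (iota_at_comp A_noeth); congr (val (iota_at iRa _ _)).
  apply/rowP => i; rewrite mxE -[i]splitK /twist unsplitK.
  case: (fintype.split i) => b /=; first by rewrite iota_atX !row_mxEl.
  rewrite rmorphB rmorphXn /= !iota_atX !row_mxEr !mxE liftK unlift_none addrK.
  by [].
Qed.

End Points.

(** * Noetherianity, normalization and the Nullstellensatz *)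

Lemma noetherian_field (F : fieldType) : noetherian F.
Proof.
move=> I [I0 ID IM]; have [[x Ix x0]|none] := pselect (exists2 x, I x & x != 0).
  exists [:: x]; apply/seteqP; split=> [y _|]; last first.
    by apply: ideal_gen_min => // y; rewrite /= inE => /eqP ->.
  have [_ _ gM] := ideal_gen_ideal [set` [:: x]].
  by rewrite -(divfK x0 y); apply/gM/sub_ideal_gen; rewrite /= inE.
exists [::]; apply/seteqP; split=> [y Iy|]; last first.
  by apply: ideal_gen_min => // y; rewrite /= in_nil.
have [->|y0] := eqVneq y 0; first by have [] := ideal_gen_ideal [set` [::] : seq F].
by case: none; exists y.
Qed.

Section Main.
Variables (A : comNzRingType) (oA : idealr A).
Hypothesis A_noeth : noetherian A.
Hypothesis A_sep : adic_separated [set` oA].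
Hypothesis A_complete : adic_complete [set` oA].
Variables (K : fieldType) (R : valuation_subring K) (iR : Aring_structure oA R).
Hypothesis R_viable : viable iR.
Variables (Ka : closedFieldType) (Ra : valuation_subring Ka).
Variables (iRa : Aring_structure oA Ra) (j : {rmorphism K -> Ka}).
Variable e : {rmorphism R -> Ra}.
Hypothesis e_incl : forall x : R, val (e x) = j (val x).
Hypothesis Ra_extends : extends iR iRa e.

Local Notation T := (Ktate iR).
Local Notation prep := 
  (Ktate_preparation A_noeth A_sep A_complete R_viable e_incl Ra_extends).
Local Notation Keval := (Keval A_noeth A_sep A_complete e_incl Ra_extends).

Theorem Ktate_noetherian n : noetherian (T n).
Proof.
elim: n => [|n IH].
  pose scal : {rmorphism K -> T 0} := in_alg (T 0).
  refine (noetherian_surj (psi := scal) (@noetherian_field K) _) => f.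
  have [->|/(Ktate0_unit A_noeth A_sep A_complete)[k _ ->]] := eqVneq f 0.
    by exists 0; rewrite rmorph0.
  by exists k.
move=> I idI; have [I0 ID IM] := idI.
have [[f If f0]|none] := pselect (exists2 f, I f & f != 0).
  have [psi [eta [P [_ _ [q PE] div _]]]] := prep f0.
  apply: (noetherian_reduce (psi := psi) (s := [:: ext_eval psi eta P])
    (d := size P) (b := fun i => eta ^+ i)) => //.
    by move=> g; rewrite /= inE => /eqP ->; rewrite PE; apply: IM.
  move=> g _; have [q' [r [sr gE]]] := div g.
  exists (q' * ext_eval psi eta P).
    have [_ _ gM] := ideal_gen_ideal [set` [:: ext_eval psi eta P]].
    by apply/gM/sub_ideal_gen; rewrite /= inE.
  exists (fun i => r`_i); rewrite {1}gE; congr (_ + _).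
  exact/ext_eval_wide/ltnW.
exists [::]; apply/seteqP; split=> [y Iy|]; last first.
  by apply: ideal_gen_min => // y; rewrite /= in_nil.
have [->|y0] := eqVneq y 0.
  by have [] := ideal_gen_ideal [set` [::] : seq (T n.+1)].
by case: none; exists y.
Qed.

Lemma kernel_or_injective (S Q : comNzRingType) (pi : {rmorphism S -> Q}) :
  injective pi \/ exists2 f, f != 0 & pi f = 0.
Proof.
have [|none] := pselect (exists2 f, f != 0 & pi f = 0); first by right.
left=> a b E; apply/eqP; rewrite -subr_eq0; apply: contra_notT none => ab.
by exists (a - b); rewrite // rmorphB E subrr.
Qed.

Lemma T0_injective (Q : comNzRingType) (pi : {rmorphism T 0 -> Q}) : injective pi.
Proof.
case: (kernel_or_injective pi) => // -[f f0 pf].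
have [k k0 fE] := Ktate0_unit A_noeth A_sep A_complete f0.
have : pi (k^-1%:A * k%:A) = 0 by rewrite rmorphM -fE pf mulr0.
by rewrite mulr_algl scalerA mulVf // scale1r rmorph1 => /eqP; rewrite oner_eq0.
Qed.

(** The kernel of [pi \o psi] is the contraction of that of [pi]. If [pi] is not injective, a
    nonzero element of its kernel makes the image of [pi] finite over that of [pi \o psi], with the
    powers of [eta] below [size P] as module generators. *)
Theorem Ktate_normalization n (Q : comNzRingType) (pi : {rmorphism T n -> Q}) :
  exists m (theta : {rmorphism T m -> T n}),
    [/\ (m <= n)%N, forall k : K, theta k%:A = k%:A, injective (pi \o theta)
      & exists (I : finType) (b : I -> T n), forall g, exists c : I -> T m,
          pi g = pi (\sum_i theta (c i) * b i)].
Proof.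
have triv l (pi' : {rmorphism T l -> Q}) : injective pi' ->
    exists m (theta : {rmorphism T m -> T l}),
    [/\ (m <= l)%N, forall k : K, theta k%:A = k%:A, injective (pi' \o theta)
      & exists (I : finType) (b : I -> T l), forall g, exists c : I -> T m,
          pi' g = pi' (\sum_i theta (c i) * b i)].
  move=> inj; exists l, idfun; split=> //.
  exists unit, (fun=> 1) => g; exists (fun=> g).
  by rewrite (big_pred1 tt) ?mulr1 //; case.
elim: n pi => [|n IH] pi; first exact/triv/T0_injective.
case: (kernel_or_injective pi) => [/triv//|[f f0 pf]].
have [psi [eta [P [psiA _ [q PE] div _]]]] := prep f0.
have [m [theta [le_mn thetaA inj [I [b bP]]]]] := IH (pi \o psi).
exists m, (psi \o theta); split=> //.
- exact: leqW.
- by move=> k /=; rewrite thetaA psiA.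
exists (I * 'I_(size P))%type, (fun x : I * 'I_(size P) => psi (b x.1) * eta ^+ x.2) => g.
have [q' [r [sr gE]]] := div g.
have /choice[c cE] := fun i : 'I_(size P) => bP r`_i.
exists (fun x => c x.2 x.1).
rewrite {1}gE rmorphD rmorphM PE rmorphM pf !mulr0 add0r.
rewrite (ext_eval_wide _ _ (ltnW sr)) !rmorph_sum.
rewrite -(pair_big xpredT xpredT (fun a i =>
  pi ((psi \o theta) (c i a) * (psi (b a) * eta ^+ i)))) /= exchange_big /=.
apply: eq_bigr => i _; rewrite rmorphM [pi (psi _)]cE /= !rmorph_sum mulr_suml.
by apply: eq_bigr => a _; rewrite !rmorphM mulrA.
Qed.

Let avoid (s : seq Ka) : exists k : K, j k \notin s.
Proof.
have [t tP] := uniformizer_ex A_noeth A_sep A_complete R_viable.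
apply: contrapT => none.
pose u := [seq j (val (t ^+ i)) | i <- iota 0 (size s).+1].
have uu : uniq u.
  rewrite map_inj_uniq ?iota_uniq // => a b /fmorph_inj/val_inj.
  exact: uniformizer_expI tP a b.
have : (size u <= size s)%N.
  apply: uniq_leq_size => // _ /mapP[i _ ->]; apply: contrapT => ns.
  by apply: none; exists (val (t ^+ i)); apply/negP.
by rewrite size_map size_iota ltnn.
Qed.

Section CommonRoot.
Variables (n : nat) (Q : comNzRingType) (pi : {rmorphism T n.+1 -> Q}).
Variables (psi : {rmorphism T n -> T n.+1}) (eta : T n.+1) (P : {poly T n}).
Variable y : 'rV[Ra]_n.
Hypothesis P_monic : P \is monic.
Hypothesis P_ker : pi (ext_eval psi eta P) = 0.
Hypothesis y_ker : forall r, pi (psi r) = 0 -> Keval y r = 0.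

Local Notation eval := (ext_eval psi eta).
Local Notation at_y := (map_poly (Keval y)).

Let at_y_monic (p : {poly T n}) : p \is monic -> at_y p \is monic.
Proof. exact: monic_map. Qed.

(* A generic combination of polynomials in the kernel vanishes at no root at which
   one of them does not vanish. *)
Let combine (s : seq Ka) :
  (forall z, z \in s -> exists p, pi (eval p) = 0 /\ (at_y p).[z] != 0) ->
  exists p, pi (eval p) = 0 /\ forall z, z \in s -> (at_y p).[z] != 0.
Proof.
elim: s => [|z s IH] sP; first by exists 0; rewrite !rmorph0.
have [|p [p0 pP]] := IH; first by move=> w ws; apply: sP; rewrite inE ws orbT.
have [q [q0 qz]] := sP z (mem_head _ _).
(* These are the values of [k] at which [p + k q] vanishes at some [w]. Where [q] vanishes the entry
   is 0 by convention, and [p] is already nonzero there. *)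
have [k kP] := avoid [seq - (at_y p).[w] / (at_y q).[w] | w <- z :: s].
exists (p + (k%:A)%:P * q); split.
  by rewrite !rmorphD !rmorphM p0 q0 mulr0 addr0.
move=> w ws; rewrite rmorphD rmorphM /= map_polyC hornerD hornerM hornerC /= KevalA.
have [qw|qw] := eqVneq (at_y q).[w] 0.
  rewrite qw mulr0 addr0; apply: pP; move: ws; rewrite inE => /orP[/eqP E|//].
  by rewrite -E qw eqxx in qz.
apply: contraNneq kP => /eqP; rewrite addrC addr_eq0 => /eqP E.
apply/mapP; exists w => //; rewrite -E mulfK //.
Qed.

(* Otherwise [P] and some [p] in the kernel have no common root over [y]; their
   resultant is then a constant in the kernel that does not vanish at [y]. *)
Lemma common_root : exists2 z, root (at_y P) z &
  forall p, pi (eval p) = 0 -> (at_y p).[z] = 0.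
Proof.
apply: contrapT => none.
have [s sE] := closed_field_poly_normal (at_y P).
have memS z : (z \in s) = root (at_y P) z.
  by rewrite [in RHS]sE (monicP (at_y_monic P_monic)) scale1r root_prod_XsubC.
have [z|p [p0 pP]] := @combine s.
  rewrite memS => rz; apply: contrapT => noz; apply: none; exists z => // p p0.
  by apply/eqP; apply: contrapT => /negP pz; apply: noz; exists p.
have sP : (1 < size P)%N.
  rewrite ltnNge; apply/negP => sP; have PE := size1_polyC sP.
  have P1 : P`_0 = 1 by have := monicP P_monic; rewrite {1}PE lead_coefC.
  move: P_ker; rewrite PE P1 !rmorph1 => /eqP.
  by rewrite oner_eq0.
(* A monic substitute for [p] with the same values at the roots of [P]: both leading coefficients
   are then 1, and the resultant commutes with evaluation at [y]. *)
pose p' := P * 'X^(size p) + p.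
have sPX : size (P * 'X^(size p)) = (size P + size p)%N.
  by rewrite size_Mmonic ?monicXn ?monic_neq0 // size_polyXn addnS.
have lt_p : (size p < size (P * 'X^(size p))%R)%N.
  by rewrite sPX -addn1 addnC leq_add2r ltnW.
have p'm : p' \is monic.
  by apply/monicP; rewrite lead_coefDl // lead_coef_Mmonic ?monicXn // (monicP P_monic).
have sp' : (1 < size p')%N by rewrite size_polyDl // sPX ltn_addr.
have p'0 : pi (eval p') = 0 by rewrite !(rmorphD, rmorphM) P_ker p0 mul0r addr0.
have p'root z : root (at_y P) z -> root (at_y p') z -> (at_y p).[z] = 0.
  move=> /rootP Pz /rootP; rewrite /p' rmorphD rmorphM hornerD hornerM Pz.
  by rewrite mul0r add0r.
clearbody p'; have [[u v] _ uvE] := resultant_in_ideal sP sp'.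
have : Keval y (resultant P p') = 0.
  apply: y_ker; rewrite -(ext_evalC psi eta) uvE /=.
  by rewrite !(rmorphD, rmorphM) P_ker p'0 !mulr0 addr0.
rewrite map_resultant_rmorph ?(monicP P_monic) ?(monicP p'm) ?rmorph1 ?oner_neq0 //.
move/eqP; rewrite resultant_eq0 => /gtn_eqF/negbT.
case/closed_rootP => z; rewrite root_gcd => /andP[Pz p'z].
by have := pP z; rewrite memS Pz => /(_ isT)/eqP; apply; apply: p'root.
Qed.

End CommonRoot.

Theorem Ktate_nullstellensatz n (Q : comNzRingType) (pi : {rmorphism T n -> Q}) :
  exists y : 'rV[Ra]_n, forall f, pi f = 0 -> Keval y f = 0.
Proof.
have triv l (pi' : {rmorphism T l -> Q}) : injective pi' ->
    exists y : 'rV[Ra]_l, forall f, pi' f = 0 -> Keval y f = 0.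
  by move=> inj; exists 0 => f; rewrite -(rmorph0 pi') => /inj ->; rewrite rmorph0.
elim: n pi => [|n IH] pi; first exact/triv/T0_injective.
case: (kernel_or_injective pi) => [/triv//|[f f0 pf]].
have [psi [eta [P [psiA Pm [q PE] div pts]]]] := prep f0.
have [y yP] := IH (pi \o psi).
have P0 : pi (ext_eval psi eta P) = 0 by rewrite PE rmorphM pf mulr0.
have [z Pz zP] := common_root Pm P0 yP.
have [Pint lift] := pts y.
(* [z] is a root of a monic polynomial over [Ra], hence a legitimate coordinate. *)
have zV : z \in vset Ra.
  apply: vring_integral Pz; first exact: monic_map.
  by move=> i; rewrite coef_map; apply: Pint.
have [y' [y'psi y'eta]] := lift (Sub z zV).
exists y' => g g0.
have evalE p : Keval y' (ext_eval psi eta p) = (map_poly (Keval y) p).[z].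
  rewrite /ext_eval -horner_map y'eta SubK -map_poly_comp.
  by congr _.[_]; apply: eq_map_poly => c /=; rewrite y'psi.
(* Modulo the value of [P], which vanishes at [y'], any [g] in the kernel is a polynomial [r] in
   [eta] also killed by [pi], and [z] was chosen to be a zero of all such [r]. *)
have [q' [r [_ gE]]] := div g.
have r0 : pi (ext_eval psi eta r) = 0.
  by move: g0; rewrite gE rmorphD rmorphM P0 mulr0 add0r.
rewrite gE rmorphD rmorphM !evalE (zP _ r0) addr0.
by move/rootP: Pz => ->; rewrite mulr0.
Qed.

End Main.

Theorem theorem6p16
    (A : comNzRingType) (oA : idealr A)
    (A_noeth : noetherian A)
    (A_sep : adic_separated [set` oA])
    (A_complete : adic_complete [set` oA])
    (K : fieldType) (R : valuation_subring K) (iR : Aring_structure oA R)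
    (R_viable : viable iR)
    (Ka : closedFieldType) (Ra : valuation_subring Ka)
    (iRa : Aring_structure oA Ra)
    (j : {rmorphism K -> Ka})
    (j_valued : forall z : K, (j z \in vset Ra) = (z \in vset R))
    (e : {rmorphism R -> Ra})
    (e_incl : forall x : R, val (e x) = j (val x))
    (Ra_extends : extends iR iRa e)
    (n : nat) :
  noetherian (Ktate iR n) /\
  forall I : idealr (Ktate iR n),
    (exists (m : nat) (phi : {rmorphism Ktate iR m -> {ideal_quot I}}),
       [/\ (m <= n)%N,
           forall k : K, phi k%:A = \pi_({ideal_quot I}) k%:A,
           injective phi
         & exists (d : nat) (b : 'I_d -> {ideal_quot I}),
             forall q, exists c : 'I_d -> Ktate iR m,
               q = \sum_(i < d) phi (c i) * b i]) /\
    (exists y : 'rV[Ra]_n,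
       forall f, f \in I -> forall v : Ka, Ktate_eval iRa e f y v -> v = 0).
Proof.
split.
  exact: (Ktate_noetherian A_noeth A_sep A_complete R_viable e_incl Ra_extends).
move=> I; pose pi : {rmorphism Ktate iR n -> {ideal_quot I}} := \pi_({ideal_quot I}).
split.
  have [m [theta [le_mn thetaA inj [T [b bP]]]]] :=
    Ktate_normalization A_noeth A_sep A_complete R_viable e_incl Ra_extends pi.
  exists m, (pi \o theta); split=> // [k|]; first by rewrite /= thetaA.
  exists #|T|, (fun i => pi (b (enum_val i))) => q.
  have [c cE] := bP (repr q); exists (fun i => c (enum_val i)).
  rewrite -[LHS]reprK [LHS]cE rmorph_sum (reindex (@enum_val T predT)) /=.
    by apply: eq_bigr => i _; rewrite rmorphM.
  by apply: onW_bij; apply: enum_val_bij.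
have [y yP] :=
  Ktate_nullstellensatz A_noeth A_sep A_complete R_viable e_incl Ra_extends pi.
exists y => f fI v /(Keval_unique A_noeth A_sep A_complete e_incl Ra_extends) ->.
apply: yP; apply/eqP; rewrite -(rmorph0 pi).
by rewrite /pi /= -Quotient.idealrBE subr0.
Qed.
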